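(* Fix a unit $n\in[N]$ and a counterfactual treatment assignment $\tilde a\in[D]^N$, with donor set $\mathcal I=\mathcal I^{(n)}$. Suppose: (1) $Y^{(a)}_{t,i}=Y^{(a_{\mathcal N(i)})}_{t,i}$ for all $t\in[T]$, $i\in[N]$, $a\in[D]^N$; (2) there are latent factors $u_{j,i},w_{t,b}\in\mathbb R^r$ such that for all $t,i,a$: $Y^{(a_{\mathcal N(i)})}_{t,i}=\sum_{j\in\mathcal N(i)}\langle u_{j,i},w_{t,a_j}\rangle+\epsilon^{(a_{\mathcal N(i)})}_{t,i}$ with $\mathbb E[\epsilon^{(a_{\mathcal N(i)})}_{t,i}\mid LF]=0$; (3) $Y^{(a_{\mathcal N(i)})}_{t,i}\perp A\mid LF$ for all $i,t,a$; (4) $\mathcal I$ is non-empty and $\tilde u_{n,\mathcal N(n)}$ lies in the linear span of $\{\tilde u_{i,\pi_i(\mathcal N(i))}\}_{i\in\mathcal I}$; (5) the rowspace of $\mathbb E[Z_{\mathrm{pr},\mathcal I}\mid LF,A]$ lies within the rowspace of $\mathbb E[Z_{\mathrm{tr},\mathcal I}\mid LF,A]$; (6) conditioned on $LF$, the $\epsilon^{(a_{\mathcal N(i)})}_{t,i}$ are independent sub-Gaussian with $\mathrm{Var}(\epsilon^{(a_{\mathcal N(i)})}_{t,i}\mid LF)=\sigma^2$ and $\|\epsilon^{(a_{\mathcal N(i)})}_{t,i}\mid LF\|_{\psi_2}\le\xi\sigma$ for some constant $\xi>0$ (for all $i,t,a$); (7) $\mathbb E[Y^{(a_{\mathcal N(i)})}_{t,i}\mid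 LF]\in[-1,1]$ for all $i,t$ (and all $a$); (8) for parameters $\xi',\xi''>0$: $s_{r_{\mathrm{tr}}}/s_1\ge\xi'$ and $\|\mathbb E[Z_{\mathrm{tr},\mathcal I}\mid LF,A]\|_F^2\ge\xi''\,T_{\mathrm{tr}}|\mathcal I|$; (9) the hyperparameter of the estimator is $\kappa=r_{\mathrm{tr}}$, where $r_{\mathrm{tr}}\le r|\mathcal N(n)|$. Let $\Delta=\hat\alpha-\alpha$ and suppose in addition that $$\|\Delta\|_2=o_P\!\left(\min\left(\frac{\sigma\|\alpha\|_2}{\sqrt{T_{\mathrm{pr}}|\mathcal I|}},\ \sqrt{\frac{\|\alpha\|_2}{\sigma}}\right)\right).$$ Then, conditioned on $LF$ and $A$, $$\frac{\sqrt{T_{\mathrm{pr}}}}{\sigma\|\alpha\|_2}\big(\mathrm{IPO}_n-\widehat{\mathrm{IPO}}_n\big)\ \xrightarrow{d}\ \mathcal N(0,1)\qquad\text{as }T_{\mathrm{tr}},T_{\mathrm{pr}},|\mathcal I|\to\infty .$$ Moreover, with $\xi'''=\xi'\sqrt{\xi''}$, $$|\hat\sigma^2-\sigma^2|=O_P\!\left(\frac{r_{\mathrm{tr}}}{\sqrt{T_{\mathrm{tr}}}}+\frac{r_{\mathrm{tr}}^2\log(T_{\mathrm{tr}}|\mathcal I|)}{(\xi''')^4\min(T_{\mathrm{tr}},|\mathcal I|)}\right).$$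
   Context: $[X]=\{1,\dots,X\}$. There are $N$ units, $D$ treatments, $T$ measurements. $\mathcal G=([N],\mathcal E)$ is a fixed, known undirected graph with all self-edges included; $\mathcal N(n)=\{j:(j,n)\in\mathcal E\}$ (so $n\in\mathcal N(n)$), with a fixed ordering of its elements. For $a\in[D]^N$, $a_S$ is the subvector indexed by $S$. $Y^{(a)}_{t,n}$ is the real random potential outcome of unit $n$ at measurement $t$ under treatments $a$. Data: $A=[a^1,\dots,a^T]\in[D]^{N\times T}$ is the observed treatment assignment; $Z\in\mathbb R^{T\times N}$, $Z_{t,n}=Y^{(a^t)}_{t,n}$. $\mathcal T_{\mathrm{tr}}=\{1,\dots,T_{\mathrm{tr}}\}$ and $\mathcal T_{\mathrm{pr}}=\{T_{\mathrm{tr}}+1,\dots,T\}$, $T_{\mathrm{pr}}=|\mathcal T_{\mathrm{pr}}|\ge1$; $a^t=a^{\mathrm{pr}}$ for all $t\in\mathcal T_{\mathrm{pr}}$. $M[S_1,S_2]$ is a submatrix. $LF=\{u_{j,i},w_{t,b}\}$ is the collection of latent factors. $\tilde u_{n,\mathcal N(n)}\in\mathbb R^{r|\mathcal N(n)|}$ concatenates $u_{j,n}$, $j\in\mathcal N(n)$, in the fixed order; $\tilde u_{i,\pi_i(\mathcal N(i))}$ does so for unit $i$ in the order given by $\pi_i$. Donor set $\mathcal I^{(n)}$: all units $i\ne n$ with $|\mathcal N(i)|=|\mathcal N(n)|$ for which there is a permutation $\pi_i$ of $\mathcal N(i)$ (fixed for each donor) with $A[\pi_i(\mathcal N(i)),\mathcal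 T_{\mathrm{tr}}]=A[\mathcal N(n),\mathcal T_{\mathrm{tr}}]$ and $a^{\mathrm{pr}}_{\pi_i(\mathcal N(i))}=\tilde a_{\mathcal N(n)}$. $z_{\mathrm{tr},n}=Z[\mathcal T_{\mathrm{tr}},n]$, $Z_{\mathrm{tr},\mathcal I}=Z[\mathcal T_{\mathrm{tr}},\mathcal I]$, $Z_{\mathrm{pr},\mathcal I}=Z[\mathcal T_{\mathrm{pr}},\mathcal I]$. $r_{\mathrm{tr}}$ is the rank of $\mathbb E[Z_{\mathrm{tr},\mathcal I}\mid LF,A]$ and $s_1\ge\dots\ge s_{r_{\mathrm{tr}}}$ its nonzero singular values. $\|\cdot\|_{\psi_2}$ is the sub-Gaussian Orlicz norm (of the conditional law). Estimand: $\mathrm{IPO}_n=\frac1{T_{\mathrm{pr}}}\sum_{t\in\mathcal T_{\mathrm{pr}}}\mathbb E[Y^{(\tilde a_{\mathcal N(n)})}_{t,n}\mid LF]$. Define $\alpha=\mathbb E[Z_{\mathrm{tr},\mathcal I}\mid LF,A]^+\,\mathbb E[z_{\mathrm{tr},n}\mid LF,A]$ (${}^+$ is the pseudo-inverse). NSI estimator with hyperparameter $\kappa$: let $(\hat s_\ell,\hat\mu_\ell,\hat\nu_\ell)$ be the singular values (in decreasing order), left and right singular vectors of $Z_{\mathrm{tr},\mathcal I}$; $\hat\alpha=\big(\sum_{\ell=1}^{\kappa}\hat s_\ell^{-1}\hat\nu_\ell\hat\mu_\ell^\top\big)z_{\mathrm{tr},n}$, $\widehat{\mathrm{IPO}}_n=\frac1{T_{\mathrm{pr}}}\mathbf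 1^\top Z_{\mathrm{pr},\mathcal I}\,\hat\alpha$, and $\hat\sigma^2=\frac1{T_{\mathrm{tr}}}\|z_{\mathrm{tr},n}-Z_{\mathrm{tr},\mathcal I}\hat\alpha\|_2^2$. $X_m=O_P(\chi_m)$ means: for every $\varepsilon>0$ there are constants $c_\varepsilon,m_\varepsilon$ with $P(|X_m|>c_\varepsilon\chi_m)<\varepsilon$ for all $m\ge m_\varepsilon$; $X_m=o_P(\chi_m)$ means $X_m/\chi_m\to0$ in probability. These are along sequences of problem instances with $T_{\mathrm{tr}},T_{\mathrm{pr}},|\mathcal I|\to\infty$, with $\sigma$ and $\xi$ fixed, and with probability conditional on $LF$ and $A$.
   Formalization: Assumption (3) is taken jointly: the whole family of potential outcomes is independent of A given LF. With each Y only separately independent of A, A could reveal that all prediction noises coincide, and the limit law fails. *)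

(* Defs.v *)
From HB Require Import structures.
From mathcomp Require Import all_boot all_order all_algebra.
From mathcomp Require Import all_classical all_reals all_analysis.

Set Implicit Arguments.
Unset Strict Implicit.
Unset Printing Implicit Defensive.

Import Order.TTheory GRing.Theory Num.Theory.
Import numFieldNormedType.Exports.

Local Open Scope classical_set_scope.
Local Open Scope ring_scope.

Section LinearAlgebra.
Context {R : realType}.

Definition frob m n (A : 'M[R]_(m, n)) : R :=
  Num.sqrt (\sum_i \sum_j A i j ^+ 2).

(* The Euclidean norm of a column vector is its Frobenius norm. *)
Definition norm2 m (v : 'cV[R]_m) : R := frob v.

Definition is_mpinv m n (A : 'M[R]_(m, n)) (B : 'M[R]_(n, m)) : Prop :=
  [/\ A *m B *m A = A, B *m A *m B = B,
      (A *m B)^T = A *m B & (B *m A)^T = B *m A].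

(* The Moore-Penrose pseudo-inverse; it differs in general from the partial
   inverse [pinvmx] of mxalgebra. *)
Definition mpinv m n (A : 'M[R]_(m, n)) : 'M[R]_(n, m) :=
  xget 0 [set B | is_mpinv A B].

(* Thin singular value decomposition: the l-th columns of U and V are the left
   and right singular vectors of the l-th entry (from 0) of s, and
   A = \sum_l s`_l *: (col l U *m (col l V)^T). *)
Definition is_svd m n (A : 'M[R]_(m, n)) (s : seq R)
    (U : 'M[R]_(m, minn m n)) (V : 'M[R]_(n, minn m n)) : Prop :=
  [/\ size s = minn m n,
      sorted >=%O s /\ all (>= 0) s,
      U^T *m U = 1%:M,
      V^T *m V = 1%:M &
      A = U *m diag_mx (\row_l s`_l) *m V^T].

(* All minn m n singular values, in decreasing order and with multiplicity;
   the first \rank A of them are the nonzero ones. *)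
Definition singular_values m n (A : 'M[R]_(m, n)) : seq R :=
  xget [::] [set s | exists U V, is_svd A s U V].

End LinearAlgebra.

Section SigmaAlgebras.
Context {R : realType} {Om : Type}.

Definition sigma_gen (S : set (Om -> R)) : set (set Om) :=
  <<s [set E | exists X : Om -> R, exists B : set R,
               [/\ S X, measurable B & E = X @^-1` B]] >>.

Definition sigma_mx m n (X : Om -> 'M[R]_(m, n)) : set (set Om) :=
  sigma_gen [set f | exists i j, f = (fun x => X x i j)].

Definition measurable_for (G : set (set Om)) (f : Om -> R) : Prop :=
  forall B : set R, measurable B -> G (f @^-1` B).

End SigmaAlgebras.

Section Probability.
Context {d : measure_display} {Om : measurableType d} {R : realType}.

(* K is a regular conditional probability given the sub-sigma-algebra G. *)
Definition is_rcp (P : probability Om R) (G : set (set Om))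
    (K : Om -> probability Om R) : Prop :=
  forall B, measurable B ->
    measurable_for G (fun x => fine (K x B)) /\
    (forall C, G C -> (\int[P]_(x in C) K x B = P (C `&` B))%E).

Definition mean_mx (Q : probability Om R) m n (X : Om -> 'M[R]_(m, n)) :
    'M[R]_(m, n) :=
  \matrix_(i, j) fine 'E_Q[fun x => X x i j].

Definition psi2_norm (Q : probability Om R) (X : Om -> R) : \bar R :=
  ereal_inf [set c%:E | c in
    [set c : R | 0 < c /\ ('E_Q[fun x => expR ((X x / c) ^+ 2)] <= 2%:E)%E]].

Definition mutually_independent (Q : probability Om R) (I : finType)
    (J : {set I}) (X : I -> Om -> R) : Prop :=
  forall (J' : {set I}) (B : I -> set R), J' \subset J ->
    (forall i, measurable (B i)) ->
    fine (Q (\bigcap_(i in [set` J']) X i @^-1` B i)) =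
    \prod_(i in J') fine (Q (X i @^-1` B i)).

Definition independent_sigma (Q : probability Om R) (G H : set (set Om)) :
    Prop :=
  forall E F, G E -> H F -> (Q (E `&` F) = Q E * Q F)%E.

End Probability.

Section Asymptotics.
Context {R : realType} {d : nat -> measure_display}
  {Om : forall m, measurableType (d m)} (Q : forall m, probability (Om m) R).
Implicit Types (X : forall m, Om m -> R) (chi : nat -> R).

Definition OP X chi : Prop :=
  forall eps : R, 0 < eps -> exists c : R, exists m0 : nat,
    forall m, (m0 <= m)%N -> (Q m [set x | (c * chi m < `|X m x|)%R] < eps%:E)%E.

(* X_m / chi_m --> 0 in probability; the first clause says that the quotient
   is meaningful (division by 0 would return 0). *)
Definition oP X chi : Prop :=
  (\forall m \near \oo, 0 < chi m) /\
  forall eps : R, 0 < eps ->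
    Q m [set x | eps < `|X m x / chi m|] @[m --> \oo] --> 0%E.

(* Convergence of the distribution functions at every continuity point of the
   limiting one. *)
Definition cvg_in_distribution X (nu : set R -> \bar R) : Prop :=
  forall y : R, nu [set y] = 0%E ->
    Q m [set x | X m x <= y] @[m --> \oo] --> nu `]-oo, y]%classic.

End Asymptotics.

Record panel (R : realType) := Panel {
  disp : measure_display;
  Om : measurableType disp;
  P : probability Om R;
  nunit : nat;
  ntreat : nat;
  rk : nat;
  Ttr : nat;
  Tpr : nat;
  Tpr_gt0 : (0 < Tpr)%N;
  edge : rel 'I_nunit;
  edge_sym : symmetric edge;
  edge_refl : reflexive edge;
  (* nbr i lists the neighbourhood of i in its fixed order *)
  nbr : 'I_nunit -> seq 'I_nunit;
  nbr_uniq : forall i, uniq (nbr i);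
  mem_nbr : forall i j, (j \in nbr i) = edge j i;
  (* latent factors; u j i is only meaningful for j in nbr i *)
  u : 'I_nunit -> 'I_nunit -> Om -> 'rV[R]_rk;
  w : 'I_(Ttr + Tpr) -> 'I_ntreat -> Om -> 'rV[R]_rk;
  measurable_u : forall j i k, measurable_fun setT (fun x => u j i x 0 k);
  measurable_w : forall t b k, measurable_fun setT (fun x => w t b x 0 k);
  (* observed assignment; its t-th column is a^t *)
  A : Om -> 'M['I_ntreat]_(nunit, Ttr + Tpr);
  measurable_A : forall a, measurable (A @^-1` [set a]);
  A_pr : forall x j t t', A x j (rshift Ttr t) = A x j (rshift Ttr t');
  (* Y t i a is the outcome of unit i at measurement t under a *)
  Y : 'I_(Ttr + Tpr) -> 'I_nunit -> {ffun 'I_nunit -> 'I_ntreat} -> Om -> R;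
  measurable_Y : forall t i a, measurable_fun setT (Y t i a)
}.

Notation assignment p := {ffun 'I_(nunit p) -> 'I_(ntreat p)}.

Section Panel.
Context {R : realType} (p : panel R).
Implicit Types (i n : 'I_(nunit p)) (t : 'I_(Ttr p + Tpr p)).
Implicit Types (a : assignment p) (I : {set 'I_(nunit p)}) (x : Om p).

Definition restr i a : seq 'I_(ntreat p) := [seq a j | j <- nbr i].

Definition sigma_LF : set (set (Om p)) :=
  sigma_gen [set X : Om p -> R |
    (exists j i k, j \in nbr i /\ X = (fun x => u j i x 0 k)) \/
    (exists t b k, X = (fun x => w t b x 0 k))].

Definition sigma_A : set (set (Om p)) :=
  <<s [set E | exists b, E = @A R p @^-1` [set b]] >>.

Definition sigma_LFA : set (set (Om p)) := <<s sigma_LF `|` sigma_A >>.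

Definition sigma_Y : set (set (Om p)) :=
  sigma_gen [set X : Om p -> R | exists t i a, X = Y t i a].

Definition factor_mean t i a x : R :=
  \sum_(j <- nbr i) \sum_(k < rk p) u j i x 0 k * w t (a j) x 0 k.

Definition noise t i a x : R := Y t i a x - factor_mean t i a x.

Definition local_interference : Prop :=
  forall t i a a', restr i a = restr i a' -> Y t i a = Y t i a'.

(* The index set of the noise is that of the triples (t, i, a_{N(i)}), and two
   assignments that agree on N(i) have the same noise: J ranges over the
   finite sets of triples (t, i, a) that are distinct as (t, i, a_{N(i)}). *)
Definition independent_noise (Q : probability (Om p) R) : Prop :=
  forall J : {set 'I_(Ttr p + Tpr p) * 'I_(nunit p) * assignment p},
    {in J &, injective (fun y => (y.1, restr y.1.2 y.2))} ->
    mutually_independent Q J (fun y => noise y.1.1 y.1.2 y.2).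

(* s is an ordering of the neighbourhood of some unit along which the observed
   assignment A matches n under A (training) and under ta (prediction). *)
Definition matching (A : 'M['I_(ntreat p)]_(nunit p, Ttr p + Tpr p)) n
    (ta : assignment p) (s : seq 'I_(nunit p)) : bool :=
  [forall t : 'I_(Ttr p),
     [seq A j (lshift (Tpr p) t) | j <- s] ==
     [seq A j (lshift (Tpr p) t) | j <- nbr n]] &&
  [forall t : 'I_(Tpr p), [seq A j (rshift (Ttr p) t) | j <- s] == restr n ta].

Definition donors A n ta : {set 'I_(nunit p)} :=
  [set i | [&& i != n, size (nbr i) == size (nbr n)
             & has (matching A n ta) (permutations (nbr i))]].

Definition donor_orderings A n ta (pi : 'I_(nunit p) -> seq 'I_(nunit p)) :
    Prop :=
  forall i, i \in donors A n ta ->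
    perm_eq (pi i) (nbr i) /\ matching A n ta (pi i).

(* Concatenation of the u_{j,i} for j in s; q is the length of s, kept apart so
   that units with neighbourhoods of equal sizes give vectors of one type. *)
Definition utilde q i (s : seq 'I_(nunit p)) x : 'rV[R]_(q * rk p) :=
  mxvec (\matrix_(l < q) u (nth i s l) i x).

Definition in_donor_span n I (pi : 'I_(nunit p) -> seq 'I_(nunit p)) x : Prop :=
  let q := size (nbr n) in
  (utilde q n (nbr n) x <=
   \matrix_(k < #|I|) utilde q (enum_val k) (pi (enum_val k)) x)%MS.

Definition Z x : 'M[R]_(Ttr p + Tpr p, nunit p) :=
  \matrix_(t, i) Y t i [ffun j => A x j t] x.

Definition ztr n x : 'cV[R]_(Ttr p) := col n (usubmx (Z x)).
Definition Ztr I x : 'M[R]_(Ttr p, #|I|) :=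
  colsub (@enum_val _ (mem I)) (usubmx (Z x)).
Definition Zpr I x : 'M[R]_(Tpr p, #|I|) :=
  colsub (@enum_val _ (mem I)) (dsubmx (Z x)).

(* Below, Q is the conditional law given the latent factors and A, except in
   IPO, where it is the conditional law given the latent factors only. *)
Definition EZtr (Q : probability (Om p) R) I := mean_mx Q (Ztr I).
Definition EZpr (Q : probability (Om p) R) I := mean_mx Q (Zpr I).
Definition rtr (Q : probability (Om p) R) I : nat := \rank (EZtr Q I).
Definition alpha (Q : probability (Om p) R) I n : 'cV[R]_#|I| :=
  mpinv (EZtr Q I) *m mean_mx Q (ztr n).

Definition IPO (Q : probability (Om p) R) n (ta : assignment p) : R :=
  (Tpr p)%:R^-1 * \sum_(t < Tpr p) fine 'E_Q[Y (rshift (Ttr p) t) n ta].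

(* Singular vectors are not unique: mu and nu are any choice that depends
   measurably on Ztr I, and on nothing else. *)
Definition svd_of_Ztr I (s : Om p -> seq R)
    (mu : Om p -> 'M[R]_(Ttr p, minn (Ttr p) #|I|))
    (nu : Om p -> 'M[R]_(#|I|, minn (Ttr p) #|I|)) : Prop :=
  [/\ forall x, is_svd (Ztr I x) (s x) (mu x) (nu x),
      forall k l, measurable_for (sigma_mx (Ztr I)) (fun x => mu x k l) &
      forall k l, measurable_for (sigma_mx (Ztr I)) (fun x => nu x k l)].

Definition alpha_hat (kappa : nat) n I (s : Om p -> seq R)
    (mu : Om p -> 'M[R]_(Ttr p, minn (Ttr p) #|I|))
    (nu : Om p -> 'M[R]_(#|I|, minn (Ttr p) #|I|)) x : 'cV[R]_#|I| :=
  (\sum_(l < minn (Ttr p) #|I| | (l < kappa)%N)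
     ((s x)`_l)^-1 *: (col l (nu x) *m (col l (mu x))^T)) *m ztr n x.

Definition IPO_hat I (ah : Om p -> 'cV[R]_#|I|) x : R :=
  (Tpr p)%:R^-1 * \sum_(t < Tpr p) (Zpr I x *m ah x) t 0.

Definition sigma2_hat n I (ah : Om p -> 'cV[R]_#|I|) x : R :=
  (Ttr p)%:R^-1 * norm2 (ztr n x - Ztr I x *m ah x) ^+ 2.

End Panel.

(* Main.v *)
Require Import Defs.
From mathcomp Require Import all_boot all_order all_algebra.
From mathcomp Require Import all_classical all_reals all_analysis.
From mathcomp Require Import measurable_realfun ring lra.

Set Implicit Arguments.
Unset Strict Implicit.
Unset Printing Implicit Defensive.

Import Order.TTheory GRing.Theory Num.Theory.
Import numFieldNormedType.Exports.

Local Open Scope classical_set_scope.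
Local Open Scope ring_scope.

(* Given (LF, A), the outcomes have the law they have given LF alone, so
   Z = F + eps with F constant and eps independent, centered, of variance sigma^2
   and bounded fourth moment.  The span and row space conditions give
   IPO_n = T_pr^-1 1^T F_pr alpha, whence
     IPO_n - IPO_hat_n = - T_pr^-1 1^T (eps_pr alpha + Z_pr Delta).
   The first term is a weighted sum of independent shocks, asymptotically normal by
   Stein's method; the second is negligible by the rate assumed on Delta and a
   second moment bound on 1^T eps_pr.

   The fitted residual is (1 - P) z for the projection P on the leading left
   singular vectors of Z_tr, a function of the donors' shocks and so independent of
   the shocks of n.  Its bias (1 - P) F_tr alpha is controlled by Weyl's inequality
   and by alpha = F_tr^T b with |b| <= |alpha| / s_r; bounding the operator norm of
   the noise by |E^T E|_F, whose square has mean O(T_tr^2 |I| + T_tr |I|^2), yields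
   a first moment bound on |sigma_hat^2 - sigma^2|, without the logarithm. *)

(** * Stein equation for the standard normal law *)

(** The two conditional laws are kernels determined up to null sets, so their good properties are
    gathered into one almost sure statement; past it, all work is done at a fixed outcome, and the
    null set precedes the choice of orderings and of singular vectors. Each weight of the main sum
    is, up to sign, a coordinate of [alpha] over [sqrt T_pr sigma |alpha|], hence small by the mere
    number of prediction measurements, however [alpha] is spread over the donors. A fourth moment
    bound then takes the place of the Lindeberg condition, and the constants of Stein's method may
    depend on the test function, which is fixed before the limit. The remainder pairs [Delta] with
    the donors' column sums of [Z_pr], of norm at most of order [T_pr sqrt |I|]; Cauchy-Schwarz
    turns this into the first term of the minimum in the rate. For the variance, condition number
    and signal strength give [|alpha|^2 <= r / (xi'''^2 |I|)] and
    [|b|^2 <= r^2 / (xi'''^4 T_tr |I|^2)], the source of the powers of [r] and xi''' in the rate;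
    the projected shocks cost at most [r sigma^2] in mean, the projection having trace at most
    [r]. *)

Section Stein.
Context {R : realType}.
Notation mu := (@lebesgue_measure R).
Implicit Types x y : R.

Let phi : R -> R := normal_pdf 0 1.
Let peak : R := normal_peak 1.

Let phiE x : phi x = peak * expR (- (x ^+ 2 / 2)).
Proof.
by rewrite /phi normal_pdfE ?oner_neq0// /normal_fun subr0 expr1n mulNr.
Qed.

Let peak_gt0 : 0 < peak. Proof. by rewrite normal_peak_gt0 ?oner_neq0. Qed.

Let phi_gt0 x : 0 < phi x.
Proof. by rewrite phiE mulr_gt0 ?expR_gt0. Qed.

Let phiN x : phi (- x) = phi x. Proof. by rewrite !phiE sqrrN. Qed.

Let phi_cont : continuous phi.
Proof. by move=> x; exact: continuous_normal_pdf (oner_neq0 _) _. Qed.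

Let phi_int : mu.-integrable setT (EFin \o phi).
Proof. exact: integrable_normal_pdf. Qed.

Lemma is_derive_normal_pdf x : is_derive x 1 (normal_pdf 0 1) (- x * normal_pdf 0 1 x).
Proof.
have -> : normal_pdf 0 1 = (fun y : R => peak * expR (- (y ^+ 2 / 2))).
  by apply/funext => y; exact: phiE.
have d1 : is_derive x 1 (fun y : R => - (y ^+ 2 / 2)) (- x).
  apply: is_derive_eq; rewrite !scaler0 add0r.
  by rewrite /GRing.scale /=; field.
have d2 : is_derive x 1 (fun y : R => expR (- (y ^+ 2 / 2)))
    (expR (- (x ^+ 2 / 2)) * - x).
  exact: (@is_derive1_comp _ expR (fun y : R => - (y ^+ 2 / 2))).
apply: is_derive_eq.
by rewrite /GRing.scale /=; ring.
Qed.

Let phi_cvg : phi x @[x --> +oo] --> 0.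
Proof.
apply: (@squeeze_cvgr _ _ _ _ (fun=> 0) (fun x : R => peak * expR (- x))).
- near=> x; rewrite (ltW (phi_gt0 _))/= phiE ler_pM2l// ler_expR lerN2.
  have x2 : 2 <= x by near: x; apply: nbhs_pinfty_ge; rewrite num_real.
  nra.
- exact: cvg_cst.
- rewrite -[X in _ --> X](mulr0 peak); apply: cvgM; [exact: cvg_cst|exact: cvgr_expR].
Unshelve. all: by end_near. Qed.

(** Its quotient by the density is the Mills ratio, of which the Stein solution is a constant
    multiple far to the right and, after reflection, far to the left. *)
Definition normal_tail x : R := \int[mu]_(t in `[x, +oo[) (normal_pdf 0 1 t).

(** [- phi] is a primitive of [t * phi t], so the latter has integral [phi x] over [[x, +oo[]; and
    [x <= t] on that ray. *)
Lemma normal_tail_ub x : 0 < x -> x * normal_tail x <= normal_pdf 0 1 x.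
Proof.
move=> x0.
have cid : continuous (fun t : R => t * phi t).
  by move=> t; apply: cvgM; [exact: cvg_id|exact: phi_cont].
have key : (\int[mu]_(t in `[x, +oo[) (t * phi t)%:E = (phi x)%:E)%E.
  rewrite (@ge0_continuous_FTC2y _ _ (fun t => - phi t) _ 0).
  - by rewrite EFinN oppeK add0e.
  - by move=> t xt; rewrite mulr_ge0 ?(ltW (phi_gt0 _))// (le_trans (ltW x0)).
  - exact/continuous_subspaceT.
  - by rewrite -oppr0; apply: cvgN; exact: phi_cvg.
  - move=> t _; apply: derivableN.
    by have := is_derive_normal_pdf t; case.
  - by apply: cvg_at_right_filter; apply: cvgN; exact: phi_cont.
  - move=> t _; rewrite derive1E.
    have dphi : is_derive t (1:R) phi (- t * phi t) := is_derive_normal_pdf t.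
    have /@derive_val -> : is_derive t 1 (fun t => - phi t) (- (- t * phi t)).
      exact: is_deriveN.
    by rewrite mulNr opprK.
have i1 : mu.-integrable `[x, +oo[ (EFin \o phi).
  exact: integrableS phi_int.
have i2 : mu.-integrable `[x, +oo[ (EFin \o (fun t => t * phi t)).
  apply/integrableP; split.
    apply/measurable_EFinP; apply: measurable_funTS.
    exact: continuous_measurable_fun.
  under eq_integral => t.
    rewrite inE /= in_itv/= andbT => xt.
    rewrite ger0_norm; last first.
      by rewrite mulr_ge0 ?(ltW (phi_gt0 _))// (le_trans (ltW x0)).
    over.
  by rewrite key ltry.
rewrite /normal_tail -RintegralZl//.
rewrite -/phi; suff <- : \int[mu]_(t in `[x, +oo[) (t * phi t) = phi x.
  apply: le_Rintegral => //.
  - exact: (integrableZl _ x i1).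
  - by move=> t; rewrite /= in_itv/= andbT => xt; rewrite ler_pM2r.
by rewrite /Rintegral key.
Qed.

(** [- phi t / t] is a primitive of [(1 + t^-2) * phi t], and on the ray the first factor is at most
    [1 + x^-2]. *)
Lemma normal_tail_lb x : 0 < x ->
  x * normal_pdf 0 1 x <= (1 + x ^+ 2) * normal_tail x.
Proof.
move=> x0.
have xneq0 : x != 0 by rewrite gt_eqF.
pose k t : R := (1 + t^-1 ^+ 2) * phi t.
have k_ge0 t : 0 <= k t.
  by rewrite mulr_ge0 ?(ltW (phi_gt0 _))// addr_ge0// sqr_ge0.
have kc (t : R) : t != 0 -> {for t, continuous k}.
  move=> t0; apply: cvgM; last exact: phi_cont.
  apply: cvgD; first exact: cvg_cst.
  by rewrite expr2; under eq_fun do rewrite expr2; apply: cvgM; apply: cvgV.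
have pos t : t \in `]x, +oo[ -> t != 0.
  by rewrite in_itv/= andbT => xt; rewrite gt_eqF// (lt_trans x0).
have dk (t : R) : t != 0 -> is_derive t 1 (fun t => - (t^-1 * phi t)) (k t).
  move=> t0.
  have dphi : is_derive t (1:R) phi (- t * phi t) := is_derive_normal_pdf t.
  have dV : is_derive t (1:R) (fun t : R => t^-1) (- t ^- 2 *: 1).
    exact: is_deriveV.
  have d : is_derive t 1 (fun t => t^-1 * phi t)
      (t^-1 *: (- t * phi t) + phi t *: (- t ^- 2 *: 1)) := is_deriveM dV dphi.
  apply: is_derive_eq (is_deriveN d) _.
  rewrite /k /GRing.scale /=; field; exact: t0.
have key : (\int[mu]_(t in `[x, +oo[) (k t)%:E = (x^-1 * phi x)%:E)%E.
  rewrite (@ge0_continuous_FTC2y _ _ (fun t => - (t^-1 * phi t)) _ 0) //.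
  - by rewrite EFinN oppeK add0e.
  - apply/continuous_within_itvcyP; split => [t /pos|]; first exact: kc.
    by apply: cvg_at_right_filter; exact: kc.
  - rewrite -oppr0; apply: cvgN.
    apply: (@squeeze_cvgr _ _ _ _ (fun=> 0) phi); last 2 first.
      exact: cvg_cst.
      exact: phi_cvg.
    near=> t; have t1 : 1 <= t by near: t; apply: nbhs_pinfty_ge; rewrite num_real.
    rewrite mulr_ge0 ?(ltW (phi_gt0 _)) ?invr_ge0 ?(le_trans ler01)//=.
    by rewrite ler_piMl ?(ltW (phi_gt0 _))// invf_le1// (lt_le_trans ltr01).
  - move=> t xt; have t0 : t != 0 by rewrite gt_eqF// (lt_trans x0).
    by have := dk t t0; case.
  - apply: cvg_at_right_filter.
    have := dk x xneq0; case => /derivable1_diffP/differentiable_continuous + _.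
    exact.
  - by move=> t /pos t0; rewrite derive1E; have /@derive_val -> := dk t t0.
have mk : measurable_fun `[x, +oo[ (EFin \o (k : measurableTypeR R -> R)).
  apply/measurable_EFinP; apply: measurable_funM.
    apply: measurable_funD => //; apply: measurable_funX.
    have : measurable_fun (`]0, +oo[ : set (measurableTypeR R)) (fun t : R => t^-1).
      apply: open_continuous_measurable_fun; first exact: interval_open.
      by move=> t; rewrite inE /= in_itv/= andbT => t0; apply: cvgV => //; rewrite gt_eqF.
    apply: measurable_funS => //; apply: subset_itvr.
    by rewrite bnd_simp.
  by apply: measurable_funTS; exact: continuous_measurable_fun.
have i1 : mu.-integrable `[x, +oo[ (EFin \o phi).
  exact: integrableS phi_int.
have i2 : mu.-integrable `[x, +oo[ (EFin \o k).
  apply/integrableP; split => //.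
  under eq_integral => t _ do rewrite /= ger0_norm//.
  by rewrite key ltry.
have le1 : x^-1 * phi x <= (1 + x^-1 ^+ 2) * normal_tail x.
  rewrite /normal_tail -RintegralZl//.
  rewrite -/phi; suff <- : \int[mu]_(t in `[x, +oo[) k t = x^-1 * phi x.
    apply: le_Rintegral => //.
    - exact: (integrableZl _ (1 + x^-1 ^+ 2) i1).
    - move=> t; rewrite /= in_itv/= andbT => xt; rewrite ler_pM2r//.
      rewrite lerD2l lerXn2r ?nnegrE ?invr_ge0 ?(ltW x0) ?(le_trans (ltW x0))//.
      by rewrite lef_pV2// posrE (lt_le_trans x0).
  by rewrite /Rintegral key.
have -> : x * phi x = x ^+ 2 * (x^-1 * phi x) by field.
have -> : 1 + x ^+ 2 = x ^+ 2 * (1 + x^-1 ^+ 2) by field.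
by rewrite -mulrA ler_pM2l// exprn_gt0.
Unshelve. all: by end_near. Qed.

(** The Mills ratio [m] satisfies [m' = x * m - 1], so the second quantity is the derivative of
    [x * m]. It equals [m - x * (1 - x * m)], at most [m], hence at most 1 when [1 <= x]. *)
Let ftail_bounds x : 1 <= x ->
  0 <= normal_tail x / phi x <= 1 /\
  0 <= (1 + x ^+ 2) * (normal_tail x / phi x) - x <= 1.
Proof.
move=> x1; have x0 : 0 < x by rewrite (lt_le_trans ltr01).
pose m := normal_tail x / phi x.
have e : normal_tail x = m * phi x by rewrite divfK// gt_eqF.
have lb : x <= (1 + x ^+ 2) * m.
  by rewrite -(ler_pM2r (phi_gt0 x)) -mulrA -e; exact: normal_tail_lb.
have ub : x * m <= 1.
  by rewrite -(ler_pM2r (phi_gt0 x)) -mulrA -e mul1r; exact: normal_tail_ub.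
have t0 : 0 <= m.
  rewrite divr_ge0// ?(ltW (phi_gt0 _))// Rintegral_ge0// => t _.
  exact: ltW (phi_gt0 t).
rewrite -/m; clear e; clearbody m.
by split; apply/andP; split; nra.
Qed.

Section solution.
Variables (h : R -> R) (K L0 : R).
Hypothesis h_cont : continuous h.
Hypothesis h01 : forall x, 0 <= h x <= 1.
Hypothesis K1 : 1 <= K.
Hypothesis h1 : forall x, x <= - K -> h x = 1.
Hypothesis h0 : forall x, K <= x -> h x = 0.
Hypothesis L0_ge0 : 0 <= L0.
Hypothesis hL : forall x y, `|h x - h y| <= L0 * `|x - y|.

Let Nh : R := \int[mu]_t (h t * phi t).
Let q (t : R) : R := (h t - Nh) * phi t.
Let H (x : R) : R := \int[mu]_(t in `]-oo, x]) q t.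
(** Solves [f' - x * f = h - Nh] with integrating factor [phi]. Then [r'] is the derivative of
    [x * f x]; its boundedness makes [f' = h - Nh + x * f] Lipschitz. *)
Let f (x : R) : R := H x / phi x.
Let r' (x : R) : R := f x + x * (h x - Nh) + x ^+ 2 * f x.

Let hphi_int : mu.-integrable setT (EFin \o (fun t => h t * phi t)).
Proof.
apply: le_integrable phi_int => //.
  apply/measurable_EFinP; apply: measurable_funM; apply: continuous_measurable_fun => //.
move=> x _ /=; rewrite lee_fin normrM ler_piMl//.
by have /andP[? ?] := h01 x; rewrite ger0_norm.
Qed.

Let Nh01 : 0 <= Nh <= 1.
Proof.
apply/andP; split.
  apply: Rintegral_ge0 => x _; rewrite mulr_ge0 ?(ltW (phi_gt0 _))//.
  by have /andP[] := h01 x.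
have -> : 1 = \int[mu]_t phi t.
  by rewrite /Rintegral integral_normal_pdf.
apply: le_Rintegral => // x _; rewrite ler_piMl ?(ltW (phi_gt0 _))//.
by have /andP[] := h01 x.
Qed.

Let q_int : mu.-integrable setT (EFin \o q).
Proof.
have -> : EFin \o q = ((EFin \o (fun t => (h t * phi t)%R)) \- (fun t => Nh%:E * (EFin \o phi) t))%E.
  by apply/funext => t /=; rewrite /q mulrBl.
by apply: integrableB => //; exact: integrableZl.
Qed.

Let q_cont : continuous q.
Proof.
move=> x; apply: cvgM; last exact: phi_cont.
by apply: cvgB; [exact: h_cont|exact: cvg_cst].
Qed.

Let dH x : is_derive x (1:R) H (q x).
Proof.
have [] := @continuous_FTC1 _ q -oo%O x (x + 1).
- by rewrite ltrDl.
- exact: integrableS q_int.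
- exact: ltNyr.
- exact: q_cont.
move=> d e; split; first exact: d.
by rewrite -derive1E.
Qed.

Let df x : is_derive x (1:R) f (h x - Nh + x * f x).
Proof.
have dphi : is_derive x (1:R) phi (- x * phi x) := is_derive_normal_pdf x.
have p0 : phi x != 0 by rewrite gt_eqF.
have dV := is_deriveV p0 dphi.
apply: is_derive_eq (is_deriveM (dH x) dV) _.
rewrite /f /GRing.scale /= /q; field; exact: p0.
Qed.

Let dr x : is_derive x (1:R) (fun x : R => x * f x) (r' x).
Proof.
apply: is_derive_eq (is_deriveM (is_derive_id x 1) (df x)) _.
by rewrite /r' /GRing.scale /=; ring.
Qed.

Let f_cont : continuous f.
Proof.
by move=> x; have [/derivable1_diffP/differentiable_continuous] := df x.
Qed.

Let r'_cont : continuous r'.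
Proof.
move=> x; apply: cvgD; last first.
  apply: cvgM; last exact: f_cont.
  exact: exprn_continuous.
apply: cvgD; first exact: f_cont.
apply: cvgM; first exact: cvg_id.
by apply: cvgB; [exact: h_cont|exact: cvg_cst].
Qed.

Let f_right x : K <= x -> f x = Nh * (normal_tail x / phi x).
Proof.
move=> Kx; rewrite mulrA; congr (_ / _).
(* [q] has total integral 0, so [- H x] is its integral over the right tail, where [h] vanishes. *)
have q0 : \int[mu]_t q t = 0.
  have e t : q t = h t * phi t - Nh * phi t by rewrite /q mulrBl.
  under eq_Rintegral do rewrite e.
  rewrite RintegralB//; last exact: (integrableZl measurableT Nh phi_int).
  rewrite RintegralZl// -/Nh.
  have -> : \int[mu]_t phi t = 1 by rewrite /Rintegral integral_normal_pdf.
  by rewrite mulr1 subrr.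
have : 0 - H x = \int[mu]_(t in `]x, +oo[) q t.
  have <- := @Rintegral_itvB _ q -oo%O +oo%O x.
  - by rewrite set_itvE q0.
  - by rewrite set_itvE; exact: q_int.
  - by rewrite bnd_simp.
  - by rewrite bnd_simp.
rewrite sub0r => /eqP; rewrite eqr_oppLR => /eqP ->.
rewrite Rintegral_itv_obnd_cbnd; last exact: integrableS q_int.
have -> : \int[mu]_(t in `[x, +oo[) q t = \int[mu]_(t in `[x, +oo[) (- Nh * phi t).
  apply: eq_Rintegral => t; rewrite inE/= in_itv/= andbT => xt.
  by rewrite /q h0 ?sub0r// (le_trans Kx).
rewrite RintegralZl//; last exact: integrableS phi_int.
by rewrite mulNr opprK.
Qed.

Let f_left x : x <= - K -> f x = (1 - Nh) * (normal_tail (- x) / phi (- x)).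
Proof.
move=> Kx; rewrite phiN mulrA; congr (_ / _).
rewrite /H; have -> : \int[mu]_(t in `]-oo, x]) q t =
    \int[mu]_(t in `]-oo, x]) ((1 - Nh) * phi t).
  apply: eq_Rintegral => t; rewrite inE/= in_itv/= => xt.
  by rewrite /q h1// (le_trans xt).
rewrite RintegralZl//; last exact: integrableS phi_int.
congr (_ * _); rewrite /normal_tail /Rintegral; congr fine.
rewrite -{1}(opprK x) ge0_integration_by_substitutionNy.
- by apply: eq_integral => t _ /=; rewrite -/phi phiN.
- exact/continuous_subspaceT.
- by move=> t _; exact: ltW.
Qed.

Let outside x : K <= x -> `|f x| <= 1 /\ `|r' x| <= 1.
Proof.
move=> Kx; have [/andP[a1 a2] /andP[b1 b2]] := ftail_bounds (le_trans K1 Kx).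
have /andP[n0 n1] := Nh01.
rewrite /r' (f_right Kx) (h0 Kx).
move: a1 a2 b1 b2; set m := _ / _; clearbody m => *.
have n0' : 0 <= Nh by []. have n1' : Nh <= 1 by [].
split; first by rewrite ger0_norm ?mulr_ge0//; nra.
have -> : Nh * m + x * (0 - Nh) + x ^+ 2 * (Nh * m) =
  Nh * ((1 + x ^+ 2) * m - x) by ring.
by rewrite ger0_norm ?mulr_ge0// mulr_ile1.
Qed.

Let outside' x : x <= - K -> `|f x| <= 1 /\ `|r' x| <= 1.
Proof.
move=> Kx; have Kx' : K <= - x by rewrite lerNr.
have [/andP[a1 a2] /andP[b1 b2]] := ftail_bounds (le_trans K1 Kx').
have /andP[n0 n1] := Nh01.
rewrite /r' (f_left Kx) (h1 Kx).
move: a1 a2 b1 b2; set m := _ / _; clearbody m => *.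
have n0' : 0 <= 1 - Nh by rewrite subr_ge0.
have n1' : 1 - Nh <= 1 by rewrite gerBl.
split; first by rewrite ger0_norm ?mulr_ge0// mulr_ile1.
have -> : (1 - Nh) * m + x * (1 - Nh) + x ^+ 2 * ((1 - Nh) * m) =
  (1 - Nh) * ((1 + (- x) ^+ 2) * m - (- x)) by ring.
by rewrite ger0_norm ?mulr_ge0// mulr_ile1.
Qed.

Let bounded_of (g : R -> R) : continuous g ->
  (forall x, K <= x -> `|g x| <= 1) -> (forall x, x <= - K -> `|g x| <= 1) ->
  exists2 B : R, 0 <= B & forall x, `|g x| <= B.
Proof.
move=> gc gr gl.
have [c _ cM] : exists2 c, c \in `[- K, K]%R &
    forall t, t \in `[- K, K]%R -> `|g t| <= `|g c|.
  apply: (@EVT_max _ (fun x => `|g x|)).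
    by rewrite (@le_trans _ _ 0)// ?oppr_le0 (le_trans ler01).
  apply: continuous_subspaceT => x; apply: cvg_norm; exact: gc.
exists (Num.max 1 `|g c|) => [|x]; first by rewrite le_max ler01.
rewrite le_max; have [/gr ->//|xK] := leP K x.
have [/gl ->//|Kx] := leP x (- K).
by rewrite cM ?orbT// in_itv/= !ltW.
Qed.

Let lip_of (g g' : R -> R) (B : R) : (forall x, is_derive x (1:R) g (g' x)) ->
  (forall x, `|g' x| <= B) -> forall x y, `|g x - g y| <= B * `|x - y|.
Proof.
move=> dg gB; have key x y : y <= x -> `|g x - g y| <= B * `|x - y|.
  move=> yx; have [|c _ ->] := @MVT_segment _ g g' y x yx (fun x _ => dg x).
    apply: continuous_subspaceT => z.
    by have [/derivable1_diffP/differentiable_continuous] := dg z.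
  by rewrite normrM ler_wpM2r.
move=> x y; have [/key//|/ltW/key] := leP y x.
by rewrite distrC (distrC y).
Qed.

(** [g] is the derivative of [f]. The bounds come from the Mills ratio outside [[- K, K]] and from
    compactness inside, so they are not explicit; they depend on [h] alone. *)
Lemma stein_equation : exists f g : R -> R, exists B L : R,
  [/\ (continuous f /\ continuous g) /\ 0 <= L,
      forall x, `|f x| <= B,
      forall x y, `|g x - g y| <= L * `|x - y|,
      forall x u, `|f (x + u) - f x - u * g x| <= L * u ^+ 2 &
      forall x, g x - x * f x = h x - \int[mu]_t (h t * normal_pdf 0 1 t)].
Proof.
have [B _ fB] := bounded_of f_cont (fun x Kx => (outside Kx).1)
  (fun x Kx => (outside' Kx).1).
have [C C0 rC] := bounded_of r'_cont (fun x Kx => (outside Kx).2)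
  (fun x Kx => (outside' Kx).2).
pose g x := h x - Nh + x * f x.
have gL x y : `|g x - g y| <= (L0 + C) * `|x - y|.
  have -> : g x - g y = (h x - h y) + (x * f x - y * f y) by rewrite /g; ring.
  rewrite mulrDl (le_trans (ler_normD _ _))// lerD//.
  exact: (lip_of (fun x => dr x)).
have L_ge0 : 0 <= L0 + C by rewrite addr_ge0.
exists f, g, B, (L0 + C); split => //.
- split=> //; split => // x; apply: cvgD.
    by apply: cvgB; [exact: h_cont|exact: cvg_cst].
  by apply: cvgM; [exact: cvg_id|exact: f_cont].
- move=> x u.
  have := @lip_of (fun y => f y - y * g x) (fun y => g y - g x).
  (* Mean value theorem for [k], whose derivative [g y - g x] is at most [L * |u|] between [x] and
     [x + u]; the two signs of [u] are treated apart. *)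
  pose k y := f y - y * g x.
  have dk y : is_derive y (1:R) k (g y - g x).
    have d2 : is_derive y (1:R) (fun y : R => y * g x) (g x).
      by apply: is_derive_eq; rewrite scaler0 add0r /GRing.scale /= mulr1.
    exact: is_deriveB (df y) d2.
  have ck : forall a b, {within `[a, b], continuous k}.
    move=> a b; apply: continuous_subspaceT => z.
    by have [/derivable1_diffP/differentiable_continuous] := dk z.
  move=> _; have -> : f (x + u) - f x - u * g x = k (x + u) - k x.
    by rewrite /k; ring.
  have [u0|u0] := leP 0 u.
    have [|c cin ->] := @MVT_segment _ k (fun y => g y - g x) x (x + u) _ (fun y _ => dk y) (ck _ _).
      by rewrite lerDl.
    move: cin; rewrite in_itv/= => /andP[c1 c2].
    have -> : x + u - x = u by rewrite addrC addKr.
    rewrite normrM (ger0_norm u0) expr2 mulrA ler_wpM2r//.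
    by rewrite (le_trans (gL _ _))// ler_wpM2l// ger0_norm ?subr_ge0// lerBlDl.
  have [|c cin] := @MVT_segment _ k (fun y => g y - g x) (x + u) x _ (fun y _ => dk y) (ck _ _).
    by rewrite gerDl ltW.
  move: cin; rewrite in_itv/= => /andP[c1 c2].
  rewrite distrC => ->.
  have -> : x - (x + u) = - u by ring.
  rewrite normrM (ger0_norm (x := - u)) ?oppr_ge0 ?(ltW u0)//.
  rewrite -sqrrN expr2 mulrA ler_wpM2r ?oppr_ge0 ?(ltW u0)//.
  rewrite (le_trans (gL _ _))// ler_wpM2l// distrC ger0_norm ?subr_ge0//.
  by rewrite lerBlDr -lerBlDl opprK.
- by move=> x; rewrite /g addrK.
Qed.

End solution.

End Stein.

(** * Smoothed indicators of half-lines *)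

Section SteinIndicator.
Context {R : realType}.
Notation mu := (@lebesgue_measure R).

Lemma normal_prob_itv_shift (y d : R) : 0 <= d ->
  (normal_prob 0 1 `]-oo, (y + d)%R] <=
   normal_prob 0 1 `]-oo, y] + (normal_peak 1 * d)%:E)%E.
Proof.
move=> d0.
have -> : (`]-oo, y + d] = `]-oo, y] `|` `]y, y + d])%classic.
  by rewrite -itv_bndbnd_setU// bnd_simp// lerDl.
rewrite measureU//; last first.
  by apply/seteqP; split => // x /= []; rewrite !in_itv/= => xy /andP[/lt_geF]; rewrite xy.
rewrite leeD2l//.
apply: (@le_trans _ _ (\int[mu]_(x in `]y, (y + d)%R]) (normal_peak 1 : R)%:E)%E).
  rewrite /normal_prob; apply: ge0_le_integral => //.
  - by move=> x _; rewrite lee_fin normal_pdf_ge0.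
  - apply/measurable_EFinP/measurable_funTS; exact: measurable_normal_pdf.
  - by move=> x _; rewrite lee_fin normal_pdf_ub ?oner_neq0.
rewrite integral_cst//= lebesgue_measure_itv/= lte_fin.
have [_|] := ltP y (y + d); first by rewrite -EFinB -EFinM addrC addKr.
by rewrite mule0 lee_fin mulr_ge0 ?normal_peak_ge0.
Qed.

Let clamp (t : R) : R := Num.max 0 (Num.min 1 t).

Let clampE t : [\/ t <= 0 /\ clamp t = 0, 1 <= t /\ clamp t = 1 | 0 <= t <= 1 /\ clamp t = t].
Proof.
rewrite /clamp; have [t0|/ltW t0] := leP t 0.
  by constructor 1; rewrite (min_r (le_trans t0 ler01)) max_l.
have [t1|] := boolP (t <= 1).
  by constructor 3; rewrite t0 (min_r t1) max_r.
by rewrite -ltNge => /ltW t1; constructor 2; rewrite (min_l t1) max_r.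
Qed.

Let clampL s t : `|clamp s - clamp t| <= `|s - t|.
Proof.
wlog st : s t / t <= s.
  by move=> W; have [/W//|/ltW/W] := leP t s; rewrite distrC (distrC t).
rewrite (ger0_norm (x := s - t)) ?subr_ge0// ler_norml.
have [[? ->]|[? ->]|[/andP[? ?] ->]] := clampE s;
have [[? ->]|[? ->]|[/andP[? ?] ->]] := clampE t; apply/andP; split; lra.
Qed.

(** A Lipschitz ramp descending from 1 at [y] to 0 at [y + d] lies between the two indicators, and
    its Gaussian mean [N] between their probabilities. It is constant outside a bounded interval, as
    the Stein equation requires. *)
Lemma stein_indicator (y d : R) : 0 < d ->
  exists h f g : R -> R, exists B L N : R,
  [/\ [/\ continuous h, continuous f & continuous g] /\ 0 <= L,
      forall x : R, (x <= y)%R%:R <= h x <= (x <= y + d)%R%:R,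
      [/\ forall x, `|f x| <= B,
          forall x x', `|g x - g x'| <= L * `|x - x'| &
          forall x u, `|f (x + u) - f x - u * g x| <= L * u ^+ 2],
      forall x, g x - x * f x = h x - N &
      (normal_prob 0 1 `]-oo, y] <= N%:E <= normal_prob 0 1 `]-oo, (y + d)%R])%E].
Proof.
move=> d0; pose h x := clamp ((y + d - x) / d).
have hL x x' : `|h x - h x'| <= d^-1 * `|x - x'|.
  rewrite (le_trans (clampL _ _))// -mulrBl normrM (gtr0_norm (x := d^-1)) ?invr_gt0//.
  by rewrite mulrC [X in `|X|](_ : _ = x' - x) 1?distrC//; ring.
have hc : continuous h.
  move=> x; apply/(@cvgrPdist_le _ R^o) => e e0; near=> z.
  rewrite (le_trans (hL _ _))// mulrC ler_pdivrMr//.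
  near: z; apply: (@cvgr_dist_le _ R^o _ _ _ id x) => //; exact: mulr_gt0.
have hbd x : (x <= y)%R%:R <= h x <= (x <= y + d)%R%:R.
  rewrite /h; have := clampE ((y + d - x) / d).
  rewrite ler_pdivrMr// !ler_pdivlMr// mul0r mul1r !subr_le0 subr_ge0.
  move=> [[yx ->]|[yx ->]|[/andP[xy yx] ->]].
  - rewrite ler0n andbT; case: (x <= y) / idP => //= xy; lra.
  - have -> : x <= y + d by lra.
    by rewrite lern1 leq_b1 /=.
  - rewrite xy yx andbT.
    by case: (x <= y) / idP => xy'; rewrite ?ler_pdivlMr ?mul1r ?mul0r//; lra.
have h01 x : 0 <= h x <= 1.
  by have /andP[h1 h2] := hbd x; rewrite (le_trans _ h1) ?ler0n// (le_trans h2)// lern1 leq_b1.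
(* This [K] is at least 1, for the Mills ratio bounds, and [[- K, K]] contains both ends of the
   ramp. *)
have K1 : 1 <= 1 + `|y| + `|y + d| by rewrite -addrA lerDl addr_ge0.
have [yl yr] : - `|y| <= y /\ y + d <= `|y + d|.
  by split; [rewrite lerNl -normrN ler_norm|exact: ler_norm].
have n1 : 0 <= `|y| by []. have n2 : 0 <= `|y + d| by [].
have hl x : x <= - (1 + `|y| + `|y + d|) -> h x = 1.
  move=> xl; have xy : x <= y by lra.
  by apply/eqP; rewrite eq_le; have /andP[+ _] := hbd x; rewrite xy => ->; have /andP[_ ->] := h01 x.
have hr x : (1 + `|y| + `|y + d|) <= x -> h x = 0.
  move=> xl; have xy : (x <= y + d) = false by apply/negbTE; rewrite -ltNge; lra.
  by apply/eqP; rewrite eq_le; have /andP[_ +] := hbd x; rewrite xy => ->; have /andP[-> _] := h01 x.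
have d1 : 0 <= d^-1 by rewrite invr_ge0 ltW.
have [f [g [B [L [[[fc gc] L0] fB gL fT fg]]]]] := stein_equation hc h01 K1 hl hr d1 hL.
exists h, f, g, B, L, (\int[mu]_t (h t * normal_pdf 0 1 t)); split => //.
have hi : mu.-integrable setT (fun t => (h t * normal_pdf 0 1 t)%:E).
  apply: le_integrable (integrable_normal_pdf 0 1) => //.
    apply/measurable_EFinP; apply: measurable_funM; last exact: measurable_normal_pdf.
    exact: continuous_measurable_fun.
  move=> x _ /=; rewrite lee_fin normrM ler_piMl//.
  by have /andP[? ?] := h01 x; rewrite ger0_norm.
rewrite /Rintegral fineK ?integrable_fin_num//.
have mn : measurable_fun setT (normal_pdf 0 1 : measurableTypeR R -> R).
  exact: measurable_normal_pdf.
have mh : measurable_fun setT (h : measurableTypeR R -> R).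
  exact: continuous_measurable_fun.
rewrite /normal_prob; apply/andP; split.
  rewrite [leLHS]integral_mkcond; apply: ge0_le_integral => //.
  - by move=> x _; rewrite patchE; case: ifP => // _; rewrite lee_fin normal_pdf_ge0.
  - apply/(measurable_restrictT _ _).1 => //.
    by apply/measurable_funTS/measurable_EFinP.
  - by apply/measurable_EFinP/measurable_funM.
  - move=> x _; rewrite patchE mem_setE in_itv/=.
    have /andP[+ _] := hbd x; case: (x <= y) => hx; rewrite lee_fin.
      by rewrite ler_peMl ?normal_pdf_ge0.
    by rewrite mulr_ge0 ?normal_pdf_ge0.
rewrite [leRHS]integral_mkcond; apply: ge0_le_integral => //.
- move=> x _; rewrite lee_fin mulr_ge0 ?normal_pdf_ge0//.
  by have /andP[] := h01 x.
- by apply/measurable_EFinP/measurable_funM.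
- apply/(measurable_restrictT _ _).1 => //.
  by apply/measurable_funTS/measurable_EFinP.
- move=> x _; rewrite patchE mem_setE in_itv/=.
  have /andP[_ +] := hbd x; case: (x <= y + d) => hx; rewrite lee_fin.
    by rewrite ler_piMl ?normal_pdf_ge0.
  by rewrite mulr_le0_ge0 ?normal_pdf_ge0.
Unshelve. all: by end_near. Qed.

End SteinIndicator.

(** * Independent families of random variables *)

Section MeasurableFor.
Context {R : realType} {d : measure_display} {Om : measurableType d}.
Implicit Types (G : set (set Om)) (S : set (Om -> R)) (f g : Om -> R).

Lemma measurable_forP G f : measurable_for <<s G>> f <->
  measurable_fun setT (f : g_sigma_algebraType G -> R).
Proof.
split=> [mf _ B mB|mf B mB]; first by rewrite setTI; exact: mf.
by rewrite -[X in <<s _>> X]setTI; exact: (mf measurableT).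
Qed.

Lemma measurable_for_gen S f : S f -> measurable_for (sigma_gen S) f.
Proof. by move=> Sf B mB; apply: sub_sigma_algebra; exists f, B. Qed.

Lemma sigma_gen_measurable S : (forall f, S f -> measurable_fun setT f) ->
  sigma_gen S `<=` measurable.
Proof.
move=> mS; apply: smallest_sub; first exact: sigma_algebra_measurable.
by move=> E [f [B [/mS mf mB ->]]]; rewrite -[X in measurable X]setTI; exact: mf.
Qed.

Lemma measurable_for_fun G f : G `<=` measurable -> measurable_for G f ->
  measurable_fun setT f.
Proof. by move=> GM mf _ B mB; rewrite setTI; apply: GM; exact: mf. Qed.

Lemma sigma_gen_subset S S' : S `<=` measurable_for (sigma_gen S') ->
  sigma_gen S `<=` sigma_gen S'.
Proof.
move=> SS'; apply: smallest_sub; first exact: smallest_sigma_algebra.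
by move=> E [f [B [/SS' + mB ->]]]; exact.
Qed.

End MeasurableFor.

Section IndependentSigma.
Context {R : realType} {d : measure_display} {Om : measurableType d}.
Variable Q : probability Om R.
Local Open Scope ereal_scope.

(** For fixed [B] both sides are finite measures in [A]: [Q] restricted to [B], and [Q] scaled by
    [Q B]. They agree on a pi-system, hence on what it generates. *)
Lemma independent_gen_l (G : set (set Om)) (B : set Om) : measurable B ->
  G `<=` measurable -> setI_closed G -> G setT ->
  (forall A, G A -> Q (A `&` B) = Q A * Q B) ->
  forall A, <<s G>> A -> Q (A `&` B) = Q A * Q B.
Proof.
move=> mB Gm GI GT GQ A sA.
pose r : {nonneg R} := NngNum (fine_ge0 (measure_ge0 Q B)).
have e C : mscale r Q C = Q C * Q B.
  by rewrite /mscale/= fineK ?fin_num_measure// muleC.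
have -> : Q (A `&` B) = mrestr Q mB A by [].
rewrite -e; apply: (@g_sigma_algebra_measure_unique _ _ _ G _ (fun=> setT)) => //.
- by rewrite bigcup_const.
- by move=> C GC; rewrite [LHS]GQ// -e.
- move=> _; change (Q (setT `&` B) < +oo).
  by rewrite setTI ltey_eq fin_num_measure.
Qed.

Lemma independent_gen (G1 G2 : set (set Om)) :
  G1 `<=` measurable -> setI_closed G1 -> G1 setT ->
  G2 `<=` measurable -> setI_closed G2 -> G2 setT ->
  (forall A B, G1 A -> G2 B -> Q (A `&` B) = Q A * Q B) ->
  independent_sigma Q <<s G1>> <<s G2>>.
Proof.
move=> m1 I1 T1 m2 I2 T2 G12 A B sA sB.
have mA : measurable A.
  exact: (smallest_sub (@sigma_algebra_measurable _ Om) m1).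
rewrite setIC muleC; apply: (independent_gen_l _ m2) => // {sB}B GB.
rewrite setIC muleC; apply: (independent_gen_l _ m1) => //; first exact: m2.
by move=> C GC; exact: G12.
Qed.

Lemma independent_sigma_subset G1 G2 G1' G2' : G1' `<=` G1 -> G2' `<=` G2 ->
  independent_sigma Q G1 G2 -> independent_sigma Q G1' G2'.
Proof. by move=> s1 s2 I A B /s1 ? /s2 ?; exact: I. Qed.

Definition cylinders (I : finType) (J : {set I}) (X : I -> Om -> R) : set (set Om) :=
  [set E | exists2 B : I -> set R, forall i, measurable (B i) &
    E = \bigcap_(i in [set` J]) X i @^-1` B i].

Section groups.
Variables (I : finType) (X : I -> Om -> R).
Hypothesis mX : forall i, measurable_fun setT (X i).

Let mXB i (B : set R) : measurable B -> measurable (X i @^-1` B).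
Proof. by move=> mB; rewrite -[X in measurable X]setTI; exact: mX. Qed.

Lemma cylinders_measurable J : cylinders J X `<=` measurable.
Proof.
move=> E [B mB ->]; apply: fin_bigcap_measurable => // i _; exact: mXB.
Qed.

Lemma cylinders_setI J : setI_closed (cylinders J X).
Proof.
move=> _ _ [B mB ->] [C mC ->]; exists (fun i => B i `&` C i).
  by move=> i; exact: measurableI.
by rewrite -bigcapI; apply: eq_bigcapr => i _; rewrite preimage_setI.
Qed.

Lemma cylinders_setT J : cylinders J X setT.
Proof.
by exists (fun=> setT) => //; apply/seteqP; split.
Qed.

Lemma sigma_gen_cylinders (J : {set I}) (B : set Om) :
  sigma_gen [set X i | i in [set` J]] B -> <<s cylinders J X>> B.
Proof.
move: B; apply: smallest_sub; first exact: smallest_sigma_algebra.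
move=> _ [_ [B [[i iJ <-] mB ->]]]; apply: sub_sigma_algebra.
exists (fun j => if j == i then B else setT) => [j|]; first by case: ifP.
apply/seteqP; split=> [x Bx j _ /=|x /(_ i iJ)]; last by rewrite eqxx.
by case: eqP => [->|].
Qed.

(** Cylinders over disjoint index sets can be written with one common family [D], so their
    intersection is a cylinder over the union, whose probability factors. *)
Lemma mutually_independent_groups (J1 J2 : {set I}) : (forall i, i \in J1 -> i \notin J2) ->
  mutually_independent Q (finset.setT : {set I}) X ->
  independent_sigma Q (sigma_gen [set X i | i in [set` J1]])
    (sigma_gen [set X i | i in [set` J2]]).
Proof.
move=> J12 indX.
apply: (independent_sigma_subset (@sigma_gen_cylinders J1) (@sigma_gen_cylinders J2)).
apply: independent_gen; try solve [exact: cylinders_measurable|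
  exact: cylinders_setI|exact: cylinders_setT].
move=> _ _ [B mB ->] [C mC ->].
pose D i := if i \in J1 then B i else C i.
have mD i : measurable (D i) by rewrite /D; case: ifP.
have eB : \bigcap_(i in [set` J1]) X i @^-1` B i = \bigcap_(i in [set` J1]) X i @^-1` D i.
  by apply: eq_bigcapr => i /= iJ; rewrite /D iJ.
have eC : \bigcap_(i in [set` J2]) X i @^-1` C i = \bigcap_(i in [set` J2]) X i @^-1` D i.
  apply: eq_bigcapr => i /= iJ; rewrite /D ifF//.
  by apply/negbTE/negP => /J12; rewrite iJ.
have eU : (\bigcap_(i in [set` J1]) X i @^-1` D i) `&`
    (\bigcap_(i in [set` J2]) X i @^-1` D i) =
    \bigcap_(i in [set` (finset.setU J1 J2)]) X i @^-1` D i.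
  rewrite -bigcap_setU; congr (\bigcap_(i in _) _).
  by apply/seteqP; split => i /=; rewrite finset.inE => /orP.
have mI J : measurable (\bigcap_(i in [set` J]) X i @^-1` D i).
  by apply: fin_bigcap_measurable => // i _; exact: mXB.
rewrite eB eC eU -[LHS]fineK ?fin_num_measure// -[X in _ = X * _]fineK ?fin_num_measure//.
rewrite -[X in _ = _ * X]fineK ?fin_num_measure// -EFinM; congr EFin.
rewrite !indX ?finset.subsetT//.
rewrite (bigID (mem J1))/=; congr (_ * _)%R; apply: eq_bigl => i; rewrite finset.inE.
  by case: (i \in J1); rewrite ?andbF.
by have := J12 i; case: (i \in J1) => [/(_ isT)/negbTE->|_]; rewrite ?andbT ?andbF.
Qed.

End groups.

Section product.
Variables X Y : Om -> R.
Hypothesis mX : measurable_fun setT X.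
Hypothesis mY : measurable_fun setT Y.
Hypothesis XY : forall A B : set R, measurable A -> measurable B ->
  Q (X @^-1` A `&` Y @^-1` B) = Q (X @^-1` A) * Q (Y @^-1` B).
Hypothesis iX : Q.-integrable setT (EFin \o X).
Hypothesis iY : Q.-integrable setT (EFin \o Y).

Let X' : {mfun Om >-> R} := mfun_Sub (mem_set mX).
Let Y' : {mfun Om >-> R} := mfun_Sub (mem_set mY).
Let mXY : measurable_fun setT (fun w => (X w, Y w)).
Proof. exact: measurable_fun_pair. Qed.
Let XY' : {mfun Om >-> (R * R)%type} := mfun_Sub (mem_set mXY).

Let f (z : R * R) : \bar R := (z.1 * z.2)%:E.

Let mf : measurable_fun setT f.
Proof.
apply/measurable_EFinP; apply: measurable_funM.
exact: measurable_fst. exact: measurable_snd.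
Qed.

Let joint (A : set (R * R)) : measurable A ->
  (distribution Q X' \x distribution Q Y') A = distribution Q XY' A.
Proof.
apply: product_measure_unique => B C mB mC.
by rewrite /distribution /pushforward /= -XY.
Qed.

Let if_ : (distribution Q X' \x distribution Q Y').-integrable setT f.
Proof.
apply/integrable12ltyP => //.
have -> : (fun x => \int[distribution Q Y']_y `|f (x, y)|) =
    (fun x => `|x%:E| * \int[Q]_w `|(Y w)%:E|).
  have <- : \int[distribution Q Y']_y `|y%:E| = \int[Q]_w `|(Y w)%:E|.
    by rewrite (@ge0_integral_distribution _ _ _ _ _ Q Y' (fun y => `|y%:E|))//; exact: measurableT_comp.
  apply/funext => x; rewrite -ge0_integralZl//; last exact: measurableT_comp.
  by apply: eq_integral => y _; rewrite /f EFinM abseM.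
have [y0 yoo] : 0 <= \int[Q]_w `|(Y w)%:E| /\ \int[Q]_w `|(Y w)%:E| < +oo.
  by split; [exact: integral_ge0|have /integrableP[_] := iY].
rewrite -(fineK (x := \int[Q]_w `|(Y w)%:E|)) ?ge0_fin_numE//.
rewrite ge0_integralZr//; last 2 first.
  exact: measurableT_comp.
  by rewrite lee_fin fine_ge0.
rewrite (@ge0_integral_distribution _ _ _ _ _ Q X' (fun x => `|x%:E|))//; last first.
  exact: measurableT_comp.
have /integrableP[_ xoo] := iX.
by rewrite muleC lte_mul_pinfty// lee_fin fine_ge0.
Qed.

Let eXY : \int[distribution Q X' \x distribution Q Y']_z f z =
  \int[distribution Q XY']_z f z.
Proof. by apply: eq_measure_integral => A mA _; exact: joint. Qed.

Lemma independent_integrableM : Q.-integrable setT (EFin \o (fun w => X w * Y w)%R).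
Proof.
apply/integrableP; split; first exact/measurable_EFinP/measurable_funM.
have /integrableP[_] := if_; apply: le_lt_trans.
rewrite (eq_measure_integral (distribution Q XY')); last first.
  by move=> A mA _; exact: joint.
by rewrite ge0_integral_distribution//; exact: measurableT_comp.
Qed.

(** The joint law is the product of the marginals, so Fubini applies in the plane. *)
Lemma independent_RintegralM :
  (\int[Q]_w (X w * Y w) = (\int[Q]_w X w) * (\int[Q]_w Y w))%R.
Proof.
rewrite -[RHS]/(fine _ * fine _)%R -fineM ?integrable_fin_num//; congr fine.
transitivity (\int[distribution Q XY']_z f z).
  by rewrite integral_distribution//; exact: independent_integrableM.
rewrite -eXY -(integral12_prod_meas1 if_).
have idX : (distribution Q X').-integrable setT EFin.
  exact: integrable_pushforward.
have idY : (distribution Q Y').-integrable setT EFin.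
  exact: integrable_pushforward.
have eY : \int[distribution Q Y']_y y%:E = \int[Q]_w (Y w)%:E.
  by rewrite integral_distribution.
have eX : \int[distribution Q X']_y y%:E = \int[Q]_w (X w)%:E.
  by rewrite integral_distribution.
have -> : fubini_F (distribution Q Y') f = (fun x => x%:E * \int[Q]_w (Y w)%:E).
  apply/funext => x; rewrite /fubini_F /f /= -eY -integralZl//.
rewrite -eX -(fineK (integrable_fin_num _ iY))//.
by rewrite integralZr.
Qed.

End product.

Lemma independent_sigma_RintegralM G H (X Y : Om -> R) :
  independent_sigma Q G H -> G `<=` measurable -> H `<=` measurable ->
  measurable_for G X -> measurable_for H Y ->
  Q.-integrable setT (EFin \o X) -> Q.-integrable setT (EFin \o Y) ->
  Q.-integrable setT (EFin \o (fun w => X w * Y w)%R) /\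
  (\int[Q]_w (X w * Y w) = (\int[Q]_w X w) * (\int[Q]_w Y w))%R.
Proof.
move=> I Gm Hm GX HY iX iY.
have mX := measurable_for_fun Gm GX. have mY := measurable_for_fun Hm HY.
have XY A B : measurable A -> measurable B ->
    Q (X @^-1` A `&` Y @^-1` B) = Q (X @^-1` A) * Q (Y @^-1` B).
  by move=> mA mB; apply: I; [exact: GX|exact: HY].
split; first exact: independent_integrableM.
exact: independent_RintegralM.
Qed.

End IndependentSigma.

(** * A central limit theorem for weighted arrays *)

Notation rintegrable Q X := ((Q : measure _ _).-integrable setT (EFin \o X)).

Section RealExpectation.
Context {R : realType} {d : measure_display} {Om : measurableType d}.
Variable Q : probability Om R.
Implicit Types X Y : Om -> R.

Lemma rintegrable_measurable X : rintegrable Q X -> measurable_fun setT X.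
Proof. by move=> /measurable_int/measurable_EFinP. Qed.

Lemma rintegrableD X Y : rintegrable Q X -> rintegrable Q Y ->
  rintegrable Q (fun y => X y + Y y).
Proof. by move=> iX iY; exact: (integrableD measurableT iX iY). Qed.

Lemma rintegrableB X Y : rintegrable Q X -> rintegrable Q Y ->
  rintegrable Q (fun y => X y - Y y).
Proof. by move=> iX iY; exact: (integrableB measurableT iX iY). Qed.

Lemma rintegrableZ (k : R) X : rintegrable Q X -> rintegrable Q (fun y => k * X y).
Proof. by move=> iX; exact: (integrableZl measurableT k iX). Qed.

Lemma rintegrable_cst (k : R) : rintegrable Q (fun=> k).
Proof. exact: finite_measure_integrable_cst. Qed.

Lemma rintegrable_sum (I : Type) (s : seq I) (P : pred I) (X : I -> Om -> R) :
  (forall i, P i -> rintegrable Q (X i)) ->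
  rintegrable Q (fun y => \sum_(i <- s | P i) X i y).
Proof.
move=> iX; have := integrable_sum measurableT s iX.
by apply: eq_integrable => // y _; rewrite /= sumEFin.
Qed.

Lemma rintegrable_le X Y : measurable_fun setT X -> (forall y, `|X y| <= Y y) ->
  rintegrable Q Y -> rintegrable Q X.
Proof.
move=> mX XY; apply: le_integrable => //; first exact/measurable_EFinP.
by move=> y _ /=; rewrite lee_fin (le_trans (XY y))// ler_norm.
Qed.

Lemma Rintegral_sum (I : Type) (s : seq I) (P : pred I) (X : I -> Om -> R) :
  (forall i, P i -> rintegrable Q (X i)) ->
  \int[Q]_y (\sum_(i <- s | P i) X i y) = \sum_(i <- s | P i) \int[Q]_y X i y.
Proof.
move=> iX; elim: s => [|i s IH].
  by under eq_Rintegral do rewrite big_nil; rewrite Rintegral_cst// mul0r big_nil.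
under eq_Rintegral do rewrite big_cons; rewrite big_cons.
case: ifP => // Pi; rewrite RintegralD ?IH//; first exact: iX.
exact: rintegrable_sum.
Qed.

Lemma Rintegral_prob_cst (k : R) : \int[Q]_y k = k.
Proof. by rewrite Rintegral_cst// [X in fine X]probability_setT mulr1. Qed.

Lemma Rintegral_ae X Y : measurable_fun setT X -> rintegrable Q Y ->
  {ae Q, forall y, X y = Y y} -> rintegrable Q X /\ \int[Q]_y X y = \int[Q]_y Y y.
Proof.
move=> mX iY XY.
have mY := rintegrable_measurable iY.
have e : ae_eq Q setT (EFin \o X) (EFin \o Y).
  by apply: filterS XY => y /= -> _.
split; last first.
  by congr fine; apply: ae_eq_integral => //; exact/measurable_EFinP.
apply/integrableP; split; first exact/measurable_EFinP.
have /integrableP[_] := iY; apply: le_lt_trans.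
rewrite (ae_eq_integral (fun y => `|(EFin \o Y) y|)%E)//.
- by do 2 apply: measurableT_comp => //.
- by do 2 apply: measurableT_comp => //.
- by apply: filterS XY => y /= -> _.
Qed.

Lemma indic_Rintegral_le (A : set Om) X : measurable A -> rintegrable Q X ->
  (forall y, \1_A y <= X y) -> (Q A <= (\int[Q]_y X y)%R%:E)%E.
Proof.
move=> mA iX AX; rewrite -[X in (Q X <= _)%E]setIT -integral_indic//.
rewrite -[leLHS]fineK; last first.
  by apply: integrable_fin_num => //; exact: integrable_indic.
rewrite lee_fin; apply: le_Rintegral => //.
exact: integrable_indic.
Qed.

Lemma Rintegral_le_indic (A : set Om) X : measurable A -> rintegrable Q X ->
  (forall y, X y <= \1_A y) -> ((\int[Q]_y X y)%R%:E <= Q A)%E.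
Proof.
move=> mA iX AX; rewrite -[X in (_ <= Q X)%E]setIT -integral_indic//.
rewrite -[leRHS]fineK; last first.
  by apply: integrable_fin_num => //; exact: integrable_indic.
rewrite lee_fin; apply: le_Rintegral => //.
exact: integrable_indic.
Qed.

Lemma measurable_gt X (k : R) : measurable_fun setT X -> measurable [set y | k < X y].
Proof.
move=> mX; rewrite -[X in measurable X]setTI.
have -> : [set y | k < X y] = X @^-1` `]k, +oo[ by apply/seteqP; split => y /=; rewrite in_itv/= andbT.
exact: mX.
Qed.

Lemma markov_ineq X (k : R) : 0 < k -> rintegrable Q X -> (forall y, 0 <= X y) ->
  (Q [set y | (k < X y)%R] <= ((\int[Q]_y X y)%R / k)%:E)%E.
Proof.
move=> k0 iX X0; have mX := rintegrable_measurable iX.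
have -> : \int[Q]_y X y / k = \int[Q]_y (k^-1 * X y).
  by rewrite RintegralZl// mulrC.
apply: indic_Rintegral_le.
- exact: measurable_gt.
- exact: rintegrableZ.
- move=> y; rewrite indicE; case: (boolP (y \in _)) => [|_].
    by rewrite inE/= => /ltW; rewrite mulrC ler_pdivlMr// mul1r.
  by rewrite mulr_ge0// invr_ge0 ltW.
Qed.

End RealExpectation.

(** * Leave-one-out error bound in Stein's method *)

Section SteinBound.
Context {R : realType} {d : measure_display} {Om : measurableType d}.
Variable Q : probability Om R.
Variables (I : finType) (X : I -> Om -> R) (v C4 : R).
Hypothesis mX : forall i, measurable_fun setT (X i).
Hypothesis indX : mutually_independent Q (finset.setT : {set I}) X.
Hypothesis iX4 : forall i, rintegrable Q (fun y => X i y ^+ 4).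
Hypothesis EX : forall i, \int[Q]_y X i y = 0.
Hypothesis EX2 : forall i, \int[Q]_y (X i y ^+ 2) = v.
Hypothesis EX4 : forall i, \int[Q]_y (X i y ^+ 4) <= C4.
Variables (c : I -> R) (eta : R).
Hypothesis c_eta : forall i, `|c i| <= eta.
Hypothesis cv : v * \sum_i c i ^+ 2 = 1.

(** Gives the single bound [1 + C4] for all absolute moments up to the fourth. *)
Let pow_le (x : R) k : (k <= 4)%N -> `|x| ^+ k <= 1 + x ^+ 4.
Proof.
move=> k4; have -> : x ^+ 4 = `|x| ^+ 4 by rewrite -normrX ger0_norm// exprn_even_ge0.
have [x1|/ltW x1] := leP `|x| 1.
  by rewrite (le_trans (exprn_ile1 _ (normr_ge0 _) x1))// lerDl exprn_ge0.
by rewrite (le_trans (ler_weXn2l x1 k4))// lerDr.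
Qed.

Let iB i : rintegrable Q (fun y => 1 + X i y ^+ 4).
Proof. by apply: rintegrableD => //; exact: rintegrable_cst. Qed.

Let iXk i k : (k <= 4)%N -> rintegrable Q (fun y => X i y ^+ k).
Proof.
move=> k4; apply: rintegrable_le (iB i); first exact: measurable_funX.
by move=> y; rewrite normrX pow_le.
Qed.

Let iXa i k : (k <= 4)%N -> rintegrable Q (fun y => `|X i y| ^+ k).
Proof.
move=> k4; apply: rintegrable_le (iB i); first exact/measurable_funX/measurableT_comp.
by move=> y; rewrite normrX normr_id pow_le.
Qed.

Let EXa i k : (k <= 4)%N -> \int[Q]_y (`|X i y| ^+ k) <= 1 + C4.
Proof.
move=> k4; apply: (@le_trans _ _ (\int[Q]_y (1 + X i y ^+ 4))).
  by apply: le_Rintegral => // [|y _]; [exact: iXa|exact: pow_le].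
rewrite RintegralD//; last exact: rintegrable_cst.
by rewrite Rintegral_prob_cst lerD2l.
Qed.

Let W y : R := \sum_i c i * X i y.

Variables (f g : R -> R) (B L : R).
Hypothesis f_cont : continuous f.
Hypothesis g_cont : continuous g.
Hypothesis L_ge0 : 0 <= L.
Hypothesis fB : forall x, `|f x| <= B.
Hypothesis gL : forall x x', `|g x - g x'| <= L * `|x - x'|.
Hypothesis fT : forall x u, `|f (x + u) - f x - u * g x| <= L * u ^+ 2.

Let mW : measurable_fun setT W.
Proof. by apply: measurable_sum => i; exact: measurable_funM. Qed.

Let iW : rintegrable Q W.
Proof.
by apply: rintegrable_sum => i _; apply: rintegrableZ; exact: (@iXk i 1).
Qed.

Let mf : measurable_fun setT f. Proof. exact: continuous_measurable_fun. Qed.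
Let mg : measurable_fun setT g. Proof. exact: continuous_measurable_fun. Qed.

Let g_int V : rintegrable Q V -> rintegrable Q (fun y => g (V y)).
Proof.
move=> iV; apply: (@rintegrable_le _ _ _ _ _ (fun y => `|g 0| + L * `|V y|)).
- by apply: measurableT_comp => //; exact: rintegrable_measurable iV.
- move=> y; rewrite -[X in `|X|](subrK (g 0)) addrC.
  by rewrite (le_trans (ler_normD _ _))// lerD2l -{2}(subr0 (V y)).
- apply: rintegrableD; first exact: rintegrable_cst.
  by apply: rintegrableZ; exact: integrable_norm.
Qed.

Let fM_int V U : rintegrable Q V -> measurable_fun setT U -> rintegrable Q (fun y => V y * f (U y)).
Proof.
move=> iV mU; apply: (@rintegrable_le _ _ _ _ _ (fun y => B * `|V y|)).
- by apply: measurable_funM; [exact: rintegrable_measurable iV|exact: measurableT_comp].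
- by move=> y; rewrite normrM mulrC ler_wpM2r.
- by apply: rintegrableZ; exact: integrable_norm.
Qed.

(* Compare W with V, the sum without its k-th term, which is independent of X k:
   f (W) = f (V) + c k X k g (V) up to the Lipschitz error of g. *)
Let term k : `|c k * \int[Q]_y (X k y * f (W y)) - c k ^+ 2 * v * \int[Q]_y (g (W y))|
  <= L * eta * ((1 + v) * (1 + C4)) * c k ^+ 2.
Proof.
pose V y := \sum_(i | i != k) c i * X i y.
have WV y : W y = V y + c k * X k y.
  by rewrite /W (bigD1 k)//= addrC.
have iV : rintegrable Q V.
  by apply: rintegrable_sum => i _; apply: rintegrableZ; exact: (@iXk i 1).
have mV := rintegrable_measurable iV.
pose J1 : {set I} := finset.set1 k.
pose J2 : {set I} := finset.setC J1.
have ind : independent_sigma Q (sigma_gen [set X i | i in [set` J1]])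
    (sigma_gen [set X i | i in [set` J2]]).
  by apply: mutually_independent_groups => // i; rewrite !finset.inE negbK.
have mgen (J : {set I}) : sigma_gen [set X i | i in [set` J]] `<=` measurable.
  by apply: sigma_gen_measurable => _ [i _ <-].
have forX n : measurable_for (sigma_gen [set X i | i in [set` J1]])
    (fun y => X k y ^+ n).
  apply/measurable_forP; apply: measurable_funX.
  by apply/measurable_forP; apply: measurable_for_gen; exists k => //=; rewrite finset.inE.
have forV (h : R -> R) : measurable_fun setT h ->
    measurable_for (sigma_gen [set X i | i in [set` J2]]) (fun y => h (V y)).
  move=> mh; apply/measurable_forP; apply: (measurableT_comp mh).
  have -> : V = (fun y => \sum_i (if i != k then c i * X i y else 0)).
    by apply/funext => y; rewrite /V big_mkcond.
  apply: measurable_sum => i; case: (boolP (i != k)) => // ik.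
  apply: measurable_funM => //.
  apply/measurable_forP; apply: measurable_for_gen.
  by exists i => //=; rewrite !finset.inE.
have ifV : rintegrable Q (fun y => f (V y)).
  apply: (@rintegrable_le _ _ _ _ _ (fun=> B)) => //; first exact: measurableT_comp.
  exact: rintegrable_cst.
have igV := g_int iV. have igW := g_int iW.
have [i1 e1] := independent_sigma_RintegralM ind (@mgen _) (@mgen _) (forX 1%N)
  (forV _ mf) (@iXk k 1 isT) ifV.
have [i2 e2] := independent_sigma_RintegralM ind (@mgen _) (@mgen _) (forX 2%N)
  (forV _ mg) (@iXk k 2 isT) igV.
have eEX : \int[Q]_y (X k y ^+ 1) = 0 by under eq_Rintegral do rewrite expr1; exact: EX.
rewrite eEX mul0r in e1. rewrite EX2 in e2.
have iXW : rintegrable Q (fun y => X k y * f (W y)) by apply: fM_int => //; exact: (@iXk k 1).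
pose T1 y := c k * (X k y * f (W y)) - c k * (X k y ^+ 1 * f (V y)) - c k ^+ 2 * (X k y ^+ 2 * g (V y)).
have iT1 : rintegrable Q T1.
  by do 2 (apply: rintegrableB; last exact: rintegrableZ); exact: rintegrableZ.
have ET1 : \int[Q]_y T1 y = c k * \int[Q]_y (X k y * f (W y)) -
    c k ^+ 2 * v * \int[Q]_y g (V y).
  rewrite RintegralB//; last 2 first.
  - by apply: rintegrableB; exact: rintegrableZ.
  - exact: rintegrableZ.
  rewrite RintegralB//; [|exact: rintegrableZ..].
  by rewrite !RintegralZl// e1 e2 mulr0 subr0 mulrA.
have T1_le y : `|T1 y| <= L * (`|c k| ^+ 3 * `|X k y| ^+ 3).
  have -> : T1 y = c k * X k y * (f (V y + c k * X k y) - f (V y) - c k * X k y * g (V y)).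
    by rewrite /T1 WV expr1; ring.
  rewrite -exprMn -normrM; set u := c k * X k y.
  rewrite normrM (le_trans (ler_wpM2l (normr_ge0 u) (fT _ _)))//.
  by rewrite -(real_normK (num_real u)) mulrCA -exprS.
have T1_int : `|\int[Q]_y T1 y| <= L * `|c k| ^+ 3 * (1 + C4).
  rewrite (le_trans (le_normr_Rintegral _ iT1))//.
  apply: (@le_trans _ _ (\int[Q]_y (L * `|c k| ^+ 3 * `|X k y| ^+ 3))).
    apply: le_Rintegral => //.
    - exact: integrable_norm.
    - by apply: rintegrableZ; exact: iXa.
    - by move=> y _; rewrite -mulrA.
  rewrite RintegralZl//; last exact: iXa.
  by rewrite ler_wpM2l ?EXa// mulr_ge0// exprn_ge0.
have gVW : `|\int[Q]_y g (V y) - \int[Q]_y g (W y)| <= L * `|c k| * (1 + C4).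
  rewrite -RintegralB// (le_trans (le_normr_Rintegral _ (rintegrableB igV igW)))//.
  apply: (@le_trans _ _ (\int[Q]_y (L * `|c k| * `|X k y| ^+ 1))).
    apply: le_Rintegral => //.
    - exact/integrable_norm/rintegrableB.
    - by apply: rintegrableZ; exact: iXa.
    - move=> y _; rewrite (le_trans (gL _ _))// -mulrA ler_wpM2l// WV.
      by rewrite opprD addrA subrr sub0r normrN normrM expr1.
  rewrite RintegralZl//; last exact: iXa.
  by rewrite ler_wpM2l ?EXa// mulr_ge0.
have v0 : 0 <= v by rewrite -(EX2 k); apply: Rintegral_ge0 => y _; exact: sqr_ge0.
have C40 : 0 <= 1 + C4.
  by apply: le_trans (@EXa k 0 isT); apply: Rintegral_ge0 => y _; rewrite expr0.
rewrite (_ : _ - _ = \int[Q]_y T1 y + c k ^+ 2 * v * (\int[Q]_y g (V y) - \int[Q]_y g (W y))); last first.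
  by rewrite ET1; ring.
rewrite (le_trans (ler_normD _ _))//.
have cv0 : 0 <= c k ^+ 2 * v by apply: mulr_ge0 => //; exact: sqr_ge0.
rewrite normrM (ger0_norm cv0).
have cc : c k ^+ 2 = `|c k| ^+ 2 by rewrite real_normK ?num_real.
(* One factor [|c k|] of the error is traded for [eta]; the remaining [c k ^+ 2] has a sum over [k]
   fixed by the normalization. *)
have step1 : L * `|c k| ^+ 3 * (1 + C4) <= L * eta * (1 + C4) * c k ^+ 2.
  rewrite cc exprS; have := c_eta k.
  rewrite -subr_ge0 => h; rewrite -subr_ge0.
  have -> : L * eta * (1 + C4) * `|c k| ^+ 2 - L * (`|c k| * `|c k| ^+ 2) * (1 + C4) =
    L * (1 + C4) * `|c k| ^+ 2 * (eta - `|c k|) by ring.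
  by rewrite !mulr_ge0// exprn_ge0.
have step2 : c k ^+ 2 * v * (L * `|c k| * (1 + C4)) <= L * eta * (v * (1 + C4)) * c k ^+ 2.
  have := c_eta k; rewrite -subr_ge0 => h; rewrite -subr_ge0.
  have -> : L * eta * (v * (1 + C4)) * c k ^+ 2 - c k ^+ 2 * v * (L * `|c k| * (1 + C4)) =
    L * (1 + C4) * v * c k ^+ 2 * (eta - `|c k|) by ring.
  by rewrite cc !mulr_ge0// exprn_ge0.
rewrite (le_trans (lerD T1_int (ler_wpM2l cv0 gVW)))//.
rewrite (le_trans (lerD step1 step2))//.
by rewrite le_eqVlt; apply/orP; left; apply/eqP; ring.
Qed.

Lemma stein_bound : rintegrable Q (fun y => g (W y) - W y * f (W y)) /\
  `|\int[Q]_y (g (W y) - W y * f (W y))| <=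
  L * eta * ((1 + v) * (1 + C4)) * \sum_i c i ^+ 2.
Proof.
have igW := g_int iW.
have iWf : rintegrable Q (fun y => W y * f (W y)) by exact: fM_int.
split; first exact: rintegrableB.
rewrite RintegralB//.
have -> : \int[Q]_y (W y * f (W y)) = \sum_k c k * \int[Q]_y (X k y * f (W y)).
  transitivity (\int[Q]_y (\sum_k c k * (X k y * f (W y)))).
    by apply: eq_Rintegral => y _; rewrite /W big_distrl/=; apply: eq_bigr => k _; rewrite mulrA.
  rewrite Rintegral_sum.
    by apply: eq_bigr => k _; rewrite RintegralZl//; apply: fM_int => //; exact: (@iXk k 1).
  by move=> k _; apply: rintegrableZ; apply: fM_int => //; exact: (@iXk k 1).
(* The normalization [cv] splits the mean of [g (W)] into shares [v * c k ^+ 2], each compared with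
   the [k]-th summand of the mean of [W * f (W)]. *)
rewrite -[\int[Q]_y g (W y)]mul1r -[X in X * \int[Q]_y g (W y)]cv.
rewrite mulr_sumr big_distrl/= -sumrB mulr_sumr.
rewrite (le_trans (ler_norm_sum _ _ _))//; apply: ler_sum => k _.
by rewrite distrC (mulrC v) term.
Qed.

End SteinBound.

Section CLT.
Context {R : realType}.

(** One row of a triangular array whose weighted sum has variance 1. Along the rows [v] and [C4]
    stay fixed while [eta] tends to 0, which stands for the Lindeberg condition. *)
Definition weighted_array d (Om : measurableType d) (Q : probability Om R)
    (I : finType) (X : I -> Om -> R) (c : I -> R) (v C4 eta : R) : Prop :=
  [/\ (forall i, measurable_fun setT (X i)) /\
        mutually_independent Q (finset.setT : {set I}) X,
      forall i, rintegrable Q (fun y => X i y ^+ 4),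
      forall i, [/\ \int[Q]_y X i y = 0, \int[Q]_y (X i y ^+ 2) = v &
        \int[Q]_y (X i y ^+ 4) <= C4],
      forall i, `|c i| <= eta &
      v * \sum_i c i ^+ 2 = 1].

Let Phi (y : R) : R := fine (normal_prob 0 1 `]-oo, y]).

Let Phi_shift (y e : R) : 0 <= e -> Phi (y + e) <= Phi y + normal_peak 1 * e.
Proof.
move=> e0; rewrite -lee_fin EFinD !fineK ?fin_num_measure//.
exact: normal_prob_itv_shift.
Qed.

Section one.
Context {d : measure_display} {Om : measurableType d} (Q : probability Om R)
  (I : finType) (X : I -> Om -> R) (c : I -> R) (v C4 eta : R)
  (V : Om -> R).
Hypothesis H : weighted_array Q X c v C4 eta.
Hypothesis mV : measurable_fun setT V.

Let W y := \sum_i c i * X i y.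

Let mW : measurable_fun setT W.
Proof.
have [[mX _] _ _ _ _] := H.
by apply: measurable_sum => i; exact: measurable_funM.
Qed.

Let m_le (U : Om -> R) a : measurable_fun setT U -> measurable [set y | U y <= a].
Proof.
move=> mU; rewrite -[X in measurable X]setTI.
have -> : [set y | U y <= a] = U @^-1` `]-oo, a] by apply/seteqP; split => y /=; rewrite in_itv.
exact: mU.
Qed.

Let m_dist a : measurable [set y | a < `|V y - W y|].
Proof.
by apply: measurable_gt; apply: measurableT_comp => //; exact: measurable_funB.
Qed.

(** Stated for a pair [U], [U'] at the same distance as [V], [W], since both orders occur: one for
    each side of the distribution function. *)
Let close_sub (U U' : Om -> R) a e : measurable_fun setT U -> measurable_fun setT U' ->
  (forall y, `|U y - U' y| = `|V y - W y|) ->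
  fine (Q [set y | U y <= a]) <= fine (Q [set y | U' y <= a + e]) +
    fine (Q [set y | e < `|V y - W y|]).
Proof.
move=> mU mU' UU'.
have m1 := m_le (a + e) mU'. have m2 := m_dist e.
rewrite -fineD ?fin_num_measure//.
apply: fine_le; rewrite ?fin_num_measure//; [exact: m_le|by rewrite fin_numD !fin_num_measure|].
apply: (@le_trans _ _ (Q ([set y | U' y <= a + e] `|` [set y | e < `|V y - W y|]))).
  apply: le_measure; rewrite ?inE; [exact: m_le|exact: measurableU|].
  move=> y /= Uy; have [|h] := leP (U' y) (a + e); first by left.
  right; rewrite -UU'; have := ler_norm (U' y - U y); rewrite distrC; lra.
exact: measureU2.
Qed.

Variables (y0 e : R).
Variables (h f g : R -> R) (B L N : R).
Hypotheses (hc : continuous h) (fc : continuous f) (gc : continuous g) (L0 : 0 <= L)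
  (hb : forall x : R, (x <= y0)%R%:R <= h x <= (x <= y0 + e)%R%:R)
  (fB : forall x : R, `|f x| <= B)
  (gL : forall x x' : R, `|g x - g x'| <= L * `|x - x'|)
  (fT : forall x u : R, `|f (x + u) - f x - u * g x| <= L * u ^+ 2)
  (fg : forall x : R, g x - x * f x = h x - N).

(** Constant of [stein_bound], with [v^-1] as the sum of the squared weights. *)
Let K := L * ((1 + v) * (1 + C4)) * v^-1.

Let hW_int : rintegrable Q (fun y => h (W y)).
Proof.
apply: (@rintegrable_le _ _ _ _ _ (fun=> 1)); last exact: rintegrable_cst.
  by apply: measurableT_comp => //; exact: continuous_measurable_fun.
move=> y; have /andP[h1 h2] := hb (W y).
by rewrite ger0_norm ?(le_trans h2) ?(le_trans _ h1)// lern1 leq_b1.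
Qed.

Let hW_close : `|\int[Q]_y h (W y) - N| <= K * eta.
Proof.
have [[mX indX] iX4 EX ceta cv] := H.
have [i1] := stein_bound mX indX iX4 (fun i => let: And3 a _ _ := EX i in a)
  (fun i => let: And3 _ a _ := EX i in a) (fun i => let: And3 _ _ a := EX i in a)
  ceta cv fc gc L0 fB gL fT.
have v0 : v != 0 by apply: contra_eq_neq cv => ->; rewrite mul0r eq_sym oner_neq0.
have -> : \sum_i c i ^+ 2 = v^-1 by rewrite -[RHS]mulr1 -cv mulKf.
have -> : \int[Q]_y (g (\sum_i c i * X i y) - (\sum_i c i * X i y) * f (\sum_i c i * X i y))
    = \int[Q]_y h (W y) - N.
  rewrite -[N in RHS](@Rintegral_prob_cst _ _ _ Q) -RintegralB//; last exact: rintegrable_cst.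
  by apply: eq_Rintegral => y _; rewrite fg.
by move=> le; rewrite (le_trans le)// le_eqVlt; apply/orP; left; apply/eqP; rewrite /K; ring.
Qed.

Lemma clt_upper y : y + e <= y0 -> N <= Phi (y0 + e) ->
  fine (Q [set x | V x <= y]) <= Phi (y0 + e) + K * eta +
    fine (Q [set x | e < `|V x - W x|]).
Proof.
move=> ye NPhi; have := @close_sub V W y e mV mW (fun=> erefl).
move/le_trans; apply; rewrite lerD2r.
apply: (@le_trans _ _ (\int[Q]_x h (W x))).
  rewrite -lee_fin fineK ?fin_num_measure//; last exact: m_le.
  apply: indic_Rintegral_le; [exact: m_le|exact: hW_int|].
  move=> x; have /andP[+ _] := hb (W x); apply: le_trans; rewrite indicE.
  case: (boolP (x \in _)) => [|_]; last by rewrite ler0n.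
  by rewrite inE /= => Wx; rewrite (le_trans Wx).
by move: hW_close; rewrite ler_norml => /andP[_]; lra.
Qed.

Lemma clt_lower y : y0 + e <= y - e -> Phi y0 <= N ->
  Phi y0 - K * eta - fine (Q [set x | e < `|V x - W x|]) <=
    fine (Q [set x | V x <= y]).
Proof.
move=> ye NPhi.
have := @close_sub W V (y - e) e mW mV (fun x => distrC _ _).
rewrite subrK => le; rewrite lerBlDr (le_trans _ le)//.
have : \int[Q]_x h (W x) <= fine (Q [set x | W x <= y - e]).
  rewrite -lee_fin [X in (_ <= X)%E]fineK ?fin_num_measure//; last exact: m_le.
  apply: Rintegral_le_indic; [exact: m_le|exact: hW_int|].
  move=> x; have /andP[_ hx] := hb (W x); apply: le_trans hx _; rewrite indicE.
  case: (boolP (x \in _)) => [_|]; first by rewrite lern1 leq_b1.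
  rewrite notin_setE /= => Wx; rewrite ler_nat leqn0 eqb0; apply/negP => Wx'.
  by apply: Wx; rewrite (le_trans Wx').
by move: hW_close; rewrite ler_norml => /andP[+ _]; lra.
Qed.

End one.

Theorem clt_slutsky (d : nat -> measure_display)
  (Om : forall m, measurableType (d m)) (Q : forall m, probability (Om m) R)
  (I : nat -> finType) (X : forall m, I m -> Om m -> R) (c : forall m, I m -> R)
  (v C4 : R) (eta : nat -> R) (V : forall m, Om m -> R) :
  (\forall m \near \oo, weighted_array (Q m) (X m) (c m) v C4 (eta m)) ->
  eta m @[m --> \oo] --> 0 ->
  (forall m, measurable_fun setT (V m)) ->
  (forall e : R, 0 < e ->
    Q m [set x | (e < `|V m x - \sum_i c m i * X m i x|)%R] @[m --> \oo] --> 0%E) ->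
  cvg_in_distribution Q V (normal_prob 0 1).
Proof.
move=> Hm eta0 mV close y _.
have mVy m : measurable [set x | V m x <= y].
  rewrite -[X in measurable X]setTI.
  have -> : [set x | V m x <= y] = V m @^-1` `]-oo, y] by apply/seteqP; split => x /=; rewrite in_itv.
  exact: mV.
have -> : normal_prob 0 1 `]-oo, y] = (Phi y)%:E by rewrite fineK ?fin_num_measure.
apply/fine_cvgP; split.
  by apply: nearW => m; rewrite fin_num_measure//.
apply/cvgrPdist_le => eps eps0.
have pk : 0 < normal_peak (1 : R) by rewrite normal_peak_gt0 ?oner_neq0.
(* The tolerance is shared in three: the Gaussian mass of an interval of length [2 * e], bounded
   through the peak of the density; the Stein error; the probability that [V] is farther than [e]
   from the sum. The ramps descend on [[y + e, y + 2e]] for the upper bound and on [[y - 2e, y - e]]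
   for the lower one. *)
pose e := eps / (6 * normal_peak 1).
have e0 : 0 < e by rewrite divr_gt0// mulr_gt0.
have pe : normal_peak 1 * (2 * e) = eps / 3 by rewrite /e; field; rewrite gt_eqF.
have [h [f [g [B [L [N [[[hc fc gc] L0] hb [fB gL fT] fg /andP[_ NPhi]]]]]]]] :=
  stein_indicator (y + e) e0.
have [h' [f' [g' [B' [L' [N' [[[hc' fc' gc'] L0'] hb' [fB' gL' fT'] fg' /andP[NPhi' _]]]]]]]] :=
  stein_indicator (y - 2 * e) e0.
pose K := L * ((1 + v) * (1 + C4)) * v^-1.
pose K' := L' * ((1 + v) * (1 + C4)) * v^-1.
have small k : \forall m \near \oo, `|k * eta m| <= eps / 3.
  have : k * eta m @[m --> \oo] --> 0.
    by rewrite -(mulr0 k); apply: cvgM => //; exact: cvg_cst.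
  move/cvgrPdist_le => /(_ (eps / 3) (divr_gt0 eps0 (ltr0Sn _ 2))).
  by apply: filterS => m; rewrite sub0r normrN.
have := close e e0 => /fine_cvgP[_ /cvgrPdist_le /(_ (eps / 3) (divr_gt0 eps0 (ltr0Sn _ 2)))] closee.
near=> m.
have Hmm : weighted_array (Q m) (X m) (c m) v C4 (eta m) by near: m.
have s1 : `|K * eta m| <= eps / 3 by near: m; exact: small.
have s2 : `|K' * eta m| <= eps / 3 by near: m; exact: small.
have : `|0 - fine (Q m [set x | e < `|V m x - \sum_i c m i * X m i x|])| <= eps / 3 by near: m.
rewrite sub0r normrN => s3.
have s3' := le_trans (ler_norm _) s3. have s1' := le_trans (ler_norm _) s1.
have s2' := le_trans (ler_norm _) s2.
have NP : N <= Phi (y + e + e) by rewrite -lee_fin fineK ?fin_num_measure.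
have NP' : Phi (y - 2 * e) <= N' by rewrite -lee_fin fineK ?fin_num_measure.
have up := clt_upper Hmm (mV m) hc fc gc L0 hb fB gL fT fg (lexx (y + e)) NP.
have y2 : y - 2 * e + e <= y - e by rewrite le_eqVlt; apply/orP; left; apply/eqP; ring.
have lo := clt_lower Hmm (mV m) hc' fc' gc' L0' hb' fB' gL' fT' fg' y2 NP'.
have e20 : 0 <= 2 * e by rewrite mulr_ge0// ltW.
have P1 := Phi_shift y e20. have P2 := Phi_shift (y - 2 * e) e20.
rewrite subrK in P2. rewrite (_ : y + e + e = y + 2 * e) in up; last by ring.
rewrite pe in P1 P2. rewrite -/K in up; rewrite -/K' in lo.
have -> : (fine \o (fun m => Q m [set x | V m x <= y])) m = fine (Q m [set x | V m x <= y]) by [].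
rewrite ler_norml; apply/andP; split; lra.
Unshelve. all: by end_near. Qed.

End CLT.

(** * Singular values and truncated projections *)

Section SquaredNorm.
Context {R : realType}.

Definition sqn n (v : 'cV[R]_n) : R := \sum_i v i 0 ^+ 2.

Lemma sqn_ge0 n (v : 'cV[R]_n) : 0 <= sqn v.
Proof. by apply: sumr_ge0 => i _; exact: sqr_ge0. Qed.

Lemma norm2_sqr n (v : 'cV[R]_n) : norm2 v ^+ 2 = sqn v.
Proof.
rewrite /norm2 /frob sqr_sqrtr.
  by apply: eq_bigr => i _; rewrite big_ord1.
by apply: sumr_ge0 => i _; apply: sumr_ge0 => j _; exact: sqr_ge0.
Qed.

Lemma frob_sqr m n (A : 'M[R]_(m, n)) : frob A ^+ 2 = \sum_i \sum_j A i j ^+ 2.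
Proof.
rewrite /frob sqr_sqrtr//.
by apply: sumr_ge0 => i _; apply: sumr_ge0 => j _; exact: sqr_ge0.
Qed.

Lemma frob_ge0 m n (A : 'M[R]_(m, n)) : 0 <= frob A.
Proof. exact: sqrtr_ge0. Qed.

Lemma norm2_ge0 n (v : 'cV[R]_n) : 0 <= norm2 v.
Proof. exact: sqrtr_ge0. Qed.

Lemma sqnE n (v : 'cV[R]_n) : sqn v = (v^T *m v) 0 0.
Proof. by rewrite mxE; apply: eq_bigr => i _; rewrite mxE expr2. Qed.

Lemma sqnN n (v : 'cV[R]_n) : sqn (- v) = sqn v.
Proof. by apply: eq_bigr => i _; rewrite mxE sqrrN. Qed.

Lemma sqn_le_double n (u v : 'cV[R]_n) : sqn (u - v) <= 2 * sqn u + 2 * sqn v.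
Proof.
rewrite /sqn !mulr_sumr -big_split; apply: ler_sum => i _ /=; rewrite !mxE.
rewrite -subr_ge0 (_ : _ - _ = (u i 0 + v i 0) ^+ 2) ?sqr_ge0//; ring.
Qed.

Lemma cauchy_schwarz (I : finType) (a b : I -> R) :
  (\sum_i a i * b i) ^+ 2 <= (\sum_i a i ^+ 2) * \sum_i b i ^+ 2.
Proof.
set A := \sum_i a i ^+ 2; set B := \sum_i b i ^+ 2; set C := \sum_i _.
have B0 : 0 <= B by apply: sumr_ge0 => i _; exact: sqr_ge0.
have key : 0 <= B * (A * B - C ^+ 2).
  rewrite (_ : B * _ = \sum_i (a i * B - b i * C) ^+ 2); last first.
    have eA : \sum_i B ^+ 2 * a i ^+ 2 = B ^+ 2 * A by rewrite -mulr_sumr.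
    have eC : \sum_i 2 * B * C * (a i * b i) = 2 * B * C * C by rewrite -mulr_sumr.
    have eB : \sum_i C ^+ 2 * b i ^+ 2 = C ^+ 2 * B by rewrite -mulr_sumr.
    transitivity (B ^+ 2 * A - 2 * B * C * C + C ^+ 2 * B); first by ring.
    rewrite -eA -eC -eB -sumrB -big_split/=.
    by apply: eq_bigr => i _; ring.
  by apply: sumr_ge0 => i _; exact: sqr_ge0.
have [Bpos|] := ltP 0 B; first by rewrite -subr_ge0 -(pmulr_rge0 _ Bpos).
rewrite le_eqVlt ltNge B0 orbF => /eqP B00; rewrite B00 mulr0.
rewrite /C big1 ?expr0n//= => i _.
have : b i ^+ 2 == 0.
  move/eqP : B00; rewrite psumr_eq0 => [/allP/(_ i (mem_index_enum i))//|j _].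
  exact: sqr_ge0.
by rewrite sqrf_eq0 => /eqP ->; rewrite mulr0.
Qed.

Lemma sqn_mul_le m n (A : 'M[R]_(m, n)) (v : 'cV[R]_n) :
  sqn (A *m v) <= (\sum_i \sum_j A i j ^+ 2) * sqn v.
Proof.
rewrite /sqn mulr_suml; apply: ler_sum => i _.
by rewrite mxE; exact: cauchy_schwarz.
Qed.

Lemma dot_le n (u v : 'cV[R]_n) : (u^T *m v) 0 0 ^+ 2 <= sqn u * sqn v.
Proof.
rewrite mxE; under eq_bigr do rewrite mxE; exact: cauchy_schwarz.
Qed.

Lemma sqn_isometry m n (U : 'M[R]_(m, n)) (v : 'cV[R]_n) :
  U^T *m U = 1%:M -> sqn (U *m v) = sqn v.
Proof.
by move=> UU; rewrite !sqnE trmx_mul mulmxA -(mulmxA v^T) UU mulmx1.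
Qed.

Lemma sqn_bessel m n (U : 'M[R]_(m, n)) (w : 'cV[R]_m) :
  U^T *m U = 1%:M -> sqn (U^T *m w) <= sqn w.
Proof.
move=> UU; rewrite -subr_ge0.
suff -> : sqn w - sqn (U^T *m w) = sqn (w - U *m (U^T *m w)) by exact: sqn_ge0.
rewrite (sqnE w) (sqnE (U^T *m w)) (sqnE (w - _)).
rewrite [(w - _)^T]linearB/= mulmxBl !mulmxBr !trmx_mul !trmxK -!mulmxA.
rewrite (mulmxA U^T U) UU mul1mx !mxE; ring.
Qed.

(** The squared operator norm of [E] is the operator norm of its Gram matrix. For independent
    centred entries the Frobenius norm of the Gram matrix is of smaller order than [frob E ^+ 2],
    because its off-diagonal entries are sums with cancellations. The bound for the transpose
    follows by pairing [w] with [E E^T w]. *)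
Lemma sqn_gram_le m n (E : 'M[R]_(m, n)) :
  let C := frob (E^T *m E) in
  (forall v, sqn (E *m v) <= C * sqn v) /\ (forall w, sqn (E^T *m w) <= C * sqn w).
Proof.
move=> C; have C0 : 0 <= C by exact: frob_ge0.
have h1 v : sqn (E *m v) <= C * sqn v.
  rewrite -(ler_pXn2r (n := 2)) ?nnegrE ?mulr_ge0 ?sqn_ge0//.
  have -> : sqn (E *m v) = (v^T *m (E^T *m E *m v)) 0 0.
    by rewrite sqnE trmx_mul !mulmxA.
  rewrite (le_trans (dot_le _ _))// mulrC exprMn expr2 mulrA.
  rewrite ler_wpM2r ?sqn_ge0// (le_trans (sqn_mul_le _ _))//.
  by rewrite -frob_sqr expr2.
split=> // w.
have [e0|ne] := eqVneq (sqn (E^T *m w)) 0; first by rewrite e0 mulr_ge0 ?sqn_ge0.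
have p : 0 < sqn (E^T *m w) by rewrite lt_def ne sqn_ge0.
rewrite -(ler_pM2l p) -expr2.
rewrite {1}[sqn _](_ : _ = (w^T *m (E *m (E^T *m w))) 0 0); last first.
  by rewrite sqnE trmx_mul trmxK !mulmxA.
rewrite (le_trans (dot_le _ _))// mulrC mulrA ler_wpM2r ?sqn_ge0//.
by rewrite mulrC h1.
Qed.

End SquaredNorm.

Section SVD.
Context {R : realType} {m n : nat} (A : 'M[R]_(m, n)).
Variables (s : seq R) (U : 'M[R]_(m, minn m n)) (V : 'M[R]_(n, minn m n)).
Hypothesis svdA : is_svd A s U V.

Let p := minn m n.
Let UU : U^T *m U = 1%:M. Proof. by have [] := svdA. Qed.
Let VV : V^T *m V = 1%:M. Proof. by have [] := svdA. Qed.

Definition dg (f : nat -> R) : 'M[R]_p := diag_mx (\row_l f l).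

Let dgE f (v : 'cV[R]_p) i : (dg f *m v) i 0 = f i * v i 0.
Proof. by rewrite /dg mul_diag_mx !mxE. Qed.

Let dgM f g : dg f *m dg g = dg (fun l => f l * g l).
Proof. by rewrite /dg mulmx_diag; congr diag_mx; apply/rowP => i; rewrite !mxE. Qed.

Let dgT f : (dg f)^T = dg f. Proof. by rewrite /dg tr_diag_mx. Qed.

Let AE : A = U *m dg (nth 0 s) *m V^T. Proof. by have [] := svdA. Qed.
Let ATE : A^T = V *m dg (nth 0 s) *m U^T.
Proof. by rewrite AE !trmx_mul trmxK dgT mulmxA. Qed.

Let s_ge0 l : 0 <= s`_l.
Proof.
have [_ [_ /all_nthP s0] _ _ _] := svdA.
by have [/s0//|sl] := ltnP l (size s); rewrite nth_default.
Qed.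

Let sqn_dg f (v : 'cV[R]_p) : sqn (dg f *m v) = \sum_(l < p) f l ^+ 2 * v l 0 ^+ 2.
Proof. by apply: eq_bigr => l _; rewrite dgE exprMn. Qed.

(** The span of the first [l + 1] right singular vectors has dimension larger than the rank of [B],
    so it contains a nonzero vector killed by [B]; there [A - B] acts as [A], which stretches by at
    least the singular value of index [l]. *)
Lemma weyl_rank k (B : 'M[R]_(m, n)) (C : R) (l : 'I_(minn m n)) :
  (\rank B <= k)%N -> (k <= l)%N ->
  (forall v, sqn ((A - B) *m v) <= C * sqn v) -> s`_l ^+ 2 <= C.
Proof.
move=> rB kl AB.
(* Coordinates in the right singular basis, as row vectors: [G] spans those of index at most [l],
   and the kernel of [M] consists of the [g] with [B V g^T = 0]. Indices start at 0, whence
   [l.+1]. *)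
pose G : 'M[R]_p := pid_mx l.+1.
pose M := (B *m V)^T.
have rM : (\rank M <= l)%N.
  rewrite mxrank_tr (leq_trans (mxrankM_maxl _ _))//; exact: leq_trans rB kl.
have lp : (l < p)%N by exact: ltn_ord.
have : (G :&: kermx M)%MS != 0.
  rewrite -mxrank_eq0 -lt0n.
  have := mxrank_mul_ker G M.
  rewrite rank_pid_mx//.
  move=> e; rewrite -(ltn_add2l (\rank (G *m M))) addn0 e ltnS.
  exact: leq_trans (mxrankM_maxr G M) rM.
case/rowV0Pn => g; rewrite sub_capmx => /andP[/submxP[x gx] /sub_kermxP gM] g0.
have gl (j : 'I_p) : (l < j)%N -> g 0 j = 0.
  move=> lj; rewrite gx mxE big1// => i _; rewrite mxE.
  by case: eqP => [->|_]; rewrite ?ltnS ?(leqNgt j) ?lj /= mulr0n mulr0.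
pose v := V *m g^T.
have Bv : B *m v = 0.
  by rewrite /v mulmxA -[B *m V]trmxK -/M -trmx_mul gM trmx0.
have := AB v; rewrite mulmxBl Bv subr0 AE -!mulmxA /v.
rewrite (mulmxA V^T) VV mul1mx (sqn_isometry _ UU) (sqn_isometry _ VV) sqn_dg => le.
have gpos : 0 < sqn g^T.
  rewrite lt_def sqn_ge0 andbT; apply: contra g0 => /eqP g0.
  apply/eqP/rowP => j; rewrite mxE.
  have : g^T j 0 ^+ 2 == 0.
    move/eqP : g0; rewrite psumr_eq0 => [/allP/(_ j (mem_index_enum j))//|i _].
    exact: sqr_ge0.
  by rewrite sqrf_eq0 mxE => /eqP.
rewrite -(ler_pM2r gpos) (le_trans _ le)// /sqn mulr_sumr; apply: ler_sum => j _.
have [lj|jl] := ltnP l j; first by rewrite !mxE gl// expr0n/= !mulr0.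
rewrite ler_wpM2r ?sqr_ge0// lerXn2r ?nnegrE//.
have [szs [srt _] _ _ _] := svdA.
have ge_trans : transitive (>=%O : rel R) by move=> ? ? ?; exact: (fun a b => le_trans b a).
by apply: (sorted_leq_nth ge_trans (fun x => lexx x) 0 srt _ _ _ _ jl); rewrite inE szs; exact: ltn_ord.
Qed.

Lemma svd_rank0 (l : 'I_(minn m n)) : (\rank A <= l)%N -> s`_l = 0.
Proof.
move=> rl; apply/eqP; rewrite -sqrf_eq0 eq_le sqr_ge0 andbT.
by apply: (weyl_rank (B := A) (leqnn _) rl) => v; rewrite subrr mul0mx mul0r /sqn big1// => i _; rewrite mxE expr0n.
Qed.

Let r := \rank A.

(** Index [r.-1] is that of the last nonzero singular value; for [r = 0] the first alternative
    always holds. *)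
Lemma svd_gap (l : 'I_(minn m n)) : s`_l = 0 \/ s`_r.-1 <= s`_l.
Proof.
have [/svd_rank0|lr] := leqP r l; [by left|right].
have [szs [srt _] _ _ _] := svdA.
have ge_trans : transitive (>=%O : rel R) by move=> ? ? ?; exact: (fun a b => le_trans b a).
apply: (sorted_leq_nth ge_trans (fun x => lexx x) 0 srt); rewrite ?inE ?szs.
- exact: ltn_ord.
- by rewrite (ltn_predK lr) leq_min rank_leq_row rank_leq_col.
- by rewrite -ltnS (ltn_predK lr).
Qed.

Lemma svd_frob : frob A ^+ 2 <= r%:R * s`_0 ^+ 2.
Proof.
have -> : frob A ^+ 2 = \sum_(l < p) s`_l ^+ 2.
  rewrite frob_sqr exchange_big/=.
  transitivity (\tr (A^T *m A)).
    apply: eq_bigr => j _; rewrite mxE; apply: eq_bigr => i _.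
    by rewrite mxE expr2.
  rewrite ATE AE -!mulmxA mxtrace_mulC -!mulmxA (mulmxA U^T) UU mul1mx.
  rewrite VV mulmx1 dgM mxtrace_diag.
  by apply: eq_bigr => l _; rewrite mxE expr2.
rewrite mulr_natl -[X in _ *+ X]card_ord -sumr_const.
have rp : (r <= p)%N by rewrite leq_min rank_leq_row rank_leq_col.
rewrite (big_ord_widen p (fun=> s`_0 ^+ 2) rp) [leRHS]big_mkcond/=.
apply: ler_sum => l _; case: ltnP => [lr|/svd_rank0 ->]; last by rewrite expr0n.
rewrite lerXn2r ?nnegrE//.
have [szs [srt _] _ _ _] := svdA.
have ge_trans : transitive (>=%O : rel R) by move=> ? ? ?; exact: (fun a b => le_trans b a).
apply: (sorted_leq_nth ge_trans (fun x => lexx x) 0 srt); rewrite ?inE ?szs//.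
exact: leq_ltn_trans (leq0n _) (ltn_ord l).
Qed.

(** A vector of the form [A^T b] has no component along right singular vectors of singular value 0,
    so only the nonzero singular values act on it. *)
Lemma svd_lower_rowspace (b : 'cV[R]_m) :
  s`_r.-1 ^+ 2 * sqn (A^T *m b) <= sqn (A *m (A^T *m b)).
Proof.
have e1 : A^T *m b = V *m (dg (nth 0 s) *m (U^T *m b)) by rewrite ATE -!mulmxA.
have e2 : A *m (A^T *m b) = U *m (dg (fun l => s`_l * s`_l) *m (U^T *m b)).
  by rewrite e1 {1}AE -!mulmxA (mulmxA V^T) VV mul1mx (mulmxA (dg _)) dgM.
rewrite e2 e1 (sqn_isometry _ UU) (sqn_isometry _ VV).
rewrite !sqn_dg mulr_sumr; apply: ler_sum => l _; rewrite mulrA ler_wpM2r ?sqr_ge0//.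
rewrite exprMn; have [->|h] := svd_gap l; first by rewrite expr0n/= !mulr0.
by rewrite ler_wpM2r ?sqr_ge0// lerXn2r ?nnegrE.
Qed.

Lemma svd_lower_colspace (c : 'cV[R]_n) :
  s`_r.-1 ^+ 2 * sqn (A *m c) <= sqn (A^T *m (A *m c)).
Proof.
have e1 : A *m c = U *m (dg (nth 0 s) *m (V^T *m c)) by rewrite {1}AE -!mulmxA.
have e2 : A^T *m (A *m c) = V *m (dg (fun l => s`_l * s`_l) *m (V^T *m c)).
  by rewrite e1 ATE -!mulmxA (mulmxA U^T) UU mul1mx (mulmxA (dg _)) dgM.
rewrite e2 e1 (sqn_isometry _ UU) (sqn_isometry _ VV).
rewrite !sqn_dg mulr_sumr; apply: ler_sum => l _; rewrite mulrA ler_wpM2r ?sqr_ge0//.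
rewrite exprMn; have [->|h] := svd_gap l; first by rewrite expr0n/= !mulr0.
by rewrite ler_wpM2r ?sqr_ge0// lerXn2r ?nnegrE.
Qed.

Lemma svd_mpinv : is_mpinv A (mpinv A).
Proof.
rewrite /mpinv; case: xgetP => [B ->//|noB]; exfalso.
(* As [0^-1 = 0], inverting the diagonal entrywise already treats the kernel as a pseudo-inverse
   must. *)
apply: (noB (V *m dg (fun l => (s`_l)^-1) *m U^T)).
have e1 : A *m (V *m dg (fun l => (s`_l)^-1) *m U^T) =
    U *m dg (fun l => s`_l * (s`_l)^-1) *m U^T.
  by rewrite AE -!mulmxA (mulmxA V^T) VV mul1mx (mulmxA (dg _)) dgM.
have e2 : V *m dg (fun l => (s`_l)^-1) *m U^T *m A =
    V *m dg (fun l => (s`_l)^-1 * s`_l) *m V^T.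
  by rewrite AE -!mulmxA (mulmxA U^T) UU mul1mx (mulmxA (dg _)) dgM.
split; rewrite ?e1 ?e2.
- rewrite {1}AE -!mulmxA (mulmxA U^T) UU mul1mx (mulmxA (dg _)) dgM [RHS]AE -mulmxA.
  congr (_ *m (_ *m _)); congr dg; apply/funext => l.
  by have [->|h] := eqVneq s`_l 0; rewrite ?mul0r// divff ?mul1r.
- rewrite -!mulmxA (mulmxA V^T) VV mul1mx (mulmxA (dg _)) dgM.
  congr (_ *m (_ *m _)); congr dg; apply/funext => l.
  by have [->|h] := eqVneq s`_l 0; rewrite ?invr0 ?mul0r// mulVf ?mul1r.
- by rewrite !trmx_mul trmxK dgT mulmxA.
- by rewrite !trmx_mul trmxK dgT mulmxA.
Qed.

End SVD.

(** * Orthogonal projections and truncated singular value decompositions *)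

Section Projection.
Context {R : realType} {m : nat} (P : 'M[R]_m).
Hypothesis PT : P^T = P.
Hypothesis PP : P *m P = P.

Lemma sqn_projE (w : 'cV[R]_m) : sqn (P *m w) = \sum_i \sum_j P i j * (w i 0 * w j 0).
Proof.
rewrite sqnE trmx_mul PT !mulmxA -(mulmxA w^T) PP mxE exchange_big/=.
apply: eq_bigr => i _; rewrite mxE mulr_suml; apply: eq_bigr => j _.
by rewrite mxE; ring.
Qed.

Lemma sqn_proj_pythagoras (w : 'cV[R]_m) : sqn w = sqn (P *m w) + sqn (w - P *m w).
Proof.
rewrite (sqnE w) (sqnE (P *m w)) (sqnE (w - _)).
rewrite [(w - _)^T]linearB/= mulmxBl !mulmxBr !trmx_mul PT -!mulmxA.
by rewrite (mulmxA P P) PP !mxE; ring.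
Qed.

Lemma sqn_projC_le (w : 'cV[R]_m) : sqn (w - P *m w) <= sqn w.
Proof. by rewrite (sqn_proj_pythagoras w) lerDr sqn_ge0. Qed.

Lemma dot_projC (u w : 'cV[R]_m) :
  ((u - P *m u)^T *m (w - P *m w)) 0 0 = ((u - P *m u)^T *m w) 0 0.
Proof.
congr (fun_of_matrix _ 0 0); rewrite mulmxBr [(u - _)^T]linearB/= trmx_mul PT.
by rewrite mulmxBl mulmxBl -!mulmxA (mulmxA P P) PP subrr subr0.
Qed.

End Projection.

Section TruncatedSVD.
Context {R : realType} {m n : nat} (Z : 'M[R]_(m, n)).
Variables (s : seq R) (U : 'M[R]_(m, minn m n)) (V : 'M[R]_(n, minn m n)).
Hypothesis svdZ : is_svd Z s U V.
Variable kappa : nat.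

Let p := minn m n.
Let UU : U^T *m U = 1%:M. Proof. by have [] := svdZ. Qed.
Let VV : V^T *m V = 1%:M. Proof. by have [] := svdZ. Qed.

Let dgE f (v : 'cV[R]_p) i : (dg f *m v) i 0 = f i * v i 0.
Proof. by rewrite /dg mul_diag_mx !mxE. Qed.

Let dgM f g : dg f *m dg g = dg (fun l => f l * g l) :> 'M[R]_p.
Proof. by rewrite /dg mulmx_diag; congr diag_mx; apply/rowP => i; rewrite !mxE. Qed.

Let dgT f : (dg f)^T = dg f :> 'M[R]_p. Proof. by rewrite /dg tr_diag_mx. Qed.

Let sqn_dg f (v : 'cV[R]_p) : sqn (dg f *m v) = \sum_(l < p) f l ^+ 2 * v l 0 ^+ 2.
Proof. by apply: eq_bigr => l _; rewrite dgE exprMn. Qed.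

Let ZE : Z = U *m dg (nth 0 s) *m V^T. Proof. by have [] := svdZ. Qed.
Let ZTE : Z^T = V *m dg (nth 0 s) *m U^T.
Proof. by rewrite ZE !trmx_mul trmxK dgT mulmxA. Qed.

(** The nonvanishing test reflects [0^-1 = 0]: a zero singular value among the first [kappa]
    contributes nothing to the fit. *)
Definition trunc (l : nat) : R := ((l < kappa)%N && (s`_l != 0))%:R.

Let trunc2 l : trunc l * trunc l = trunc l.
Proof. by rewrite -natrM mulnb andbb. Qed.

Definition lproj : 'M[R]_m := U *m dg trunc *m U^T.
Definition rproj : 'M[R]_n := V *m dg trunc *m V^T.

Lemma lprojT : lproj^T = lproj.
Proof. by rewrite /lproj !trmx_mul trmxK dgT mulmxA. Qed.

Lemma lprojM : lproj *m lproj = lproj.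
Proof.
rewrite /lproj -!mulmxA (mulmxA U^T) UU mul1mx (mulmxA (dg _)) dgM.
by congr (_ *m (_ *m _)); congr dg; apply/funext => l; exact: trunc2.
Qed.

Lemma rprojT : rproj^T = rproj.
Proof. by rewrite /rproj !trmx_mul trmxK dgT mulmxA. Qed.

Lemma rprojM : rproj *m rproj = rproj.
Proof.
rewrite /rproj -!mulmxA (mulmxA V^T) VV mul1mx (mulmxA (dg _)) dgM.
by congr (_ *m (_ *m _)); congr dg; apply/funext => l; exact: trunc2.
Qed.

(** Bounds the degrees of freedom, by which the projected shocks are controlled in mean. Equality
    fails when [kappa] exceeds the number of nonzero singular values. *)
Lemma lproj_trace : \tr lproj <= kappa%:R.
Proof.
have sum_lt q : (\sum_(l < q) (l < kappa) = minn q kappa)%N.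
  elim: q => [|q IH]; first by rewrite big_ord0 min0n.
  rewrite big_ord_recr/= IH; have [qk|kq] := ltnP q kappa.
    by rewrite (minn_idPl qk) addn1.
  by rewrite (minn_idPr (leqW kq)) addn0.
rewrite /lproj -mulmxA mxtrace_mulC -mulmxA UU mulmx1 mxtrace_diag.
apply: (@le_trans _ _ ((\sum_(l < p) (l < kappa))%N%:R)).
  rewrite natr_sum; apply: ler_sum => l _; rewrite mxE /trunc ler_nat.
  by case: (l < kappa)%N => //=; exact: leq_b1.
by rewrite sum_lt ler_nat geq_minr.
Qed.

(** The fitted values are a projection of the response, by a matrix built without the response; the
    independence of the two rests on this. *)
Lemma trunc_svd_fit (z : 'cV[R]_m) :
  Z *m ((\sum_(l < minn m n | (l < kappa)%N)
    (s`_l)^-1 *: (col l V *m (col l U)^T)) *m z) = lproj *m z.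
Proof.
have -> : \sum_(l < minn m n | (l < kappa)%N) (s`_l)^-1 *: (col l V *m (col l U)^T) =
    V *m dg (fun l => (l < kappa)%N%:R * (s`_l)^-1) *m U^T.
  apply/matrixP => i j; rewrite summxE big_mkcond -mulmxA mxE; apply: eq_bigr => l _.
  rewrite /dg mul_diag_mx !mxE; case: (l < kappa)%N; rewrite /= ?mul0r ?mulr0//.
  by rewrite big_ord1 !mxE mul1r mulrCA.
rewrite mulmxA; congr (_ *m _).
rewrite ZE /lproj -!mulmxA (mulmxA V^T) VV mul1mx (mulmxA (dg _)) dgM.
congr (_ *m (_ *m _)); congr dg; apply/funext => l; rewrite /trunc.
rewrite mulrCA; have [->|sl] := eqVneq s`_l 0; first by rewrite mul0r mulr0 andbF.
by rewrite divff// mulr1 andbT.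
Qed.

Lemma lproj_Z : Z - lproj *m Z = Z - Z *m rproj.
Proof.
congr (_ - _); rewrite /lproj /rproj ZE -!mulmxA (mulmxA U^T) UU mul1mx.
rewrite (mulmxA V^T) VV mul1mx !(mulmxA (dg _)) !dgM.
by congr (_ *m (_ *m _)); congr dg; apply/funext => l; rewrite mulrC.
Qed.

Section perturbation.
Variables (A : 'M[R]_(m, n)) (C : R).
Hypothesis rA : (\rank A <= kappa)%N.
Hypothesis C0 : 0 <= C.
Hypothesis EC : forall v, sqn ((Z - A) *m v) <= C * sqn v.
Hypothesis ECT : forall w, sqn ((Z - A)^T *m w) <= C * sqn w.

Let tail_le (l : 'I_p) : ((1 - trunc l) * s`_l) ^+ 2 <= C.
Proof.
rewrite /trunc; have [lk|kl] := ltnP l kappa; rewrite /=.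
  have [->|s0] := eqVneq s`_l 0; first by rewrite mulr0 expr0n.
  by rewrite subrr mul0r expr0n.
by rewrite subr0 mul1r; exact: (weyl_rank svdZ rA kl EC).
Qed.

Let residual_le (w : 'cV[R]_n) : sqn (Z *m w - lproj *m (Z *m w)) <= C * sqn w.
Proof.
have -> : Z *m w - lproj *m (Z *m w) =
    U *m (dg (fun l => (1 - trunc l) * s`_l) *m (V^T *m w)).
  rewrite ZE /lproj -!mulmxA (mulmxA U^T) UU mul1mx (mulmxA (dg _) (dg _)) dgM.
  rewrite -mulmxBr -mulmxBl; congr (_ *m (_ *m _)).
  rewrite /dg -linearB/=; congr diag_mx; apply/rowP => l; rewrite !mxE; ring.
rewrite (sqn_isometry _ UU) sqn_dg.
apply: (@le_trans _ _ (C * sqn (V^T *m w))).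
  rewrite /sqn mulr_sumr; apply: ler_sum => l _.
  by rewrite ler_wpM2r ?sqr_ge0.
by rewrite ler_wpM2l// sqn_bessel.
Qed.

Let residualT_le (w : 'cV[R]_m) : sqn (Z^T *m w - rproj *m (Z^T *m w)) <= C * sqn w.
Proof.
have -> : Z^T *m w - rproj *m (Z^T *m w) =
    V *m (dg (fun l => (1 - trunc l) * s`_l) *m (U^T *m w)).
  rewrite ZTE /rproj -!mulmxA (mulmxA V^T) VV mul1mx (mulmxA (dg _) (dg _)) dgM.
  rewrite -mulmxBr -mulmxBl; congr (_ *m (_ *m _)).
  rewrite /dg -linearB/=; congr diag_mx; apply/rowP => l; rewrite !mxE; ring.
rewrite (sqn_isometry _ VV) sqn_dg.
apply: (@le_trans _ _ (C * sqn (U^T *m w))).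
  rewrite /sqn mulr_sumr; apply: ler_sum => l _.
  by rewrite ler_wpM2r ?sqr_ge0.
by rewrite ler_wpM2l// sqn_bessel.
Qed.

(* First-order perturbation: (1-P)A a = (1-P)Z(1-Q)a - (1-P)E a for the left and
   right projections P and Q, and (1-Q)a is itself of order |E| |b|, so that
   only E a is of first order in the noise E = Z - A. *)
Lemma trunc_svd_perturbation (a : 'cV[R]_n) (b : 'cV[R]_m) : a = A^T *m b ->
  sqn (A *m a - lproj *m (A *m a)) <=
    2 * sqn ((Z - A) *m a) + 8 * C ^+ 2 * sqn b.
Proof.
move=> aE.
(* The factor 4: [a] is the difference of [Z^T b] and [(Z - A)^T b], each leaving at most
   [C * sqn b] after projection, and squaring a difference costs a factor 2. *)
have step1 : sqn (a - rproj *m a) <= 4 * C * sqn b.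
  have -> : a - rproj *m a = (Z^T *m b - rproj *m (Z^T *m b)) -
      ((Z - A)^T *m b - rproj *m ((Z - A)^T *m b)).
    rewrite [(Z - A)^T]linearB/= mulmxBl mulmxBr -aE.
    by apply/colP => i; rewrite !mxE; ring.
  apply: le_trans (sqn_le_double _ _) _.
  have := residualT_le b; have := sqn_projC_le rprojT rprojM ((Z - A)^T *m b).
  by have := ECT b; lra.
have -> : A *m a - lproj *m (A *m a) =
   (Z *m (a - rproj *m a) - lproj *m (Z *m (a - rproj *m a)))
    - ((Z - A) *m a - lproj *m ((Z - A) *m a)).
  have e : lproj *m (Z *m (a - rproj *m a)) = 0.
    rewrite mulmxBr (mulmxA Z rproj); have := lproj_Z => /addrI/oppr_inj <-.
    by rewrite mulmxBr (mulmxA lproj Z) (mulmxA lproj (lproj *m Z)) (mulmxA lproj lproj) lprojM subrr.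
  have e2 : Z *m (a - rproj *m a) = Z *m a - lproj *m (Z *m a).
    by rewrite mulmxBr (mulmxA Z rproj); have := lproj_Z => /addrI/oppr_inj <-; rewrite -(mulmxA lproj).
  rewrite e e2 mulmxBl mulmxBr.
  by apply/colP => i; rewrite !mxE; ring.
apply: le_trans (sqn_le_double _ _) _.
have h1 := residual_le (a - rproj *m a).
have h2 := sqn_projC_le lprojT lprojM ((Z - A) *m a).
have h3 := ler_wpM2l C0 step1.
have e : C * (4 * C * sqn b) = 4 * (C ^+ 2 * sqn b) by ring.
have e' : 8 * C ^+ 2 * sqn b = 8 * (C ^+ 2 * sqn b) by ring.
lra.
Qed.

End perturbation.
End TruncatedSVD.

Section SignalBound.
Context {R : realType} {m n : nat} (A : 'M[R]_(m, n)).
Variables (s : seq R) (U : 'M[R]_(m, minn m n)) (V : 'M[R]_(n, minn m n)).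
Hypothesis svdA : is_svd A s U V.
Variable beta : 'cV[R]_n.
Let r := \rank A.
Let zeta := A *m beta.
Let al := mpinv A *m zeta.

Lemma mpinv_fit : A *m al = zeta.
Proof. by have [e _ _ _] := svd_mpinv svdA; rewrite /al /zeta !mulmxA e. Qed.

(** The dual vector [(mpinv A)^T *m al] is the [b] required by the perturbation bound; the symmetry
    of [mpinv A *m A] moves the transpose. *)
Lemma mpinv_rowspace : al = A^T *m ((mpinv A)^T *m al).
Proof.
have [_ e _ eT] := svd_mpinv svdA.
by rewrite mulmxA -trmx_mul eT /al (mulmxA _ (mpinv A)) e.
Qed.

Let colspace : (mpinv A)^T *m al = A *m (mpinv A *m ((mpinv A)^T *m al)).
Proof.
have [_ e eT _] := svd_mpinv svdA.
rewrite (mulmxA A) -eT trmx_mul -mulmxA (mulmxA A^T) mulmxA.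
by rewrite -!trmx_mul e.
Qed.

(** By [colspace] the dual vector lies in the column space of [A], where [A^T] stretches by at least
    the smallest nonzero singular value. *)
Lemma mpinv_dual_le : s`_r.-1 ^+ 2 * sqn ((mpinv A)^T *m al) <= sqn al.
Proof.
have := svd_lower_colspace svdA (mpinv A *m ((mpinv A)^T *m al)).
by rewrite -colspace -mpinv_rowspace.
Qed.

Lemma mpinv_le : s`_r.-1 ^+ 2 * sqn al <= sqn zeta.
Proof.
have := svd_lower_rowspace svdA ((mpinv A)^T *m al).
by rewrite -mpinv_rowspace mpinv_fit.
Qed.

(** [al] and [beta] have the same image under [A], hence under any matrix whose rows combine those
    of [A]. This lets the pseudo-inverse solution replace arbitrary span coefficients at prediction
    time. *)
Lemma rowspace_mpinv k (B : 'M[R]_(k, n)) : (B <= A)%MS -> B *m al = B *m beta.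
Proof. by case/submxP => W ->; rewrite -!mulmxA mpinv_fit. Qed.

End SignalBound.

(** * Conditional laws of the panel *)

Section AlmostEverywhere.
Context {R : realType} {d : measure_display} {Om : measurableType d}.
Variable P : probability Om R.

Lemma ae_forall_countable (T : countType) (S : T -> Om -> Prop) :
  (forall t, {ae P, forall x, S t x}) -> {ae P, forall x, forall t, S t x}.
Proof.
move=> aeS.
have : {ae P, forall x, forall k, if unpickle k is Some t then S t x else True}.
  by apply/ae_foralln => k; case: unpickle => [t|]; [exact: aeS|exact: nearW].
by apply: filterS => x xS t; have := xS (pickle t); rewrite pickleK.
Qed.

Lemma null_of_pos_integral0 (D : set Om) (f : Om -> \bar R) : measurable D ->
  measurable_fun D f -> (forall x, D x -> (0 < f x)%E) ->
  (\int[P]_(x in D) f x = 0)%E -> P D = 0%E.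
Proof.
move=> mD mf f0 If.
have : ae_eq P D f (cst 0%E).
  apply/ae_eq_integral_abs => //; rewrite -If; apply: eq_integral => x.
  by rewrite inE => /f0/ltW/gee0_abs.
move=> [N [mN PN sub]]; apply/eqP; rewrite -measure_le0 -PN.
apply: le_measure; rewrite ?inE// => x Dx; apply: sub => /= /(_ Dx) fx0.
by have := f0 x Dx; rewrite fx0 ltxx.
Qed.

Lemma ae_of_null (D : set Om) : measurable D -> P D = 0%E -> {ae P, forall x, ~ D x}.
Proof. by move=> mD PD; exists D; split => // x /= /contrapT. Qed.

End AlmostEverywhere.

(** * Regular conditional probabilities *)

Section RegularConditional.
Context {R : realType} {d : measure_display} {Om : measurableType d}.
Variable P : probability Om R.
Variables (G : set (set Om)) (K : Om -> probability Om R).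
Hypothesis sG : sigma_algebra setT G.
Hypothesis Gm : G `<=` measurable.
Hypothesis rK : is_rcp P G K.

Lemma sub_sigma0 : G set0. Proof. by case: sG. Qed.
Lemma sub_sigmaC A : G A -> G (~` A).
Proof. by case: sG => _ h _ /h; rewrite setTD. Qed.
Lemma sub_sigma_bigcup (F : nat -> set Om) : (forall k, G (F k)) -> G (\bigcup_k F k).
Proof. by case: sG => _ _; exact. Qed.
Lemma sub_sigmaT : G setT. Proof. by rewrite -setC0; exact/sub_sigmaC/sub_sigma0. Qed.
Lemma sub_sigmaI A B : G A -> G B -> G (A `&` B).
Proof.
move=> GA GB; rewrite -[A `&` B]setCK setCI; apply: sub_sigmaC.
rewrite -bigcup2E; apply: sub_sigma_bigcup => -[|[|k]] /=; try exact: sub_sigmaC.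
exact: sub_sigma0.
Qed.

Lemma rcp_fin x B : measurable B -> K x B \is a fin_num.
Proof. by move=> mB; exact: fin_num_measure. Qed.

Lemma rcp_measurable B : measurable B -> measurable_fun setT (fun x => K x B).
Proof.
move=> mB; have [mf _] := rK mB.
have -> : (fun x => K x B) = EFin \o (fun x => fine (K x B)).
  by apply/funext => x /=; rewrite fineK ?rcp_fin.
by apply/measurable_EFinP; exact: measurable_for_fun mf.
Qed.

Let rcp0 C D : G C -> measurable D -> P (C `&` D) = 0%E ->
  {ae P, forall x, C x -> K x D = 0%E}.
Proof.
move=> GC mD PCD; have [_ /(_ C GC)] := rK mD; rewrite PCD => I0.
have : ae_eq P C (K^~ D) (cst 0%E).
  apply/ae_eq_integral_abs; [exact: Gm|exact/measurable_funTS/rcp_measurable|].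
  by rewrite -I0; apply: eq_integral => x _; rewrite gee0_abs.
exact.
Qed.

Lemma rcp_determined C : G C ->
  {ae P, forall x, (C x -> K x (~` C) = 0%E) /\ (~ C x -> K x C = 0%E)}.
Proof.
move=> GC; have h1 : {ae P, forall x, C x -> K x (~` C) = 0%E}.
  apply: rcp0 => //; [exact/measurableC/Gm|by rewrite setICr measure0].
have h2 : {ae P, forall x, (~` C) x -> K x C = 0%E}.
  apply: rcp0 => //; [exact: sub_sigmaC|exact: Gm|by rewrite setICl measure0].
by apply: filterS2 h1 h2 => x ? ?.
Qed.

(** The exceptional set of [rcp_determined] depends on the event, but countably many rational level
    sets suffice to pin down a real value. *)
Lemma rcp_const (f : Om -> R) : measurable_for G f ->
  {ae P, forall x, {ae K x, forall y, f y = f x}}.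
Proof.
move=> mf; pose C (q : rat) := f @^-1` `]-oo, ratr q].
have GC q : G (C q) by exact: mf.
have := ae_forall_countable (fun q => rcp_determined (GC q)).
apply: filterS => x xC.
have : {ae K x, forall y, forall q, C q y <-> C q x}.
  apply: ae_forall_countable => q; have [h1 h2] := xC q.
  have mC := Gm (GC q).
  have [Cx|Cx] := pselect (C q x).
    exists (~` C q); split; [exact: measurableC|exact: h1|].
    by move=> y /= h Cy; apply: h.
  exists (C q); split => //; first exact: h2.
  by move=> y /= h; apply: contrapT => Cy; apply: h.
apply: filterS => y h; apply/eqP; rewrite eq_le; apply/andP; split; rewrite leNgt; apply/negP.
  move=> /rat_in_itvoo[q]; rewrite in_itv/= => /andP[q1 q2].
  have [_] := h q; rewrite /C /= !in_itv/= (ltW q1) => /(_ isT).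
  by rewrite leNgt q2.
move=> /rat_in_itvoo[q]; rewrite in_itv/= => /andP[q1 q2].
have [+ _] := h q; rewrite /C /= !in_itv/= (ltW q1) => /(_ isT).
by rewrite leNgt q2.
Qed.

End RegularConditional.

Section Refinement.
Context {R : realType} {d : measure_display} {Om : measurableType d}.
Variable P : probability Om R.
Variables (G1 G2 : set (set Om)) (K1 K2 : Om -> probability Om R).
Hypotheses (sG1 : sigma_algebra setT G1) (sG2 : sigma_algebra setT G2).
Hypotheses (G12 : G1 `<=` G2) (G2m : G2 `<=` measurable).
Hypotheses (rK1 : is_rcp P G1 K1) (rK2 : is_rcp P G2 K2).
Variable H : set Om.
Hypothesis G2H : G2 H.
Hypothesis trace : forall C, G2 C -> exists2 F, G1 F & C `&` H = F `&` H.

Let G1m : G1 `<=` measurable. Proof. by move=> A /G12/G2m. Qed.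
Let mH := G2m G2H.

(* Where K2 x E < q < K1 x E inside H, a set F in G1 gives
   P (F, H, E) < q P (F, H) from K2 and P (F, H, E) >= q P (F, H) from K1. *)
Let refine_lt (E : set Om) (q : R) : measurable E ->
  {ae P, forall x, K1 x (E `&` H) = (K1 x E * K1 x H)%E} ->
  P ([set x | fine (K2 x E) < q] `&` [set x | q < fine (K1 x E)] `&` H) = 0%E.
Proof.
move=> mE ind.
have [mK1 IK1] := rK1 mE; have [mK2 IK2] := rK2 mE.
have GA : G2 [set x | fine (K2 x E) < q].
  have := mK2 `]-oo, q[%classic (measurable_itv _); rewrite (_ : _ @^-1` _ = [set x | fine (K2 x E) < q]); first by [].
  by apply/seteqP; split => x /=; rewrite in_itv.
have GB : G1 [set x | q < fine (K1 x E)].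
  have := mK1 `]q, +oo[%classic (measurable_itv _); rewrite (_ : _ @^-1` _ = [set x | q < fine (K1 x E)]); first by [].
  by apply/seteqP; split => x /=; rewrite in_itv/= andbT.
have [F0 GF0 eF0] := trace GA.
pose F := F0 `&` [set x | q < fine (K1 x E)].
have GF : G1 F by exact: sub_sigmaI.
have -> : [set x | fine (K2 x E) < q] `&` [set x | q < fine (K1 x E)] `&` H = F `&` H.
  by rewrite setIAC eF0 setIAC.
have FHlt x : (F `&` H) x -> fine (K2 x E) < q.
  move=> [[F0x _] Hx]; have : (F0 `&` H) x by [].
  by rewrite -eF0 => -[].
have mF := G1m GF.
have mFH : measurable (F `&` H) by exact: measurableI.
have [q0|q0] := ltP q 0.
  have -> : F `&` H = set0; last by rewrite measure0.
  apply/seteqP; split => // x /FHlt; apply/negP; rewrite -leNgt.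
  by rewrite (le_trans (ltW q0))// fine_ge0.
have e2 : (\int[P]_(x in F `&` H) K2 x E = P (F `&` H `&` E))%E.
  by apply: IK2; apply: sub_sigmaI => //; exact: G12.
have e1 : (\int[P]_(x in F) K1 x (E `&` H) = P (F `&` H `&` E))%E.
  have [_ /(_ F GF) ->] := rK1 (measurableI _ _ mE mH).
  by rewrite (setIC E) setIA.
have e3 : (\int[P]_(x in F) K1 x H = P (F `&` H))%E.
  by have [_ /(_ F GF) ->] := rK1 mH.
have m1E := rcp_measurable G1m rK1 mE.
have m1H := rcp_measurable G1m rK1 mH.
have m1EH := rcp_measurable G1m rK1 (measurableI _ _ mE mH).
have m2E := rcp_measurable G2m rK2 mE.
have ge : (q%:E * P (F `&` H) <= P (F `&` H `&` E))%E.
  rewrite -e1 -e3 -ge0_integralZl//; last exact: measurable_funTS.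
  have -> : (\int[P]_(x in F) K1 x (E `&` H) = \int[P]_(x in F) (K1 x E * K1 x H))%E.
    apply: ae_eq_integral => //.
    - exact: measurable_funTS.
    - by apply: measurable_funTS; exact: emeasurable_funM.
    - by apply: filterS ind => x e _.
  apply: ge0_le_integral => //.
  - by move=> x _; rewrite mule_ge0// lee_fin.
  - by apply: emeasurable_funM => //; exact: measurable_funTS.
  - by apply: measurable_funTS; exact: emeasurable_funM.
  - move=> x [_ /= qx]; rewrite lee_wpmul2r//.
    by rewrite -[leRHS]fineK ?fin_num_measure// lee_fin ltW.
have iq : P.-integrable (F `&` H) (cst q%:E).
  exact: (finite_measure_integrable_cst P q mFH).
have i2 : P.-integrable (F `&` H) (K2^~ E).
  apply/integrableP; split; first exact: measurable_funTS.
  under eq_integral do rewrite gee0_abs//.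
  by rewrite e2 ltey_eq fin_num_measure//; exact: measurableI.
apply: (@null_of_pos_integral0 _ _ _ P _ (fun x => q%:E - K2 x E)%E) => //.
- apply: emeasurable_funB => //; exact: measurable_funTS.
- move=> x /FHlt lt; rewrite -[K2 x E]fineK ?fin_num_measure// -EFinB lte_fin.
  by rewrite subr_gt0.
- have I0 : (0 <= \int[P]_(x in F `&` H) (q%:E - K2 x E))%E.
    apply: integral_ge0 => x /FHlt lt; rewrite -[K2 x E]fineK ?fin_num_measure// -EFinB lee_fin.
    by rewrite subr_ge0 ltW.
  apply/eqP; rewrite eq_le I0 andbT integralB// integral_cst// e2.
  by rewrite leeBlDr ?add0e ?fin_num_measure//; exact: measurableI.
Qed.

Let refine_le (E : set Om) : measurable E ->
  {ae P, forall x, K1 x (E `&` H) = (K1 x E * K1 x H)%E} ->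
  {ae P, forall x, H x -> (K1 x E <= K2 x E)%E}.
Proof.
move=> mE ind.
have mD q : measurable ([set x | fine (K2 x E) < q] `&` [set x | q < fine (K1 x E)] `&` H).
  have [/(measurable_for_fun G1m) mK1 _] := rK1 mE.
  have [/(measurable_for_fun G2m) mK2 _] := rK2 mE.
  apply: measurableI => //; apply: measurableI.
    rewrite -[X in measurable X]setTI (_ : [set x | _] = (fun x => fine (K2 x E)) @^-1` `]-oo, q[).
      exact: mK2.
    by apply/seteqP; split => x /=; rewrite in_itv.
  rewrite -[X in measurable X]setTI (_ : [set x | _] = (fun x => fine (K1 x E)) @^-1` `]q, +oo[).
    exact: mK1.
  by apply/seteqP; split => x /=; rewrite in_itv/= andbT.
have := @ae_forall_countable _ _ _ P rat _ (fun q => ae_of_null (mD (ratr q)) (refine_lt (ratr q) mE ind)).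
apply: filterS => x h Hx; rewrite leNgt; apply/negP.
rewrite -[K2 x E]fineK ?fin_num_measure// -[K1 x E]fineK ?fin_num_measure// lte_fin.
move=> /rat_in_itvoo[q]; rewrite in_itv/= => /andP[q1 q2].
by apply: (h q).
Qed.

(** [H] will be an event [A = b], on which the finer sigma-algebra has the same traces as the
    coarser one. Independence from [H] passes to the complement of [E], so one inequality, applied
    to [E] and to its complement, gives equality. *)
Lemma rcp_refine (E : set Om) : measurable E ->
  {ae P, forall x, K1 x (E `&` H) = (K1 x E * K1 x H)%E} ->
  {ae P, forall x, H x -> K2 x E = K1 x E}.
Proof.
move=> mE ind.
have indC : {ae P, forall x, K1 x (~` E `&` H) = (K1 x (~` E) * K1 x H)%E}.
  apply: filterS ind => x e.
  have -> : ~` E `&` H = H `\` (E `&` H).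
    by apply/seteqP; split => y /= [h1 h2]; split => // -?; tauto.
  rewrite measureD//; [|exact: measurableI|by rewrite ltey_eq fin_num_measure].
  rewrite (_ : H `&` (E `&` H) = E `&` H); last by rewrite setICA setIid.
  transitivity (K1 x H - K1 x E * K1 x H)%E; first by rewrite -e.
  rewrite probability_setC// -[K1 x E]fineK ?fin_num_measure// -[K1 x H]fineK ?fin_num_measure//.
  have h (a b : R) : b - a * b = (1 - a) * b by ring.
  exact: (congr1 EFin (h _ _)).
have h1 := refine_le mE ind. have h2 := refine_le (measurableC mE) indC.
apply: filterS2 h1 h2 => x h1 h2 Hx; apply/eqP; rewrite eq_le h1// andbT.
have := h2 Hx; rewrite !probability_setC//.
rewrite -[K1 x E]fineK ?fin_num_measure// -[K2 x E]fineK ?fin_num_measure//.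
by rewrite -!EFinB !lee_fin lerD2l lerN2.
Qed.

End Refinement.

Section RationalCylinders.
Context {R : realType} {d : measure_display} {Om : measurableType d}.
Variables (I : finType) (X : I -> Om -> R).
Hypothesis mX : forall i, measurable_fun setT (X i).

(* Rational cylinders form a countable pi-system, so identities that hold almost
   surely for each of them hold almost surely for all of them at once. *)
Definition rat_itv (o : option rat) : set R :=
  if o is Some q then `]-oo, ratr q]%classic else setT.

Definition rat_cylinder (q : {ffun I -> option rat}) : set Om :=
  \bigcap_(i in setT) X i @^-1` rat_itv (q i).

Let Gr : set (set Om) := range rat_cylinder.

Let mrat o : measurable (rat_itv o).
Proof. by case: o => [q|] //=; exact: measurable_itv. Qed.

Lemma rat_cylinder_sigma_gen (S : set (Om -> R)) q : (forall i, S (X i)) ->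
  sigma_gen S (rat_cylinder q).
Proof.
move=> SX; have sS : sigma_algebra setT (sigma_gen S) by exact: smallest_sigma_algebra.
rewrite /rat_cylinder; pose T := g_sigma_algebraType
  [set E | exists X : Om -> R, exists B : set R, [/\ S X, measurable B & E = X @^-1` B]].
have : measurable ((\bigcap_(i in setT) X i @^-1` rat_itv (q i)) : set T).
  apply: fin_bigcap_measurable => // i _.
  by apply: sub_sigma_algebra; exists (X i), (rat_itv (q i)).
by [].
Qed.

Let Gm : Gr `<=` measurable.
Proof.
move=> _ [q _ <-]; apply: fin_bigcap_measurable => // i _.
by rewrite -[X in measurable X]setTI; exact: mX.
Qed.

Let rat_itvI o1 o2 : exists o, rat_itv o1 `&` rat_itv o2 = rat_itv o.
Proof.
case: o1 o2 => [a|] [b|]; last by exists None; rewrite setIT.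
- have [ab|ba] := leP a b; [exists (Some a)|exists (Some b)];
    apply/seteqP; split => x /=; rewrite !in_itv/=.
  + by case.
  + by move=> xa; split=> //; rewrite (le_trans xa)// ler_rat.
  + by case.
  + by move=> xb; split=> //; rewrite (le_trans xb)// ler_rat ltW.
- by exists (Some a); rewrite setIT.
- by exists (Some b); rewrite setTI.
Qed.

Let GI : setI_closed Gr.
Proof.
move=> _ _ [q _ <-] [r _ <-].
pose o i := sval (cid (rat_itvI (q i) (r i))).
exists [ffun i => o i] => //; rewrite /rat_cylinder -bigcapI.
apply: eq_bigcapr => i _; rewrite ffunE /o; case: cid => /= s <-.
by rewrite preimage_setI.
Qed.

Lemma eq_on_rat_cylinders (Q1 Q2 : probability Om R) :
  (forall q, Q1 (rat_cylinder q) = Q2 (rat_cylinder q)) ->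
  forall E, sigma_gen (range X) E -> Q1 E = Q2 E.
Proof.
move=> eqG E sE.
have GT : Gr setT.
  exists [ffun=> None] => //; apply/seteqP; split => // x _ i _.
  by rewrite ffunE.
have [g1 g2] : Q1 setT = Q2 setT /\ (forall A, Gr A -> Q1 A = Q2 A).
  by split; [rewrite !probability_setT|move=> _ [q _ <-]].
apply: (@g_sigma_algebra_measure_unique _ _ _ Gr Gm (fun=> setT)) => //.
- by rewrite bigcup_const.
- by move=> _; rewrite ltey_eq fin_num_measure.
move: E sE; apply: smallest_sub; first exact: smallest_sigma_algebra.
move=> _ [_ [B [[i _ <-] mB ->]]].
(* Good sets: those whose preimage is generated by rational cylinders. They contain every open ray,
   a countable union of closed rational rays, hence all Borel sets. *)
pose T : set (set R) := [set B | <<s Gr>> (X i @^-1` B)].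
have sGr : sigma_algebra setT <<s Gr>> by exact: smallest_sigma_algebra.
have sT : sigma_algebra setT T.
  split.
  - by rewrite /T /= preimage_set0; exact: (sub_sigma0 sGr).
  - by move=> C; rewrite /T /= setTD preimage_setC; exact: (sub_sigmaC sGr).
  - by move=> C TC; rewrite /T /= preimage_bigcup; exact: (sub_sigma_bigcup sGr).
have GT' : @RGenInftyO.G R `<=` T.
  move=> _ [a ->]; rewrite /T /=.
  have -> : X i @^-1` `]-oo, a[ = \bigcup_(q : rat)
      (if ratr q < a then X i @^-1` `]-oo, ratr q] else set0).
    apply/seteqP; split => [x|x [q _]] /=; rewrite in_itv/=.
      move=> /rat_in_itvoo[q]; rewrite in_itv/= => /andP[q1 q2].
      by exists q => //; rewrite q2 /= in_itv/= ltW.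
    by case: ifP => // qa; rewrite /= in_itv/= => /le_lt_trans; exact.
  apply: (@bigcupT_measurable_rat _ (g_sigma_algebraType Gr)) => q.
  case: ifP => _; last exact: measurable0.
  apply: sub_sigma_algebra; exists [ffun j => if j == i then Some q else None] => //.
  apply/seteqP; split => x /=; first by move=> /(_ i Logic.I); rewrite ffunE eqxx.
  by move=> xq j _; rewrite ffunE; case: eqP => // ->.
have sub : <<s @RGenInftyO.G R>> `<=` T by exact: smallest_sub.
apply: (sub B); have := RGenInftyO.measurableE R.
by move=> e; exact: (eq_ind _ (fun F : set (set R) => F B) mB _ e).
Qed.

End RationalCylinders.

Section PanelConditional.
Context {R : realType} (p : panel R).
Local Notation PP := (P p).
Local Notation aidx := ('I_(Ttr p + Tpr p) * 'I_(nunit p) * assignment p)%type.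

Let sLF : sigma_algebra setT (sigma_LF (p := p)).
Proof. exact: smallest_sigma_algebra. Qed.
Let sLFA : sigma_algebra setT (sigma_LFA (p := p)).
Proof. exact: smallest_sigma_algebra. Qed.

Let LF_m : sigma_LF (p := p) `<=` measurable.
Proof.
apply: sigma_gen_measurable => f [[j [i [k [_ ->]]]]|[t [b [k ->]]]].
  exact: measurable_u.
exact: measurable_w.
Qed.

Let A_m : sigma_A (p := p) `<=` measurable.
Proof.
apply: smallest_sub; first exact: sigma_algebra_measurable.
by move=> _ [b ->]; exact: measurable_A.
Qed.

Let LFA_m : sigma_LFA (p := p) `<=` measurable.
Proof.
by apply: smallest_sub; [exact: sigma_algebra_measurable|move=> E [/LF_m|/A_m]].
Qed.

Let LF_LFA : sigma_LF (p := p) `<=` sigma_LFA (p := p).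
Proof. by move=> E LE; apply: sub_sigma_algebra; left. Qed.

Let A_LFA b : sigma_LFA (p := p) (@A R p @^-1` [set b]).
Proof. by apply: sub_sigma_algebra; right; apply: sub_sigma_algebra; exists b. Qed.

(** Sets whose trace on [A = b] comes from [sigma_LF] form a sigma-algebra. It contains each event
    [A = b'], which either coincides with [A = b] or misses it. *)
Let trace_A b C : sigma_LFA C ->
  exists2 F, sigma_LF (p := p) F & C `&` (@A R p @^-1` [set b]) = F `&` (@A R p @^-1` [set b]).
Proof.
pose H := @A R p @^-1` [set b].
pose T : set (set (Om p)) := [set C | exists2 F, sigma_LF (p := p) F & C `&` H = F `&` H].
have sT : sigma_algebra setT T.
  split.
  - by exists set0 => //; exact: (sub_sigma0 sLF).
  - move=> B [F LF e]; exists (~` F); first exact: (sub_sigmaC sLF).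
    rewrite setTD; apply/seteqP; split => x [nx Hx]; split => // cx; apply: nx.
      by have : (F `&` H) x by []; rewrite -e => -[].
    by have : (B `&` H) x by []; rewrite e => -[].
  - move=> B BT; pose F k := sval (cid2 (BT k)).
    exists (\bigcup_k F k).
      by apply: (sub_sigma_bigcup sLF) => k; rewrite /F; case: cid2.
    rewrite !setI_bigcupl; apply: eq_bigcupr => k _.
    by rewrite /F; case: cid2.
suff sub : sigma_LFA (p := p) `<=` T by exact: sub.
apply: smallest_sub => // D [LD|]; first by exists D.
suff sub : sigma_A (p := p) `<=` T by exact: sub.
apply: smallest_sub => // _ [b' ->].
have [->|bb'] := eqVneq b' b; [exists setT|exists set0].
- exact: (sub_sigmaT sLF).
- by rewrite setTI setIid.
- exact: (sub_sigma0 sLF).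
- by rewrite set0I; apply/seteqP; split => // x [/= Ax e]; case/eqP : bb'; exact: (etrans (esym Ax) e).
Qed.

(** All that is retained of the two kernels at [x]. The assignment is frozen under [Q] and the
    factors under [K]; the common law on [sigma_Y] is the bridge. Factor means are recorded instead
    of factors, since [u j i] belongs to [sigma_LF] only for neighbours. *)
Definition conditional_model (K Q : probability (Om p) R) (x : Om p) : Prop :=
  [/\ {ae Q, forall y, A y = A x},
      {ae K, forall y, forall t i (a : assignment p),
         factor_mean t i a y = factor_mean t i a x} &
      forall E, sigma_Y E -> Q E = K E].

Let Yf (k : aidx) : Om p -> R := Y k.1.1 k.1.2 k.2.

Let Yf_range : sigma_Y (p := p) = sigma_gen (range Yf).
Proof.
rewrite /sigma_Y; congr sigma_gen; apply/seteqP; split => f.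
  by move=> [t [i [a ->]]]; exists (t, i, a).
by move=> [[[t i] a] _ <-]; exists t, i, a.
Qed.

Lemma ae_conditional_model (KLF KLFA : Om p -> probability (Om p) R) :
  is_rcp PP (sigma_LF (p := p)) KLF -> is_rcp PP (sigma_LFA (p := p)) KLFA ->
  {ae PP, forall x, independent_sigma (KLF x) (sigma_Y (p := p)) (sigma_A (p := p))} ->
  {ae PP, forall x, conditional_model (KLF x) (KLFA x) x}.
Proof.
move=> rF rA ind.
have h1 : {ae PP, forall x, {ae KLFA x, forall y, A y = A x}}.
  have := @ae_forall_countable _ _ _ PP _ _ (fun b => rcp_determined sLFA LFA_m rA (A_LFA b)).
  apply: filterS => x /(_ (A x)) [/(_ erefl) K0 _].
  exists (~` (@A R p @^-1` [set A x])); split => //.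
  by apply: measurableC; exact: measurable_A.
have h2 : {ae PP, forall x, {ae KLF x, forall y, forall t i (a : assignment p),
         factor_mean t i a y = factor_mean t i a x}}.
  have hu : {ae PP, forall x, forall k : 'I_(nunit p) * 'I_(nunit p) * 'I_(rk p),
      k.1.1 \in nbr k.1.2 ->
      {ae KLF x, forall y, u k.1.1 k.1.2 y 0 k.2 = u k.1.1 k.1.2 x 0 k.2}}.
    apply: ae_forall_countable => -[[j i] k] /=.
    have [ji|ji] := boolP (j \in nbr i); last exact: nearW.
    have : measurable_for (sigma_LF (p := p)) (fun x => u j i x 0 k).
      by apply: measurable_for_gen; left; exists j, i, k.
    by move=> /(rcp_const sLF LF_m rF); apply: filterS.
  have hw : {ae PP, forall x, forall k : 'I_(Ttr p + Tpr p) * 'I_(ntreat p) * 'I_(rk p),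
      {ae KLF x, forall y, w k.1.1 k.1.2 y 0 k.2 = w k.1.1 k.1.2 x 0 k.2}}.
    apply: ae_forall_countable => -[[t b] k] /=; apply: (rcp_const sLF LF_m rF).
    by apply: measurable_for_gen; right; exists t, b, k.
  apply: filterS2 hu hw => x hu hw.
  have hu' : {ae KLF x, forall y, forall k : 'I_(nunit p) * 'I_(nunit p) * 'I_(rk p),
      k.1.1 \in nbr k.1.2 -> u k.1.1 k.1.2 y 0 k.2 = u k.1.1 k.1.2 x 0 k.2}.
    apply: ae_forall_countable => k.
    have [ji|ji] := boolP (k.1.1 \in nbr k.1.2); last exact: nearW.
    by apply: filterS (hu k ji).
  have hw' := ae_forall_countable hw.
  apply: filterS2 hu' hw' => y hy hy' t i a.
  rewrite /factor_mean big_seq [RHS]big_seq; apply: eq_bigr => j ji.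
  apply: eq_bigr => k _.
  by rewrite (hy (j, i, k) ji) (hy' (t, a j, k)).
have h3 : {ae PP, forall x, forall E, sigma_Y (p := p) E -> KLFA x E = KLF x E}.
  have mYf k : measurable_fun setT (Yf k) by exact: measurable_Y.
  have YS q : sigma_Y (p := p) (rat_cylinder Yf q).
    by rewrite Yf_range; apply: rat_cylinder_sigma_gen => k; exists k.
  have Ym : sigma_Y (p := p) `<=` measurable.
    by rewrite Yf_range; apply: sigma_gen_measurable => _ [k _ <-].
  have step q b : {ae PP, forall x, A x = b ->
      KLFA x (rat_cylinder Yf q) = KLF x (rat_cylinder Yf q)}.
    (* Conditional independence given the factors enters here, for one cylinder and one value of [A]
       at a time; both range over countable types, so the null sets can be merged. *)
    apply: (rcp_refine sLF sLFA LF_LFA LFA_m rF rA (A_LFA b)).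
    - exact: trace_A.
    - by apply: Ym; exact: YS.
    - apply: filterS ind => x; apply; first exact: YS.
      by apply: sub_sigma_algebra; exists b.
  have : {ae PP, forall x, forall q, forall b, A x = b ->
      KLFA x (rat_cylinder Yf q) = KLF x (rat_cylinder Yf q)}.
    by apply: ae_forall_countable => q; apply: ae_forall_countable => b.
  apply: filterS => x hx E; rewrite Yf_range.
  by apply: eq_on_rat_cylinders => // q; exact: (hx q (A x)).
by apply: filterS3 h1 h2 h3 => x ? ? ?; split.
Qed.

End PanelConditional.

Section Laws.
Context {R : realType} {d d' : measure_display} {Om : measurableType d}
  {Om' : measurableType d'}.
Variables (Q : probability Om R) (K : probability Om' R).

Lemma probability_ae_eq (A B : set Om) : measurable A -> measurable B ->
  {ae Q, forall y, A y <-> B y} -> Q A = Q B.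
Proof.
move=> mA mB AB; rewrite -[A]setIT -[B]setIT -!integral_indic//.
apply: ae_eq_integral => //; [exact/measurable_EFinP|exact/measurable_EFinP|].
apply: filterS AB => y AB _; congr EFin; rewrite !indicE; congr (_%:R).
by congr nat_of_bool; apply/idP/idP; rewrite !inE; apply AB.
Qed.

Variables (X : Om -> R) (X' : Om' -> R).
Hypotheses (mX : measurable_fun setT X) (mX' : measurable_fun setT X').
Hypothesis law : forall B, measurable B -> Q (X @^-1` B) = K (X' @^-1` B).

Lemma Rintegral_law (g : R -> R) : measurable_fun setT g ->
  rintegrable K (g \o X') ->
  rintegrable Q (g \o X) /\ \int[Q]_y g (X y) = \int[K]_y g (X' y).
Proof.
move=> mg /integrableP[_ ig].
have mEg : measurable_fun setT (EFin \o g) by exact/measurable_EFinP.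
pose M : {mfun Om >-> R} := mfun_Sub (mem_set mX).
pose M' : {mfun Om' >-> R} := mfun_Sub (mem_set mX').
have eqM A : measurable A -> A `<=` setT -> distribution Q M A = distribution K M' A.
  by move=> mA _; exact: law.
have iQ : rintegrable Q (g \o X).
  apply/integrableP; split; first exact/measurable_EFinP/measurableT_comp.
  rewrite -(@ge0_integral_distribution _ _ _ _ _ Q M (fun z => `|(g z)%:E|%E))//; last first.
    exact: measurableT_comp.
  rewrite (eq_measure_integral (distribution K M'))//.
  by rewrite ge0_integral_distribution//; exact: measurableT_comp.
split => //; congr fine.
have iK : rintegrable K (g \o X').
  by apply/integrableP; split => //; exact/measurable_EFinP/measurableT_comp.
rewrite -(@integral_distribution _ _ _ _ _ Q M (EFin \o g))//.
rewrite -(@integral_distribution _ _ _ _ _ K M' (EFin \o g))//.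
by apply: eq_measure_integral => A mA ?; exact: eqM.
Qed.

End Laws.

Section Psi2.
Context {R : realType} {d : measure_display} {Om : measurableType d}.
Variable Q : probability Om R.

Lemma psi2_moment4 (X : Om -> R) (c : R) : measurable_fun setT X -> 0 < c ->
  (psi2_norm Q X <= c%:E)%E ->
  rintegrable Q (fun y => X y ^+ 4) /\ \int[Q]_y (X y ^+ 4) <= 4 * (2 * c) ^+ 4.
Proof.
(* The infimum in the norm need not be attained: doubling [c] makes the inequality strict and yields
   an admissible [b] below [2 * c]. The factor 4 is the 2 of [z ^+ 4 / 2 <= expR (z ^+ 2)] times the
   2 of the Orlicz condition. *)
move=> mX c0 psi; have : (psi2_norm Q X < (2 * c)%:E)%E.
  by rewrite (le_lt_trans psi)// lte_fin ltr_pMl// ltr1n.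
move=> /ereal_inf_lt[_ [b [b0 Eb] <-]]; rewrite lte_fin => bc.
have mE : measurable_fun setT (fun y => expR ((X y / b) ^+ 2)).
  apply: measurableT_comp => //; apply: measurable_funX.
  exact: measurable_funM.
have iE : rintegrable Q (fun y => expR ((X y / b) ^+ 2)).
  apply/integrableP; split; first exact/measurable_EFinP.
  under eq_integral do rewrite /= ger0_norm ?expR_ge0//.
  by move: Eb; rewrite unlock => /le_lt_trans; apply; rewrite ltry.
have le4 y : X y ^+ 4 <= 2 * b ^+ 4 * expR ((X y / b) ^+ 2).
  have := @expR_ge1Dxn _ ((X y / b) ^+ 2) 1 (sqr_ge0 _).
  rewrite -exprM => h.
  have -> : X y ^+ 4 = b ^+ 4 * (X y / b) ^+ 4 by rewrite -exprMn mulrCA divff ?mulr1// gt_eqF.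
  have {}h : 1 + (X y / b) ^+ 4 / 2 <= expR ((X y / b) ^+ 2).
    by move: h; rewrite !factS fact0 !muln1.
  have b4 : 0 < b ^+ 4 by rewrite exprn_gt0.
  by have := ler_wpM2l (ltW b4) h; lra.
have i4 : rintegrable Q (fun y => X y ^+ 4).
  apply: (@rintegrable_le _ _ _ _ _ (fun y => 2 * b ^+ 4 * expR ((X y / b) ^+ 2))).
  - exact: measurable_funX.
  - by move=> y; rewrite ger0_norm ?exprn_even_ge0.
  - exact: rintegrableZ.
split => //.
apply: (@le_trans _ _ (2 * b ^+ 4 * 2)).
  apply: (@le_trans _ _ (\int[Q]_y (2 * b ^+ 4 * expR ((X y / b) ^+ 2)))).
    apply: le_Rintegral => //; exact: rintegrableZ.
  rewrite RintegralZl// ler_pM2l ?mulr_gt0 ?exprn_gt0//.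
  move: Eb; rewrite unlock -[leLHS]fineK ?lee_fin//.
  exact: integrable_fin_num.
rewrite mulrAC (_ : 2 * 2 = 4)// ?ler_pM2l//; last by ring.
by rewrite lerXn2r// ?nnegrE ltW// mulr_gt0.
Qed.

End Psi2.

(** The index type is arbitrary so that the same facts serve all the shocks of a panel and the
    subfamilies obtained by reindexing. *)
Definition noise_array (R : realType) d (Om : measurableType d)
    (Q : probability Om R) (I : finType) (e : I -> Om -> R) (v C4 : R) : Prop :=
  [/\ forall i, measurable_fun setT (e i),
      mutually_independent Q (finset.setT : {set I}) e,
      forall i, rintegrable Q (fun y => e i y ^+ 4) &
      forall i, [/\ \int[Q]_y e i y = 0, \int[Q]_y (e i y ^+ 2) = v &
        \int[Q]_y (e i y ^+ 4) <= C4]].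

(** * Shocks at a fixed value of the factors and treatments *)

Section ModelAt.
Context {R : realType} (p : panel R) (K Q : probability (Om p) R) (x : Om p).
Variables sigma xi : R.
Hypotheses (sigma_gt0 : 0 < sigma) (xi_gt0 : 0 < xi).
Hypothesis model : conditional_model K Q x.
Hypothesis H2 : forall t i (a : assignment p), ('E_K[noise t i a] = 0)%E.
Hypothesis H6 : independent_noise (p := p) K.
Hypothesis H6' : forall t i (a : assignment p),
  ('V_K[noise t i a] = (sigma ^+ 2)%:E)%E /\
  (psi2_norm K (noise t i a) <= (xi * sigma)%:E)%E.
Hypothesis H7 : forall t i (a : assignment p),
  ((-1)%:E <= 'E_K[Y t i a] <= 1%:E)%E.

Local Notation pairs := ('I_(Ttr p + Tpr p) * 'I_(nunit p))%type.

Definition observed t : assignment p := [ffun j => A x j t].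
Definition signal t i : R := factor_mean t i (observed t) x.
(** Centred at the constant [signal], frozen at [x], instead of the random factor mean: a function
    of [Z] alone, whose law under [Q] is that of the noise under [K]. *)
Definition shock (k : pairs) (y : Om p) : R := Z y k.1 k.2 - signal k.1 k.2.
Let nz (k : pairs) : Om p -> R := noise k.1 k.2 (observed k.1).

Lemma measurable_Z t i : measurable_fun setT (fun y => Z (p := p) y t i).
Proof.
move=> _ B mB; rewrite setTI.
have -> : (fun y => Z (p := p) y t i) @^-1` B = \bigcup_(b in [set: 'M['I_(ntreat p)]_(nunit p, Ttr p + Tpr p)])
    (@A R p @^-1` [set b] `&` Y t i [ffun j => b j t] @^-1` B).
  apply/seteqP; split => [y|y [b _] [/= e]] /=; rewrite mxE; last by rewrite e.
  by move=> By; exists (A y).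
apply: fin_bigcup_measurable => // b _; apply: measurableI; first exact: measurable_A.
by rewrite -[X in measurable X]setTI; exact: measurable_Y.
Qed.

Let measurable_fm t i (a : assignment p) : measurable_fun setT (factor_mean t i a).
Proof.
have -> : factor_mean t i a = fun y => \sum_(l < size (nbr i)) \sum_(k < rk p)
    u (nth i (nbr i) l) i y 0 k * w t (a (nth i (nbr i) l)) y 0 k.
  by apply/funext => y; rewrite /factor_mean (big_nth i) big_mkord.
apply: measurable_sum => l; apply: measurable_sum => k.
by apply: measurable_funM; [exact: measurable_u|exact: measurable_w].
Qed.

Let measurable_noise t i (a : assignment p) : measurable_fun setT (noise t i a).
Proof. by apply: measurable_funB; [exact: measurable_Y|exact: measurable_fm]. Qed.

Lemma measurable_shock k : measurable_fun setT (shock k).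
Proof. by apply: measurable_funB => //; exact: measurable_Z. Qed.

(** Under [Q] the assignment is constant, so the observed outcomes are fixed potential outcomes;
    their law is read off under [K], where the factor means are constant and subtracting them gives
    the noise. *)
Let joint_law (J : {set pairs}) (B : pairs -> set R) : (forall k, measurable (B k)) ->
  Q (\bigcap_(k in [set` J]) shock k @^-1` B k) =
  K (\bigcap_(k in [set` J]) nz k @^-1` B k).
Proof.
move=> mB; have [aeA aeF eqY] := model.
pose D k := [set z | B k (z - signal k.1 k.2)].
have mD k : measurable (D k).
  have : measurable_fun setT (fun z : R => z - signal k.1 k.2) by exact: measurable_funB.
  by move=> /(_ measurableT _ (mB k)); rewrite setTI.
pose E := \bigcap_(k in [set` J]) Y k.1 k.2 (observed k.1) @^-1` D k.
have sE : sigma_Y E.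
  pose T := g_sigma_algebraType
    [set E | exists X : Om p -> R, exists B : set R,
      [/\ [set X : Om p -> R | exists t i a, X = Y t i a] X, measurable B & E = X @^-1` B]].
  have : measurable (E : set T).
    apply: fin_bigcap_measurable => // k _.
    apply: sub_sigma_algebra; exists (Y k.1 k.2 (observed k.1)), (D k); split => //.
    by exists k.1, k.2, (observed k.1).
  by [].
have mE : measurable E.
  apply: fin_bigcap_measurable => // k _.
  by rewrite -[X in measurable X]setTI; exact: measurable_Y.
transitivity (Q E).
  apply: probability_ae_eq => //.
    apply: fin_bigcap_measurable => // k _.
    by rewrite -[X in measurable X]setTI; exact: measurable_shock.
  apply: filterS aeA => y Ay.
  have eZ k : Z y k.1 k.2 = Y k.1 k.2 (observed k.1) y.
    by rewrite mxE /observed; congr (Y _ _ _ y); apply/ffunP => j; rewrite !ffunE Ay.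
  by split=> h k kJ; have := h k kJ; rewrite /E /D /shock /= eZ.
rewrite eqY//; apply: probability_ae_eq => //.
  apply: fin_bigcap_measurable => // k _.
  by rewrite -[X in measurable X]setTI; exact: measurable_noise.
apply: filterS aeF => y fmy.
by split=> h k kJ; have := h k kJ; rewrite /E /D /nz /noise /signal /= fmy.
Qed.

Let law k B : measurable B -> Q (shock k @^-1` B) = K (nz k @^-1` B).
Proof.
move=> mB; have := @joint_law (finset.set1 k) (fun=> B) (fun=> mB).
have e (S : set (Om p)) (F : pairs -> set (Om p)) : \bigcap_(k' in [set` (finset.set1 k : {set pairs})]) F k' = F k.
  apply/seteqP; split => [y|y Fy k' /=]; last by rewrite finset.inE => /eqP ->.
  by move=> /(_ k); apply => /=; rewrite finset.inE.
by rewrite !e//; exact: set0.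
Qed.

Let nz_moment4 k : rintegrable K (fun y => nz k y ^+ 4) /\
  \int[K]_y (nz k y ^+ 4) <= 4 * (2 * (xi * sigma)) ^+ 4.
Proof.
apply: psi2_moment4; [exact: measurable_noise|exact: mulr_gt0|].
by have [] := H6' k.1 k.2 (observed k.1).
Qed.

Lemma noise_rintegrable t i (a : assignment p) : rintegrable K (noise t i a).
Proof.
have [i4 _] := @psi2_moment4 _ _ _ K (noise t i a) (xi * sigma)
  (measurable_noise t i a) (mulr_gt0 xi_gt0 sigma_gt0) (proj2 (H6' t i a)).
apply: (@rintegrable_le _ _ _ _ _ (fun y => 1 + noise t i a y ^+ 4)) => //.
  move=> y; set z := noise t i a y; rewrite ler_norml.
  have := sqr_ge0 (z ^+ 2 - 1); have := sqr_ge0 (z - 1); have := sqr_ge0 (z + 1).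
  by rewrite (_ : z ^+ 4 = (z ^+ 2) ^+ 2) -?exprM//; set w := z ^+ 2 => *; apply/andP; split; nra.
by apply: rintegrableD => //; exact: rintegrable_cst.
Qed.

Let nz2 k : rintegrable K (fun y => nz k y ^+ 2) /\ \int[K]_y (nz k y ^+ 2) = sigma ^+ 2.
Proof.
have [i4 _] := nz_moment4 k.
have i2 : rintegrable K (fun y => nz k y ^+ 2).
  apply: (@rintegrable_le _ _ _ _ _ (fun y => 1 + nz k y ^+ 4)).
  - by apply: measurable_funX; exact: measurable_noise.
  - move=> y; rewrite ger0_norm ?sqr_ge0//.
    have -> : nz k y ^+ 4 = (nz k y ^+ 2) ^+ 2 by rewrite -exprM.
    have := sqr_ge0 (nz k y); move: (nz k y ^+ 2) => w w0.
    by have := sqr_ge0 (w - 1); nra.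
  - by apply: rintegrableD => //; exact: rintegrable_cst.
split => //; have [+ _] := H6' k.1 k.2 (observed k.1).
rewrite /variance unlock H2/= unlock => e.
rewrite /Rintegral.
rewrite -[RHS]/(fine (sigma ^+ 2)%:E) -e; congr fine; apply: eq_integral => y _.
change ((nz k y ^+ 2)%:E = ((nz k y - 0) * (nz k y - 0))%:E).
by rewrite subr0 expr2.
Qed.

Lemma shock_noise_array : noise_array Q shock (sigma ^+ 2) (4 * (2 * (xi * sigma)) ^+ 4).
Proof.
have mnz k : measurable_fun setT (nz k) by exact: measurable_noise.
have tr k g : measurable_fun setT g -> rintegrable K (g \o nz k) ->
    rintegrable Q (g \o shock k) /\ \int[Q]_y g (shock k y) = \int[K]_y g (nz k y).
  apply: Rintegral_law => //; [exact: measurable_shock|exact: law].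
have mpow n : measurable_fun setT (fun z : R => z ^+ n) by exact: measurable_funX.
split.
- exact: measurable_shock.
- move=> J B _ mB; rewrite joint_law//.
  under eq_bigr do rewrite law//.
  (* Each pair is completed by the observed assignment at its measurement, so distinct pairs give
     triples that stay distinct after restriction to neighbourhoods. *)
  pose f (k : pairs) := (k, observed k.1).
  have finj : injective f by move=> k k' [].
  have := H6 (J := [set f k | k in (finset.setT : {set pairs})]%SET).
  move=> /(_ _ [set f k | k in J]%SET (fun y => B y.1)).
  have -> : \bigcap_(i in [set` [set f k | k in J]%SET]) noise i.1.1 i.1.2 i.2 @^-1` B i.1 =
      \bigcap_(k in [set` J]) nz k @^-1` B k.
    apply/seteqP; split => y h k /= kJ.
      by apply: (h (f k)) => /=; exact: imset_f.
    by case/imsetP : kJ => k' k'J -> /=; exact: h.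
  rewrite big_imset/=; last by move=> ? ? _ _; exact: finj.
  apply=> //.
  + move=> _ _ /imsetP[k _ ->] /imsetP[k' _ ->] e.
    by congr f; exact: (congr1 fst e).
  + by apply: imsetS; exact: finset.subsetT.
- by move=> k; have [i4 _] := nz_moment4 k; have [] := tr k _ (mpow 4) i4.
- move=> k; have [i4 le4] := nz_moment4 k; have [_ e4] := tr k _ (mpow 4) i4.
  have [i2 e2] := nz2 k; have [_ e2'] := tr k _ (mpow 2) i2.
  have [_ e1] := tr k _ (@measurable_id _ _ setT) (noise_rintegrable _ _ _).
  split; last by rewrite e4.
    rewrite e1; have := H2 k.1 k.2 (observed k.1); rewrite unlock => h.
    by rewrite /Rintegral h.
  by rewrite e2' e2.
Qed.

Lemma expectation_Y t i (a : assignment p) : ('E_K[Y t i a] = (factor_mean t i a x)%:E)%E.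
Proof.
have [_ aeF _] := model.
have iN := noise_rintegrable t i a.
have iS : rintegrable K (fun y => noise t i a y + factor_mean t i a x).
  by apply: rintegrableD => //; exact: rintegrable_cst.
have [iY eY] : rintegrable K (Y t i a) /\ \int[K]_y Y t i a y =
    \int[K]_y (noise t i a y + factor_mean t i a x).
  apply: Rintegral_ae => //; first exact: measurable_Y.
  by apply: filterS aeF => y fmy; rewrite /noise fmy subrK.
rewrite unlock -[LHS]fineK; last exact: integrable_fin_num.
congr EFin; transitivity (\int[K]_y Y t i a y); first by [].
rewrite eY RintegralD//; last exact: rintegrable_cst.
rewrite Rintegral_prob_cst; have := H2 t i a; rewrite unlock => h.
by rewrite /Rintegral h add0r.
Qed.

Lemma signal_bound t i : `|signal t i| <= 1.
Proof.
by have := H7 t i (observed t); rewrite expectation_Y !lee_fin ler_norml.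
Qed.

End ModelAt.

(** * Residual of the truncated regression *)

Section Linearity.
Context {R : realType} {d : measure_display} {Om : measurableType d}.
Variable Q : probability Om R.

Lemma RintegralZ (k : R) (X : Om -> R) : rintegrable Q X ->
  \int[Q]_y (k * X y) = k * \int[Q]_y X y.
Proof. by move=> iX; rewrite RintegralZl. Qed.

Lemma RintegralDT (X Y : Om -> R) : rintegrable Q X -> rintegrable Q Y ->
  \int[Q]_y (X y + Y y) = \int[Q]_y X y + \int[Q]_y Y y.
Proof. by move=> iX iY; rewrite RintegralD. Qed.

End Linearity.

Section SigmaGenCalculus.
Context {R : realType} {d : measure_display} {Om : measurableType d}.
Variable S : set (Om -> R).
Implicit Types X Y : Om -> R.

Lemma sigma_gen_cst (k : R) : measurable_for (sigma_gen S) (fun=> k).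
Proof. by apply/measurable_forP; exact: measurable_cst. Qed.

Lemma sigma_gen_fun (g : R -> R) X : measurable_fun setT g ->
  measurable_for (sigma_gen S) X -> measurable_for (sigma_gen S) (fun y => g (X y)).
Proof. by move=> mg /measurable_forP mX; apply/measurable_forP; exact: measurableT_comp. Qed.

Lemma sigma_genM X Y : measurable_for (sigma_gen S) X ->
  measurable_for (sigma_gen S) Y -> measurable_for (sigma_gen S) (fun y => X y * Y y).
Proof.
by move=> /measurable_forP mX /measurable_forP mY; apply/measurable_forP; exact: measurable_funM.
Qed.

Lemma sigma_genD X Y : measurable_for (sigma_gen S) X ->
  measurable_for (sigma_gen S) Y -> measurable_for (sigma_gen S) (fun y => X y + Y y).
Proof.
by move=> /measurable_forP mX /measurable_forP mY; apply/measurable_forP; exact: measurable_funD.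
Qed.

Lemma sigma_gen_sum (J : Type) (r : seq J) (F : J -> Om -> R) :
  (forall j, measurable_for (sigma_gen S) (F j)) ->
  measurable_for (sigma_gen S) (fun y => \sum_(j <- r) F j y).
Proof. by move=> mF; apply/measurable_forP; apply: measurable_sum => j; exact/measurable_forP. Qed.

End SigmaGenCalculus.

Section NoiseMoments.
Context {R : realType} {d : measure_display} {Om : measurableType d}.
Variables (Q : probability Om R) (I : finType) (e : I -> Om -> R) (v C4 : R).
Hypothesis H : noise_array Q e v C4.

Definition noise_sigma (J : {set I}) := sigma_gen [set e i | i in [set` J]].

Lemma noise_measurable i : measurable_fun setT (e i). Proof. by case: H. Qed.
Let me := noise_measurable.

Lemma noise_sigma_measurable J : noise_sigma J `<=` measurable.
Proof. by apply: sigma_gen_measurable => _ [i _ <-]. Qed.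

Lemma noise_sigma_gen (J : {set I}) i : i \in J -> measurable_for (noise_sigma J) (e i).
Proof. by move=> iJ; apply: measurable_for_gen; exists i. Qed.

Lemma noise_independent (J1 J2 : {set I}) (X Y : Om -> R) : (forall i, i \in J1 -> i \notin J2) ->
  measurable_for (noise_sigma J1) X -> measurable_for (noise_sigma J2) Y ->
  rintegrable Q X -> rintegrable Q Y ->
  rintegrable Q (fun y => X y * Y y) /\
  \int[Q]_y (X y * Y y) = (\int[Q]_y X y) * (\int[Q]_y Y y).
Proof.
move=> J12 mX mY iX iY; have [_ ind _ _] := H.
apply: (independent_sigma_RintegralM _ (@noise_sigma_measurable J1)
  (@noise_sigma_measurable J2)) => //.
exact: mutually_independent_groups.
Qed.

Let i4 i : rintegrable Q (fun y => e i y ^+ 4). Proof. by case: H. Qed.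

Let amgm (x y : R) : `|x * y| <= x ^+ 2 + y ^+ 2.
Proof.
rewrite ler_norml; have := sqr_ge0 (x - y); have := sqr_ge0 (x + y).
by have := sqr_ge0 x; have := sqr_ge0 y => *; apply/andP; split; nra.
Qed.

Let amgm1 (x : R) : `|x| <= 1 + x * x.
Proof. by have := amgm 1 x; rewrite mul1r expr1n expr2. Qed.

Lemma noise_rintegrable4 a b c k :
  rintegrable Q (fun y => e a y * e b y * (e c y * e k y)).
Proof.
apply: (@rintegrable_le _ _ _ _ _
  (fun y => (e a y ^+ 4 + e b y ^+ 4) + (e c y ^+ 4 + e k y ^+ 4))).
- by apply: measurable_funM; exact: measurable_funM.
- move=> y; apply: (le_trans (amgm _ _)); rewrite !exprMn.
  have q (x : R) : x ^+ 4 = (x ^+ 2) ^+ 2 by rewrite -exprM.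
  by rewrite !q; apply: lerD; exact: le_trans (ler_norm _) (amgm _ _).
- by do 2 apply: rintegrableD => //; exact: rintegrableD.
Qed.

Lemma noise_rintegrable2 a b : rintegrable Q (fun y => e a y * e b y).
Proof.
apply: (@rintegrable_le _ _ _ _ _ (fun y => 1 + e a y * e b y * (e a y * e b y))) => //.
- exact: measurable_funM.
- by apply: rintegrableD; [exact: rintegrable_cst|exact: noise_rintegrable4].
Qed.

Lemma noise_rintegrable3 b c k : rintegrable Q (fun y => e b y * (e c y * e k y)).
Proof.
apply: (@rintegrable_le _ _ _ _ _
  (fun y => e b y * e b y + e c y * e k y * (e c y * e k y))).
- by apply: measurable_funM => //; exact: measurable_funM.
- by move=> y; rewrite -!expr2.
- by apply: rintegrableD; [exact: noise_rintegrable2|exact: noise_rintegrable4].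
Qed.

Lemma noise_rintegrable1 a : rintegrable Q (e a).
Proof.
apply: (@rintegrable_le _ _ _ _ _ (fun y => 1 + e a y * e a y)) => //.
by apply: rintegrableD; [exact: rintegrable_cst|exact: noise_rintegrable2].
Qed.

Lemma noise_mean a : \int[Q]_y e a y = 0.
Proof. by have [_ _ _ /(_ a)[]] := H. Qed.

Lemma noise_var a : \int[Q]_y (e a y * e a y) = v.
Proof.
have [_ _ _ /(_ a)[_ <- _]] := H.
by apply: eq_Rintegral => y _; rewrite expr2.
Qed.

Lemma noise_moment4 a : \int[Q]_y (e a y * e a y * (e a y * e a y)) <= C4.
Proof.
have [_ _ _ /(_ a)[_ _ le]] := H; apply: le_trans le.
by rewrite le_eqVlt; apply/orP; left; apply/eqP; apply: eq_Rintegral => y _; ring.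
Qed.

Lemma noise_orth a b : \int[Q]_y (e a y * e b y) = (a == b)%:R * v.
Proof.
have [->|ab] := eqVneq a b; first by rewrite mul1r noise_var.
have dis i : i \in finset.set1 a -> i \notin finset.set1 b.
  by rewrite !finset.inE => /eqP ->.
have [_ ->] := @noise_independent (finset.set1 a) (finset.set1 b) (e a) (e b)
  dis (noise_sigma_gen (set11 _)) (noise_sigma_gen (set11 _))
  (noise_rintegrable1 a) (noise_rintegrable1 b).
by rewrite noise_mean !mul0r.
Qed.

(** An index isolated from the three others factors out with mean 0, whatever coincidences there are
    among those three. *)
Lemma noise_orth4 a b c k : a != b -> a != c -> a != k ->
  \int[Q]_y (e a y * e b y * (e c y * e k y)) = 0.
Proof.
move=> ab ac ak.
transitivity (\int[Q]_y (e a y * (e b y * (e c y * e k y)))).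
  by apply: eq_Rintegral => y _; rewrite -mulrA.
have dis i : i \in finset.set1 a -> i \notin [set b; c; k]%SET.
  by rewrite !finset.inE => /eqP ->; rewrite !negb_or ab ac.
have mbck : measurable_for (noise_sigma [set b; c; k]%SET) (fun y => e b y * (e c y * e k y)).
  apply: sigma_genM; first by apply: noise_sigma_gen; rewrite !finset.inE eqxx.
  by apply: sigma_genM; apply: noise_sigma_gen; rewrite !finset.inE eqxx ?orbT.
have [_ ->] := @noise_independent (finset.set1 a) [set b; c; k]%SET (e a)
  (fun y => e b y * (e c y * e k y)) dis (noise_sigma_gen (set11 _)) mbck
  (noise_rintegrable1 a) (noise_rintegrable3 b c k).
by rewrite noise_mean mul0r.
Qed.

Lemma noise_sq_sq a b : a != b ->
  \int[Q]_y (e a y * e b y * (e a y * e b y)) = v ^+ 2.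
Proof.
move=> ab; transitivity (\int[Q]_y (e a y * e a y * (e b y * e b y))).
  by apply: eq_Rintegral => y _; ring.
have dis i : i \in finset.set1 a -> i \notin finset.set1 b.
  by rewrite !finset.inE => /eqP ->.
have [_ ->] := @noise_independent (finset.set1 a) (finset.set1 b)
  (fun y => e a y * e a y) (fun y => e b y * e b y)
  dis (sigma_genM (noise_sigma_gen (set11 _)) (noise_sigma_gen (set11 _)))
  (sigma_genM (noise_sigma_gen (set11 _)) (noise_sigma_gen (set11 _)))
  (noise_rintegrable2 a a) (noise_rintegrable2 b b).
by rewrite !noise_var expr2.
Qed.

Lemma noise_cov_sq a b :
  rintegrable Q (fun y => (e a y * e a y - v) * (e b y * e b y - v)) /\
  \int[Q]_y ((e a y * e a y - v) * (e b y * e b y - v)) <= (a == b)%:R * C4.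
Proof.
pose F y := e a y * e a y * (e b y * e b y) - v * (e a y * e a y) - v * (e b y * e b y) + v ^+ 2.
have eF y : (e a y * e a y - v) * (e b y * e b y - v) = F y by rewrite /F; ring.
have i1 := noise_rintegrable4 a a b b.
have i2 := rintegrableZ v (noise_rintegrable2 a a).
have i3 := rintegrableZ v (noise_rintegrable2 b b).
have i12 := rintegrableB i1 i2. have i123 := rintegrableB i12 i3.
have ic : rintegrable Q (fun=> v ^+ 2) by exact: rintegrable_cst.
have iF : rintegrable Q F by exact: rintegrableD.
have -> : (fun y => (e a y * e a y - v) * (e b y * e b y - v)) = F by exact/funext.
split => //; rewrite (RintegralD _ i123 ic)// (RintegralB _ i12 i3)// (RintegralB _ i1 i2)//.
rewrite (RintegralZ v (noise_rintegrable2 a a)) (RintegralZ v (noise_rintegrable2 b b)).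
rewrite !noise_var Rintegral_prob_cst.
have [->|ab] := eqVneq a b.
  have := noise_moment4 b; have := sqr_ge0 v; rewrite mul1r expr2; lra.
rewrite mul0r; have := noise_sq_sq ab.
rewrite (_ : \int[Q]_y (e a y * e b y * (e a y * e b y)) = \int[Q]_y (e a y * e a y * (e b y * e b y))); last first.
  by apply: eq_Rintegral => y _; ring.
move=> ->; rewrite expr2; lra.
Qed.

Lemma noise_v_ge0 (a : I) : 0 <= v.
Proof. by rewrite -(noise_var a); apply: Rintegral_ge0 => y _; rewrite -expr2 sqr_ge0. Qed.

Lemma noise_C4_ge0 (a : I) : 0 <= C4.
Proof.
apply: le_trans (noise_moment4 a); apply: Rintegral_ge0 => y _.
by rewrite -expr2 sqr_ge0.
Qed.

End NoiseMoments.

Lemma measurable_neq0 (R : realType) : measurable_fun setT (fun z : R => (z != 0)%:R : R).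
Proof.
have -> : (fun z : R => (z != 0)%:R : R) = \1_(~` [set 0]).
  by apply/funext => z; rewrite indicE; case: eqVneq => [->|z0]; [rewrite memNset//= => /(_ erefl)|rewrite mem_set//=; exact/eqP].
by apply: measurable_indic; exact: measurableC.
Qed.

Section MeasurableSVD.
Context {R : realType} {d : measure_display} {Om : measurableType d} {m n : nat}.
Variable X : Om -> 'M[R]_(m, n).
Variables (s : Om -> seq R) (U : Om -> 'M[R]_(m, minn m n)) (V : Om -> 'M[R]_(n, minn m n)).
Hypothesis svdX : forall y, is_svd (X y) (s y) (U y) (V y).
Hypothesis mU : forall i l, measurable_for (sigma_mx X) (fun y => U y i l).
Hypothesis mV : forall j l, measurable_for (sigma_mx X) (fun y => V y j l).

(** Measurability is assumed of the singular vectors; the value is recovered from them as a diagonal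
    entry of [U^T X V]. *)
Lemma singular_value_measurable (l : 'I_(minn m n)) :
  measurable_for (sigma_mx X) (fun y => (s y)`_l).
Proof.
have -> : (fun y => (s y)`_l) = fun y => \sum_i \sum_j U y i l * X y i j * V y j l.
  apply/funext => y; have [_ _ UU VV XE] := svdX y.
  have : (U y)^T *m X y *m V y = diag_mx (\row_l (s y)`_l).
    by rewrite XE -!mulmxA VV mulmx1 !mulmxA UU mul1mx.
  move=> /matrixP/(_ l l); rewrite !mxE eqxx mulr1n => <-.
  rewrite exchange_big/=; apply: eq_bigr => j _; rewrite mxE mulr_suml.
  by apply: eq_bigr => i _; rewrite mxE.
apply: sigma_gen_sum => i; apply: sigma_gen_sum => j; do 2 apply: sigma_genM => //.
by apply: measurable_for_gen; exists i, j.
Qed.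

Lemma lproj_measurable kappa i j :
  measurable_for (sigma_mx X) (fun y => lproj (s y) (U y) kappa i j).
Proof.
have -> : (fun y => lproj (s y) (U y) kappa i j) =
    fun y => \sum_(l < minn m n) (U y i l * ((l < kappa)%N%:R * ((s y)`_l != 0)%:R)) * U y j l.
  apply/funext => y; rewrite /lproj mxE; apply: eq_bigr => l _.
  by rewrite /dg mul_mx_diag !mxE /trunc -natrM mulnb.
apply: sigma_gen_sum => l; apply: sigma_genM => //; apply: sigma_genM => //.
apply: sigma_genM; first exact: sigma_gen_cst.
by apply: (sigma_gen_fun (@measurable_neq0 R)); exact: singular_value_measurable.
Qed.

End MeasurableSVD.

(** The squared norm of column [j] is [P j j], which therefore dominates its own square and that of
    every entry of the column. *)
Lemma proj_entry_le1 (R : realType) (m : nat) (P : 'M[R]_m) i j :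
  P^T = P -> P *m P = P -> `|P i j| <= 1.
Proof.
move=> PT PP; have e : P j j = \sum_k P k j ^+ 2.
  rewrite -{1}PP mxE; apply: eq_bigr => k _; rewrite expr2; congr (_ * _).
  by rewrite -{1}PT mxE.
have jj : P j j ^+ 2 <= P j j.
  by rewrite [leRHS]e (bigD1 j)//= lerDl sumr_ge0// => k _; exact: sqr_ge0.
have ij : P i j ^+ 2 <= P j j.
  by rewrite [leRHS]e (bigD1 i)//= lerDl sumr_ge0// => k _; exact: sqr_ge0.
rewrite -(@expr_le1 _ 2)//.
rewrite real_normK ?num_real//; apply: (le_trans ij).
by have := sqr_ge0 (P j j - 1); nra.
Qed.

(* The projection P is a function of the donors' noise, hence independent of the
   noise eps of the target, and
   z - P z = (zeta - P zeta) + (eps - P eps) with orthogonal projections, so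
   |z - P z|^2 = |zeta - P zeta|^2 + 2 <zeta - P zeta, eps> + |eps|^2 - |P eps|^2. *)
Section Residual.
Context {R : realType} {d : measure_display} {Om : measurableType d}.
Variables (Q : probability Om R) (K : finType) (e : K -> Om -> R) (v C4 : R).
Hypothesis He : noise_array Q e v C4.
Variables (T N : nat) (f : 'I_T -> 'I_N -> K) (g : 'I_T -> K).
Hypothesis f_inj : forall t i t' i', f t i = f t' i' -> t = t' /\ i = i'.
Hypothesis g_inj : injective g.
Hypothesis fg : forall t i t', f t i != g t'.
Variable A0 : 'M[R]_(T, N).
Variables (al : 'cV[R]_N) (b : 'cV[R]_T).
Hypothesis alE : al = A0^T *m b.

Let E y : 'M[R]_(T, N) := \matrix_(t, i) e (f t i) y.
Let X y : 'M[R]_(T, N) := A0 + E y.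
Let eps y : 'cV[R]_T := \col_t e (g t) y.
Let zeta := A0 *m al.
Let z y : 'cV[R]_T := zeta + eps y.
Hypothesis zeta_le : sqn zeta <= T%:R.

Variables (s : Om -> seq R) (U : Om -> 'M[R]_(T, minn T N)) (V : Om -> 'M[R]_(N, minn T N)).
Hypothesis svdX : forall y, is_svd (X y) (s y) (U y) (V y).
Hypothesis mU : forall i l, measurable_for (sigma_mx X) (fun y => U y i l).
Hypothesis mV : forall j l, measurable_for (sigma_mx X) (fun y => V y j l).
Variable kappa : nat.
Hypothesis rA : (\rank A0 <= kappa)%N.

Let P y := lproj (s y) (U y) kappa.
Let PT y : (P y)^T = P y. Proof. exact: lprojT. Qed.
Let PP y : P y *m P y = P y. Proof. exact: lprojM (svdX y) _. Qed.

Let JX : {set K} := [set f ti.1 ti.2 | ti in (finset.setT : {set 'I_T * 'I_N})]%SET.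
Let JZ : {set K} := [set g t | t in (finset.setT : {set 'I_T})]%SET.

Let JXZ k : k \in JX -> k \notin JZ.
Proof.
move=> /imsetP[[t i] _ ->] /=; apply/imsetP => -[t' _ /eqP].
by apply/negP; exact: fg.
Qed.

Let sX : sigma_mx X `<=` noise_sigma e JX.
Proof.
apply: sigma_gen_subset => _ [t [i ->]].
have -> : (fun y => X y t i) = fun y => A0 t i + e (f t i) y.
  by apply/funext => y; rewrite !mxE.
apply: sigma_genD; first exact: sigma_gen_cst.
by apply: noise_sigma_gen; apply/imsetP; exists (t, i).
Qed.

Let mP i j : measurable_for (noise_sigma e JX) (fun y => P y i j).
Proof. by move=> B mB; apply: sX; exact: (lproj_measurable svdX mU mV). Qed.

Let meps t t' : measurable_for (noise_sigma e JZ) (fun y => e (g t) y * e (g t') y).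
Proof. by apply: sigma_genM; apply: noise_sigma_gen; exact: imset_f. Qed.

Let measP i j : measurable_fun setT (fun y => P y i j).
Proof. exact: measurable_for_fun (noise_sigma_measurable He (J := JX)) (mP i j). Qed.

(** Independence of [M] from the target's shocks separates the expectations, and orthogonality of
    those shocks leaves the diagonal of [M]. Applied to the projection, whose trace is bounded, and
    to the outer square of the bias. *)
Let quad_noise (M : 'I_T -> 'I_T -> Om -> R) (B : R) :
  (forall i j, measurable_for (noise_sigma e JX) (M i j)) ->
  (forall i j y, `|M i j y| <= B) ->
  rintegrable Q (fun y => \sum_i \sum_j M i j y * (eps y i 0 * eps y j 0)) /\
  \int[Q]_y (\sum_i \sum_j M i j y * (eps y i 0 * eps y j 0)) =
    v * \int[Q]_y (\sum_i M i i y).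
Proof.
move=> mM leM.
have iM i j : rintegrable Q (M i j).
  apply: (@rintegrable_le _ _ _ _ _ (fun=> B)) => //; last exact: rintegrable_cst.
  exact: measurable_for_fun (noise_sigma_measurable He (J := JX)) (mM i j).
have h i j := noise_independent He JXZ (mM i j) (meps i j) (iM i j)
  (noise_rintegrable2 He (g i) (g j)).
have ee y i j : M i j y * (eps y i 0 * eps y j 0) = M i j y * (e (g i) y * e (g j) y).
  by rewrite !mxE.
have -> : (fun y => \sum_i \sum_j M i j y * (eps y i 0 * eps y j 0)) =
    fun y => \sum_i \sum_j M i j y * (e (g i) y * e (g j) y).
  by apply/funext => y; do 2 apply: eq_bigr => ? _; exact: ee.
split.
  by apply: rintegrable_sum => i _; apply: rintegrable_sum => j _; have [] := h i j.
have i1 i : rintegrable Q (fun y => \sum_j M i j y * (e (g i) y * e (g j) y)).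
  by apply: rintegrable_sum => j _; have [] := h i j.
rewrite Rintegral_sum// Rintegral_sum// mulr_sumr; apply: eq_bigr => i _.
rewrite Rintegral_sum; last by move=> j _; have [] := h i j.
rewrite (bigD1 i)//= big1 ?addr0 => [|j ji].
  by have [_ ->] := h i i; rewrite (noise_var He) mulrC.
have [_ ->] := h i j; rewrite (noise_orth He) (inj_eq g_inj) eq_sym (negbTE ji).
by rewrite mul0r mulr0.
Qed.

Let v_ge0 : (0 < T)%N -> 0 <= v.
Proof. by move=> T0; exact: noise_v_ge0 He (g (Ordinal T0)). Qed.

Let projected_noise : rintegrable Q (fun y => sqn (P y *m eps y)) /\
  ((0 < T)%N -> \int[Q]_y sqn (P y *m eps y) <= v * kappa%:R).
Proof.
have -> : (fun y => sqn (P y *m eps y)) =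
    fun y => \sum_i \sum_j P y i j * (eps y i 0 * eps y j 0).
  by apply/funext => y; rewrite sqn_projE.
have [iP eP] := @quad_noise (fun i j y => P y i j) 1 mP
  (fun i j y => proj_entry_le1 i j (PT y) (PP y)).
split=> // T0; rewrite eP ler_wpM2l ?v_ge0//.
rewrite -(Rintegral_prob_cst Q kappa%:R); apply: le_Rintegral => //.
- apply: rintegrable_sum => i _.
  apply: (@rintegrable_le _ _ _ _ _ (fun=> 1)) => //; last exact: rintegrable_cst.
  by move=> y; exact: proj_entry_le1.
- exact: rintegrable_cst.
- by move=> y _; exact: (lproj_trace (svdX y) kappa).
Qed.

Let bias y := zeta - P y *m zeta.

Let bias_le y i j : `|bias y i 0 * bias y j 0| <= T%:R.
Proof.
have le : sqn (bias y) <= T%:R by exact: le_trans (sqn_projC_le (PT y) (PP y) zeta) zeta_le.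
have comp k : bias y k 0 ^+ 2 <= sqn (bias y).
  by rewrite /sqn (bigD1 k)//= lerDl sumr_ge0// => ? _; exact: sqr_ge0.
have := comp i; have := comp j; move: (bias y i 0) (bias y j 0) => a c ha hc.
rewrite ler_norml; have := sqr_ge0 (a - c); have := sqr_ge0 (a + c).
by move=> *; apply/andP; split; nra.
Qed.

Let cross : rintegrable Q (fun y => ((bias y)^T *m eps y) 0 0 ^+ 2) /\
  ((0 < T)%N -> \int[Q]_y (((bias y)^T *m eps y) 0 0 ^+ 2) <= v * T%:R).
Proof.
have -> : (fun y => ((bias y)^T *m eps y) 0 0 ^+ 2) =
    fun y => \sum_i \sum_j (bias y i 0 * bias y j 0) * (eps y i 0 * eps y j 0).
  apply/funext => y; rewrite mxE expr2 mulr_suml; apply: eq_bigr => i _.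
  rewrite mulr_sumr; apply: eq_bigr => j _; rewrite !mxE; ring.
have mb i : measurable_for (noise_sigma e JX) (fun y => bias y i 0).
  have -> : (fun y => bias y i 0) = fun y => zeta i 0 + (-1) * \sum_j P y i j * zeta j 0.
    by apply/funext => y; rewrite /bias !mxE mulN1r.
  apply: sigma_genD; first exact: sigma_gen_cst.
  apply: sigma_genM; first exact: sigma_gen_cst.
  by apply: sigma_gen_sum => j; apply: sigma_genM => //; exact: sigma_gen_cst.
have [iP eP] := @quad_noise (fun i j y => bias y i 0 * bias y j 0) T%:R
  (fun i j => sigma_genM (mb i) (mb j)) (fun i j y => bias_le y i j).
split=> // T0; rewrite eP ler_wpM2l ?v_ge0//.
rewrite -(Rintegral_prob_cst Q T%:R); apply: le_Rintegral => //.
- apply: rintegrable_sum => i _.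
  apply: (@rintegrable_le _ _ _ _ _ (fun=> T%:R)) => //; last exact: rintegrable_cst.
  by apply: measurable_funM; exact: measurable_for_fun (noise_sigma_measurable He (J := JX)) (mb i).
- exact: rintegrable_cst.
- move=> y _; apply: le_trans (le_trans (sqn_projC_le (PT y) (PP y) zeta) zeta_le).
  by rewrite le_eqVlt; apply/orP; left; apply/eqP; apply: eq_bigr => i _; rewrite expr2.
Qed.

Let direct : rintegrable Q (fun y => sqn (E y *m al)) /\
  \int[Q]_y sqn (E y *m al) = T%:R * v * sqn al.
Proof.
have -> : (fun y => sqn (E y *m al)) = fun y => \sum_t \sum_i \sum_j
    (al i 0 * al j 0) * (e (f t i) y * e (f t j) y).
  apply/funext => y; apply: eq_bigr => t _; rewrite mxE expr2 mulr_suml.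
  apply: eq_bigr => i _; rewrite mulr_sumr; apply: eq_bigr => j _; rewrite !mxE; ring.
have ik t i j : rintegrable Q (fun y => (al i 0 * al j 0) * (e (f t i) y * e (f t j) y)).
  by apply: rintegrableZ; exact: (noise_rintegrable2 He).
have ij t i : rintegrable Q (fun y => \sum_j (al i 0 * al j 0) * (e (f t i) y * e (f t j) y)).
  by apply: rintegrable_sum.
have it t : rintegrable Q (fun y => \sum_i \sum_j (al i 0 * al j 0) * (e (f t i) y * e (f t j) y)).
  by apply: rintegrable_sum.
split; first exact: rintegrable_sum.
rewrite Rintegral_sum//.
rewrite (eq_bigr (fun=> v * sqn al)) => [|t _].
  by rewrite sumr_const card_ord -mulrA mulr_natl.
rewrite Rintegral_sum// /sqn mulr_sumr; apply: eq_bigr => i _.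
rewrite Rintegral_sum// (bigD1 i)//= big1 ?addr0 => [|j ji]; rewrite RintegralZ ?(noise_orth He) ?eqxx ?mul1r; try exact: (noise_rintegrable2 He).
  by rewrite mulrC expr2.
have /negbTE-> : f t i != f t j by apply: contra_neq ji => /f_inj[].
by rewrite mul0r mulr0.
Qed.

(** The mean of [F i j t t'] vanishes unless [i = j] or [t = t'], which happens for [N T^2] and
    [N^2 T] index quadruples respectively. *)
Let gram : rintegrable Q (fun y => frob ((E y)^T *m E y) ^+ 2) /\
  \int[Q]_y (frob ((E y)^T *m E y) ^+ 2) <=
    (N%:R * T%:R ^+ 2 + N%:R ^+ 2 * T%:R) * (C4 + v ^+ 2).
Proof.
pose F i j t t' y := e (f t i) y * e (f t j) y * (e (f t' i) y * e (f t' j) y).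
have -> : (fun y => frob ((E y)^T *m E y) ^+ 2) =
    fun y => \sum_i \sum_j \sum_t \sum_t' F i j t t' y.
  apply/funext => y; rewrite frob_sqr; apply: eq_bigr => i _; apply: eq_bigr => j _.
  rewrite mxE expr2 mulr_suml; apply: eq_bigr => t _; rewrite mulr_sumr.
  by apply: eq_bigr => t' _; rewrite !mxE.
have i4 i j t t' : rintegrable Q (F i j t t') by exact: (noise_rintegrable4 He).
have i3 i j t : rintegrable Q (fun y => \sum_t' F i j t t' y) by exact: rintegrable_sum.
have i2 i j : rintegrable Q (fun y => \sum_t \sum_t' F i j t t' y) by exact: rintegrable_sum.
have i1 i : rintegrable Q (fun y => \sum_j \sum_t \sum_t' F i j t t' y) by exact: rintegrable_sum.
split; first exact: rintegrable_sum.
have leF i j t t' : \int[Q]_y F i j t t' y <= ((i == j)%:R + (t == t')%:R) * (C4 + v ^+ 2).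
  have C0 := noise_C4_ge0 He (f t i); have v2 := sqr_ge0 v.
  have [<-|ij] := eqVneq i j.
    have [<-|tt'] := eqVneq t t'.
      by apply: le_trans (noise_moment4 He (f t i)) _; rewrite /=; lra.
    rewrite (_ : \int[Q]_y F i i t t' y =
      \int[Q]_y (e (f t i) y * e (f t' i) y * (e (f t i) y * e (f t' i) y))); last first.
      by apply: eq_Rintegral => y _; rewrite /F; ring.
    rewrite (noise_sq_sq He); first by rewrite /=; lra.
    by apply: contra_neq tt' => /f_inj[].
  have [<-|tt'] := eqVneq t t'.
    rewrite (noise_sq_sq He); first by rewrite /=; lra.
    by apply: contra_neq ij => /f_inj[].
  rewrite (noise_orth4 He) ?addr0 ?mul0r//.
  - by apply: contra_neq ij => /f_inj[].
  - by apply: contra_neq tt' => /f_inj[].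
  - by apply: contra_neq tt' => /f_inj[].
have sum_eq q (k : 'I_q) : \sum_(k' < q) (k == k')%:R = 1 :> R.
  by rewrite (bigD1 k)//= eqxx big1 ?addr0// => k' /negbTE; rewrite eq_sym => ->.
rewrite Rintegral_sum//.
apply: (@le_trans _ _ (\sum_(i < N) \sum_(j < N) \sum_(t < T) \sum_(t' < T)
    ((i == j)%:R + (t == t')%:R) * (C4 + v ^+ 2))).
  apply: ler_sum => i _; rewrite Rintegral_sum//; apply: ler_sum => j _.
  rewrite Rintegral_sum//; apply: ler_sum => t _; rewrite Rintegral_sum//.
  exact: ler_sum.
under eq_bigr do under eq_bigr do under eq_bigr do
  rewrite -mulr_suml big_split/= sum_eq sumr_const card_ord.
under eq_bigr do under eq_bigr do
  rewrite -mulr_suml big_split/= !sumr_const card_ord.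
under eq_bigr do rewrite -mulr_suml big_split/= !sumrMnl sum_eq sumr_const card_ord.
rewrite -mulr_suml big_split/= !sumr_const !card_ord.
rewrite le_eqVlt; apply/orP; left; apply/eqP; congr (_ * _).
rewrite -!mulrnA; ring.
Qed.

Let variance_error : rintegrable Q (fun y => (sqn (eps y) - T%:R * v) ^+ 2) /\
  \int[Q]_y ((sqn (eps y) - T%:R * v) ^+ 2) <= T%:R * C4.
Proof.
pose F t t' y := (e (g t) y * e (g t) y - v) * (e (g t') y * e (g t') y - v).
have -> : (fun y => (sqn (eps y) - T%:R * v) ^+ 2) = fun y => \sum_t \sum_t' F t t' y.
  apply/funext => y.
  have -> : sqn (eps y) - T%:R * v = \sum_t (e (g t) y * e (g t) y - v).
    rewrite big_split/= sumr_const card_ord mulNrn mulr_natl; congr (_ - _).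
    by apply: eq_bigr => t _; rewrite mxE expr2.
  rewrite expr2 mulr_suml; apply: eq_bigr => t _; rewrite mulr_sumr.
  by apply: eq_bigr => t' _.
have i2 t t' : rintegrable Q (F t t') by have [] := noise_cov_sq He (g t) (g t').
have i1 t : rintegrable Q (fun y => \sum_t' F t t' y) by exact: rintegrable_sum.
split; first exact: rintegrable_sum.
rewrite Rintegral_sum// mulr_natl -[X in _ *+ X]card_ord -sumr_const.
apply: ler_sum => t _; rewrite Rintegral_sum//.
apply: (@le_trans _ _ (\sum_t' (t == t')%:R * C4)).
  by apply: ler_sum => t' _; have [_] := noise_cov_sq He (g t) (g t'); rewrite (inj_eq g_inj).
rewrite (bigD1 t)//= eqxx mul1r big1 ?addr0// => t' /negbTE; rewrite eq_sym => ->.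
by rewrite mul0r.
Qed.

Lemma residual_measurable : measurable_fun setT (fun y => sqn (z y - P y *m z y)).
Proof.
have mz t : measurable_fun setT (fun y => z y t 0).
  have -> : (fun y => z y t 0) = fun y => zeta t 0 + e (g t) y.
    by apply/funext => y; rewrite /z !mxE.
  by apply: measurable_funD => //; exact: noise_measurable He _.
rewrite /sqn; apply: measurable_sum => t; apply: measurable_funX.
have -> : (fun y => (z y - P y *m z y) t 0) = fun y => z y t 0 - \sum_j P y t j * z y j 0.
  by apply/funext => y; rewrite mxE [X in _ + X]mxE [X in _ - X]mxE.
by apply: measurable_funB => //; apply: measurable_sum => j; exact: measurable_funM.
Qed.

(** A dominating variable is produced rather than a tail bound: its mean is all that Markov's
    inequality asks for. *)
Lemma residual_bound : (0 < T)%N -> exists W : Om -> R,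
  [/\ rintegrable Q W, forall y, `|T%:R^-1 * sqn (z y - P y *m z y) - v| <= W y &
   \int[Q]_y W y <= T%:R^-1 * (2 * T%:R * v * sqn al +
     8 * ((N%:R * T%:R ^+ 2 + N%:R ^+ 2 * T%:R) * (C4 + v ^+ 2)) * sqn b +
     Num.sqrt T%:R * (C4 + v + 2) + v * kappa%:R)].
Proof.
move=> T0; have Tp : 0 < T%:R :> R by rewrite ltr0n.
set rT := Num.sqrt T%:R; have rTp : 0 < rT by rewrite sqrtr_gt0.
have rT2 : rT ^+ 2 = T%:R by rewrite sqr_sqrtr// ltW.
have [i1 e1] := direct; have [i2 e2] := gram; have [i3 e3] := cross.
have [i4 e4] := variance_error; have [i5 e5] := projected_noise.
(* [W1] and [W2] bound the squared bias by the perturbation lemma, with [C] the Gram norm. [W3] and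
   [W4] come from [2 |a| <= a^2 / sqrt T + sqrt T], for the cross term and for the fluctuation of
   the squared shocks; each use leaves one [rT]. *)
pose W1 y := 2 * sqn (E y *m al); pose W2 y := (8 * sqn b) * frob ((E y)^T *m E y) ^+ 2.
pose W3 y := rT^-1 * ((bias y)^T *m eps y) 0 0 ^+ 2.
pose W4 y := rT^-1 * (sqn (eps y) - T%:R * v) ^+ 2.
pose W y := T%:R^-1 * (W1 y + W2 y + W3 y + W4 y + sqn (P y *m eps y) + 2 * rT).
have j1 : rintegrable Q W1 by exact: rintegrableZ.
have j2 : rintegrable Q W2 by exact: rintegrableZ.
have j3 : rintegrable Q W3 by exact: rintegrableZ.
have j4 : rintegrable Q W4 by exact: rintegrableZ.
have k2 := rintegrableD j1 j2; have k3 := rintegrableD k2 j3.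
have k4 := rintegrableD k3 j4; have k5 := rintegrableD k4 i5.
have kc : rintegrable Q (fun=> 2 * rT) by exact: rintegrable_cst.
have k6 := rintegrableD k5 kc.
exists W; split.
- exact: rintegrableZ.
- move=> y; set D := sqn _.
  have -> : T%:R^-1 * D - v = T%:R^-1 * (D - T%:R * v).
    by rewrite mulrBr mulKf// gt_eqF.
  rewrite normrM gtr0_norm ?invr_gt0// ler_pM2l ?invr_gt0//.
  set gb := bias y; set h := eps y - P y *m eps y.
  have DE : D = sqn gb + 2 * (gb^T *m eps y) 0 0 + (sqn (eps y) - sqn (P y *m eps y)).
    have hE : sqn (eps y) - sqn (P y *m eps y) = sqn h.
      by rewrite (sqn_proj_pythagoras (PT y) (PP y) (eps y)); ring.
    have -> : (gb^T *m eps y) 0 0 = (gb^T *m h) 0 0 by rewrite dot_projC.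
    have zE : z y - P y *m z y = gb + h.
      rewrite /z mulmxDr /gb /bias /h.
      by apply/colP => k; rewrite !mxE; ring.
    rewrite hE /D zE mxE /sqn mulr_sumr -!big_split/=; apply: eq_bigr => k _.
    by rewrite !mxE; ring.
  have gb_le : sqn gb <= W1 y + W2 y.
    have [q1 q2] := sqn_gram_le (E y).
    have XA : X y - A0 = E y by rewrite /X addrAC subrr add0r.
    have := @trunc_svd_perturbation _ _ _ _ _ _ _ (svdX y) kappa A0
      (frob ((E y)^T *m E y)) rA (frob_ge0 _).
    rewrite XA => /(_ q1 q2 _ _ alE); rewrite /W1 /W2 /gb /bias /zeta /P => /le_trans; apply.
    by rewrite lerD2l mulrAC.
  have amgm (a : R) : 2 * `|a| <= rT^-1 * a ^+ 2 + rT.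
    rewrite -(ler_pM2l rTp) mulrDr (mulVKf (lt0r_neq0 rTp)) -[rT * rT]expr2.
    rewrite -(real_normK (num_real a)).
    by have := sqr_ge0 (rT - `|a|); nra.
  have a1 := amgm ((gb^T *m eps y) 0 0); have a2 := amgm (sqn (eps y) - T%:R * v).
  have p1 := sqn_ge0 (P y *m eps y); have p2 := sqn_ge0 gb.
  rewrite -[rT^-1 * _ ^+ 2]/(W3 y) in a1; rewrite -[rT^-1 * _ ^+ 2]/(W4 y) in a2.
  rewrite DE.
  have := ler_norm ((gb^T *m eps y) 0 0); have := ler_normr (- (gb^T *m eps y) 0 0) ((gb^T *m eps y) 0 0).
  move: (gb^T *m eps y) (sqn (eps y)) a1 a2 => c q a1 a2 _ _.
  have n1 := ler_norm (c 0 0); have n2 := ler_norm (- c 0 0).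
  have n3 := ler_norm (q - T%:R * v); have n4 := ler_norm (- (q - T%:R * v)).
  rewrite !normrN in n2 n4.
  have n5 := normr_ge0 (q - T%:R * v).
  by rewrite ler_norml; apply/andP; split; lra.
- rewrite (RintegralZ _ k6) ler_pM2l ?invr_gt0//.
  rewrite (RintegralDT k5 kc) (RintegralDT k4 i5) (RintegralDT k3 j4) (RintegralDT k2 j3).
  rewrite (RintegralDT j1 j2) Rintegral_prob_cst.
  rewrite /W1 /W2 /W3 /W4 !RintegralZ// e1.
  have {}e2 : 8 * sqn b * (\int[Q]_y (frob ((E y)^T *m E y) ^+ 2)) <=
      8 * ((N%:R * T%:R ^+ 2 + N%:R ^+ 2 * T%:R) * (C4 + v ^+ 2)) * sqn b.
    rewrite [leRHS]mulrAC ler_wpM2l// mulr_ge0// sqn_ge0//.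
  have {}e3 : rT^-1 * (\int[Q]_y (((bias y)^T *m eps y) 0 0 ^+ 2)) <= rT * v.
    rewrite ler_pdivrMl// mulrA -expr2 rT2 mulrC; exact: e3.
  have {}e4 : rT^-1 * (\int[Q]_y ((sqn (eps y) - T%:R * v) ^+ 2)) <= rT * C4.
    rewrite ler_pdivrMl// mulrA -expr2 rT2; exact: e4.
  have := e5 T0; lra.
Qed.

End Residual.

(** [xget] falls back on the empty sequence, whose entry 0 reads 0, so a nonzero first value
    certifies that a decomposition exists. *)
Lemma singular_values_svd (R : realType) m n (A : 'M[R]_(m, n)) :
  (singular_values A)`_0 != 0 -> exists U V, is_svd A (singular_values A) U V.
Proof.
rewrite /singular_values; case: xgetP => [s _ svd _|_]; first exact: svd.
by rewrite nth_nil eqxx.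
Qed.

(** Here [x] stands for xi''', [S] for the square of the smallest nonzero singular value, [a] and
    [b] for the squared norms of alpha and of its dual vector. The three relations give
    [a <= r / (x^2 N)] and [b <= r^2 / (x^4 T N^2)]. The constant adds up [C4 + v + 2], from the
    first rate, and [16 C4 + 16 v^2 + 3 v], from the second. *)
Lemma residual_rate_arith (R : realType) (T N r v C4 x S a b : R) :
  1 <= T -> 1 <= N -> 1 <= r -> 0 <= v -> 0 <= C4 -> 0 < x -> x <= 1 -> 0 <= S ->
  0 <= a -> 0 <= b ->
  x ^+ 2 * (T * N) <= r * S -> S * a <= T -> S * b <= a ->
  T^-1 * (2 * T * v * a + 8 * ((N * T ^+ 2 + N ^+ 2 * T) * (C4 + v ^+ 2)) * b +
     Num.sqrt T * (C4 + v + 2) + v * r) <=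
  (17 * C4 + 4 * v + 2 + 16 * v ^+ 2) *
    (r / Num.sqrt T + r ^+ 2 / (x ^+ 4 * Num.min T N)).
Proof.
move=> T1 N1 r1 v0 C0 x0 x1 S0 a0 b0 hS hSa hSb.
have T0 : 0 < T by rewrite (lt_le_trans ltr01).
have N0 : 0 < N by rewrite (lt_le_trans ltr01).
have r0 : 0 < r by rewrite (lt_le_trans ltr01).
have T0' := ltW T0; have N0' := ltW N0; have r0' := ltW r0; have x0' := ltW x0.
set M := Num.min T N; set rT := Num.sqrt T.
have [MT MN M0] : [/\ M <= T, M <= N & 0 < M] by rewrite /M; split; rewrite ?ge_min ?lt_min ?lexx ?orbT ?T0.
have rT0 : 0 < rT by rewrite sqrtr_gt0.
have rT2 : T = rT * rT by rewrite -expr2 sqr_sqrtr// ltW.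
have x20 : 0 < x ^+ 2 by rewrite exprn_gt0.
have x40 : 0 < x ^+ 4 by rewrite exprn_gt0.
have x20' := ltW x20; have x40' := ltW x40; have rT0' := ltW rT0; have M0' := ltW M0.
have x2 : x ^+ 2 <= 1 by rewrite expr_le1// ltW.
have x4 : x ^+ 4 <= 1 by rewrite expr_le1// ltW.
have x4E : x ^+ 4 = x ^+ 2 * x ^+ 2 by rewrite -exprD.
have ha : x ^+ 2 * N * a <= r.
  rewrite -(ler_pM2r T0) (_ : _ * T = x ^+ 2 * (T * N) * a); last by ring.
  apply: (@le_trans _ _ (r * S * a)); first by rewrite ler_wpM2r.
  by rewrite -mulrA ler_wpM2l// ltW.
have hb : x ^+ 4 * T * N ^+ 2 * b <= r ^+ 2.
  apply: (@le_trans _ _ (x ^+ 2 * N * (r * a))); last first.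
    by rewrite mulrCA expr2 ler_wpM2l// ltW.
  rewrite x4E (_ : _ * b = x ^+ 2 * N * (x ^+ 2 * (T * N) * b)); last by ring.
  rewrite ler_wpM2l//; first by rewrite mulr_ge0// ltW.
  apply: (@le_trans _ _ (r * S * b)); first by rewrite ler_wpM2r.
  by rewrite -mulrA ler_wpM2l// ltW.
have rr : r <= r ^+ 2 by rewrite expr2 ler_peMl// ltW.
set w := r ^+ 2 / (x ^+ 4 * M).
have xM0 : 0 < x ^+ 4 * M by rewrite mulr_gt0.
have w1 : a <= w.
  rewrite /w ler_pdivlMr// (le_trans _ rr)//.
  apply: (@le_trans _ _ (x ^+ 2 * (x ^+ 2 * N * a))).
    rewrite (_ : x ^+ 2 * _ = a * (x ^+ 4 * N)); last by rewrite x4E; ring.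
    by rewrite ler_wpM2l// ler_wpM2l// ltW.
  apply: (le_trans _ ha); rewrite ler_piMl// !mulr_ge0//.
have w2 : (N * T + N ^+ 2) * b <= 2 * w.
  rewrite /w mulrA ler_pdivlMr// [leLHS](_ : _ = (x ^+ 4 * b * N) * (M * T + M * N)); last by ring.
  apply: (@le_trans _ _ (2 * (x ^+ 4 * T * N ^+ 2 * b))); last by rewrite ler_pM2l.
  rewrite (_ : 2 * _ = x ^+ 4 * b * N * (N * T + T * N)); last by ring.
  rewrite ler_wpM2l//; first by rewrite !mulr_ge0// ltW.
  by rewrite lerD// ler_wpM2r// ltW.
have w3 : r / T <= w.
  rewrite /w ler_pdivrMr// mulrAC ler_pdivlMr//.
  rewrite ler_pM// ?mulr_ge0//.
  by rewrite -[leRHS]mul1r ler_pM.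
have w0 : 0 <= w by exact: le_trans a0 w1.
have q0 : rT^-1 <= r / rT by rewrite ler_peMl// invr_ge0 ltW.
have q0' : 0 <= r / rT by rewrite divr_ge0// ltW.
have -> : T^-1 * (2 * T * v * a + 8 * ((N * T ^+ 2 + N ^+ 2 * T) * (C4 + v ^+ 2)) * b +
     rT * (C4 + v + 2) + v * r) = 2 * v * a +
   8 * (C4 + v ^+ 2) * ((N * T + N ^+ 2) * b) + (C4 + v + 2) * rT^-1 + v * (r / T).
  have -> : T^-1 = rT^-1 * rT^-1 by rewrite rT2 invfM.
  by rewrite rT2; field; rewrite gt_eqF.
have v2 := sqr_ge0 v.
have h1 := ler_wpM2l v0 w1; have h2 := ler_wpM2l (addr_ge0 C0 v2) w2.
have h3 := ler_wpM2l v0 w3.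
have h4 : (C4 + v + 2) * rT^-1 <= (C4 + v + 2) * (r / rT) by rewrite ler_wpM2l//; lra.
have h5 : 0 <= (16 * C4 + 3 * v + 16 * v ^+ 2) * (r / rT) by rewrite mulr_ge0//; lra.
have h6 : 0 <= (C4 + v + 2) * w by rewrite mulr_ge0//; lra.
move: h1 h2 h3 h4 h5 h6; clear -C0; clearbody w.
move: (r / rT) (r / T) rT^-1 ((N * T + N ^+ 2) * b) (v ^+ 2) => *; nra.
Qed.

(** * Signal strength and the size of the coefficients *)

Section SignalRate.
Context {R : realType} {m n : nat} (A : 'M[R]_(m, n)).
Variables (x1 x2 : R).
Hypotheses (m0 : (0 < m)%N) (n0 : (0 < n)%N).
Hypotheses (x1_gt0 : 0 < x1) (x2_gt0 : 0 < x2).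
Hypothesis cond : x1 <= (singular_values A)`_(\rank A).-1 / (singular_values A)`_0.
Hypothesis strength : x2 * (m%:R * n%:R) <= frob A ^+ 2.
Hypothesis bounded : forall i j, `|A i j| <= 1.

Let s := singular_values A.

(** With [0^-1 = 0], a vanishing top singular value would make the ratio 0, against [0 < x1]. *)
Let s0 : s`_0 != 0.
Proof.
by apply/eqP => s0; move: cond; rewrite -/s s0 invr0 mulr0 leNgt x1_gt0.
Qed.

Lemma signal_svd : exists U V, is_svd A s U V.
Proof. exact: singular_values_svd. Qed.

Let frob_gt0 : 0 < frob A ^+ 2.
Proof. by apply: lt_le_trans strength; rewrite !mulr_gt0// ltr0n. Qed.

Lemma signal_rank_gt0 : (0 < \rank A)%N.
Proof.
have [U [V svd]] := signal_svd; have := svd_frob svd.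
by case: (\rank A) => //; rewrite mul0r leNgt frob_gt0.
Qed.

Let s_ge0 l : 0 <= s`_l.
Proof.
have [U [V [_ [_ /allP pos] _ _ _]]] := signal_svd.
by have [ls|ls] := ltnP l (size s); [apply/pos/mem_nth|rewrite nth_default].
Qed.

(** The squared Frobenius norm is at most the rank times the largest squared singular value, which
    the condition number compares with the smallest nonzero one; [x1 * sqrt x2] is xi'''. *)
Lemma signal_gap : (x1 * Num.sqrt x2) ^+ 2 * (m%:R * n%:R) <= (\rank A)%:R * s`_(\rank A).-1 ^+ 2.
Proof.
have [U [V svd]] := signal_svd; have := svd_frob svd => fr.
rewrite exprMn (sqr_sqrtr (ltW x2_gt0)) -mulrA.
apply: (@le_trans _ _ (x1 ^+ 2 * frob A ^+ 2)); first by rewrite ler_wpM2l// sqr_ge0.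
apply: (@le_trans _ _ (x1 ^+ 2 * ((\rank A)%:R * s`_0 ^+ 2))).
  by rewrite ler_wpM2l// sqr_ge0.
rewrite mulrCA ler_wpM2l// -exprMn lerXn2r// ?nnegrE ?(mulr_ge0 (ltW x1_gt0)) ?s_ge0//.
by rewrite -ler_pdivlMr// lt_def s0 s_ge0.
Qed.

Lemma signal_cond_le1 : x1 * Num.sqrt x2 <= 1.
Proof.
have x1_1 : x1 <= 1.
  apply: (le_trans cond); rewrite ler_pdivrMr ?mul1r ?lt_def ?s0 ?s_ge0//.
  have [U [V [sz [srt _] _ _ _]]] := signal_svd.
  have [ls|ls] := ltnP (\rank A).-1 (size s); last by rewrite [leLHS]nth_default// s_ge0.
  have ge_tr : transitive (fun x y : R => x >= y) by move=> y x z xy yz; exact: le_trans yz xy.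
  apply: (sorted_leq_nth ge_tr (fun x => lexx x) 0 srt) => //; rewrite ?inE//.
  exact: leq_ltn_trans ls.
have x2_1 : x2 <= 1.
  have mn : 0 < m%:R * n%:R :> R by rewrite mulr_gt0// ltr0n.
  rewrite -(ler_pM2r mn) mul1r; apply: (le_trans strength).
  rewrite frob_sqr; apply: (@le_trans _ _ (\sum_(i < m) \sum_(j < n) 1)).
    apply: ler_sum => i _; apply: ler_sum => j _.
    by rewrite -real_normK ?num_real// expr_le1.
  by under eq_bigr do rewrite sumr_const card_ord; rewrite sumr_const card_ord mulr_natl.
rewrite -[leRHS]mulr1 (ler_pM (ltW x1_gt0))// ?sqrtr_ge0//.
by rewrite -sqrtr1 ler_sqrt.
Qed.

Variable beta : 'cV[R]_n.
Let zeta := A *m beta.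
Let al := mpinv A *m zeta.
Let b := (mpinv A)^T *m al.
Hypothesis zeta_le : sqn zeta <= m%:R.

Lemma residual_rate (v C4 : R) : 0 <= v -> 0 <= C4 ->
  m%:R^-1 * (2 * m%:R * v * sqn al +
     8 * ((n%:R * m%:R ^+ 2 + n%:R ^+ 2 * m%:R) * (C4 + v ^+ 2)) * sqn b +
     Num.sqrt m%:R * (C4 + v + 2) + v * (\rank A)%:R) <=
  (17 * C4 + 4 * v + 2 + 16 * v ^+ 2) * ((\rank A)%:R / Num.sqrt m%:R +
    (\rank A)%:R ^+ 2 / ((x1 * Num.sqrt x2) ^+ 4 * Num.min m%:R n%:R)).
Proof.
move=> v0 C0; have [U [V svd]] := signal_svd.
apply: (@residual_rate_arith _ _ _ _ _ _ _ (s`_(\rank A).-1 ^+ 2)) => //; rewrite ?ler1n ?sqr_ge0 ?sqn_ge0//.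
- exact: signal_rank_gt0.
- by rewrite mulr_gt0// sqrtr_gt0.
- exact: signal_cond_le1.
- exact: signal_gap.
- exact: le_trans (mpinv_le svd beta) zeta_le.
- exact: mpinv_dual_le svd beta.
Qed.

End SignalRate.

(** * The estimator *)

Section Instance.
Context {R : realType} (p : panel R) (K Q : probability (Om p) R) (x : Om p).
Variables sigma xi : R.
Hypotheses (sigma_gt0 : 0 < sigma) (xi_gt0 : 0 < xi).
Hypothesis model : conditional_model K Q x.
Hypothesis H2 : forall t i (a : assignment p), ('E_K[noise t i a] = 0)%E.
Hypothesis H6 : independent_noise (p := p) K.
Hypothesis H6' : forall t i (a : assignment p),
  ('V_K[noise t i a] = (sigma ^+ 2)%:E)%E /\
  (psi2_norm K (noise t i a) <= (xi * sigma)%:E)%E.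
Hypothesis H7 : forall t i (a : assignment p),
  ((-1)%:E <= 'E_K[Y t i a] <= 1%:E)%E.

Let C4 : R := 4 * (2 * (xi * sigma)) ^+ 4.
Let shocks : noise_array Q (shock x) (sigma ^+ 2) C4.
Proof. exact: shock_noise_array model H2 H6 H6'. Qed.

Lemma expectation_Z t i : ('E_Q[fun y => Z y t i] = (signal x t i)%:E)%E.
Proof.
have iS := noise_rintegrable1 shocks (t, i).
have h := rintegrableD iS (@rintegrable_cst _ _ _ Q (signal x t i)).
have e : (fun y => Z y t i) = fun y => shock x (t, i) y + signal x t i.
  by apply/funext => y; rewrite /shock subrK.
rewrite e unlock -[LHS]fineK; last exact: integrable_fin_num h.
congr EFin; have := RintegralDT iS (@rintegrable_cst _ _ _ Q (signal x t i)).
by rewrite (noise_mean shocks) Rintegral_prob_cst add0r.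
Qed.

Variables (n : 'I_(nunit p)) (I : {set 'I_(nunit p)}).

Definition signal_tr : 'M[R]_(Ttr p, #|I|) :=
  \matrix_(t, k) signal x (lshift (Tpr p) t) (enum_val k).
Definition signal_pr : 'M[R]_(Tpr p, #|I|) :=
  \matrix_(t, k) signal x (rshift (Ttr p) t) (enum_val k).
Definition signal_n : 'cV[R]_(Ttr p) := \col_t signal x (lshift (Tpr p) t) n.

Lemma EZtrE : EZtr Q I = signal_tr.
Proof.
apply/matrixP => t k; rewrite !mxE -[RHS]/(fine (signal x _ _)%:E) -expectation_Z.
by congr (fine 'E_Q[_]); apply/funext => y; rewrite !mxE.
Qed.

Lemma EZprE : EZpr Q I = signal_pr.
Proof.
apply/matrixP => t k; rewrite !mxE -[RHS]/(fine (signal x _ _)%:E) -expectation_Z.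
by congr (fine 'E_Q[_]); apply/funext => y; rewrite !mxE.
Qed.

Lemma mean_ztrE : mean_mx Q (ztr n) = signal_n.
Proof.
apply/matrixP => t k; rewrite !mxE -[RHS]/(fine (signal x _ _)%:E) -expectation_Z.
by congr (fine 'E_Q[_]); apply/funext => y; rewrite !mxE.
Qed.

Lemma ZtrE y : Ztr I y = signal_tr +
  \matrix_(t, k) shock x (lshift (Tpr p) t, enum_val k) y.
Proof. by apply/matrixP => t k; rewrite !mxE /shock !mxE /=; ring. Qed.

Lemma ZprE y : Zpr I y = signal_pr +
  \matrix_(t, k) shock x (rshift (Ttr p) t, enum_val k) y.
Proof. by apply/matrixP => t k; rewrite !mxE /shock !mxE /=; ring. Qed.

Lemma ztrE y : ztr n y = signal_n + \col_t shock x (lshift (Tpr p) t, n) y.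
Proof. by apply/matrixP => t k; rewrite !mxE /shock !mxE /=; ring. Qed.

Section span.
Variables (ta : assignment p) (pi : 'I_(nunit p) -> seq 'I_(nunit p)).
Hypothesis pi_ok : forall i, i \in I ->
  perm_eq (pi i) (nbr i) /\ matching (A x) n ta (pi i).
Hypothesis pi_span : in_donor_span n I pi x.
Let q := size (nbr n).

(** Summing over positions instead of neighbours separates the factors of the unit from the list
    [bs] of treatments, which donor and target share. [d0] is a default for [nth]. *)
Let factor_sum_utilde t (d0 : 'I_(ntreat p)) (a : assignment p) i s bs :
  size s = q -> [seq a j | j <- s] = bs ->
  \sum_(j <- s) \sum_(k < rk p) u j i x 0 k * w t (a j) x 0 k =
  \sum_(l < q) \sum_(k < rk p)
    utilde q i s x 0 (mxvec_index l k) * w t (nth d0 bs l) x 0 k.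
Proof.
move=> sq <-; rewrite (big_nth i) sq big_mkord; apply: eq_bigr => l _.
apply: eq_bigr => k _; rewrite mxvecE mxE (nth_map i)//.
by rewrite sq.
Qed.

(** The span coefficients involve the unit factors alone, while measurement and treatment enter
    through [w], position by position; hence one [beta] serves both training under the observed
    treatments and prediction under [ta]. *)
Lemma donor_combination : exists beta : 'cV[R]_#|I|,
  signal_n = signal_tr *m beta /\
  forall t, factor_mean (rshift (Ttr p) t) n ta x = (signal_pr *m beta) t 0.
Proof.
have /submxP[D De] := pi_span.
have comb t (d0 : 'I_(ntreat p)) (a : assignment p) (bs : seq 'I_(ntreat p)) (b : assignment p) :
    [seq b j | j <- nbr n] = bs ->
    (forall i, i \in I -> [seq a j | j <- pi i] = bs) ->
    factor_mean t n b x = \sum_k factor_mean t (enum_val k) a x * D 0 k.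
  move=> bn api; rewrite /factor_mean (factor_sum_utilde _ d0 _ erefl bn).
  have pe i : i \in I -> \sum_(j <- nbr i) \sum_(k < rk p) u j i x 0 k * w t (a j) x 0 k =
      \sum_(l < q) \sum_(k < rk p)
        utilde q i (pi i) x 0 (mxvec_index l k) * w t (nth d0 bs l) x 0 k.
    move=> iI; have [pe _] := pi_ok iI; rewrite -(perm_big _ pe)/=.
    apply: factor_sum_utilde; last exact: api.
    by rewrite -(size_map a) api// -bn size_map.
  under [RHS]eq_bigr do rewrite pe ?enum_valP// mulr_suml.
  rewrite [RHS]exchange_big/=; apply: eq_bigr => l _.
  under [RHS]eq_bigr do rewrite mulr_suml.
  rewrite [RHS]exchange_big/=; apply: eq_bigr => k _.
  rewrite De mxE mulr_suml; apply: eq_bigr => i _; rewrite mxE; ring.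
exists D^T; split.
  apply/colP => t; rewrite !mxE /signal.
  rewrite (comb _ (A x n (lshift (Tpr p) t)) (observed x (lshift (Tpr p) t))
    [seq A x j (lshift (Tpr p) t) | j <- nbr n]).
  - by apply: eq_bigr => k _; rewrite !mxE.
  - by apply: eq_map => j; rewrite ffunE.
  - move=> i /pi_ok[_ /andP[/forallP/(_ t)/eqP <- _]].
    by apply: eq_map => j; rewrite ffunE.
move=> t; rewrite mxE.
rewrite (comb _ (ta n) (observed x (rshift (Ttr p) t)) (restr n ta))//.
- by apply: eq_bigr => k _; rewrite !mxE.
- move=> i /pi_ok[_ /andP[_ /forallP/(_ t)/eqP <-]].
  by apply: eq_map => j; rewrite ffunE.
Qed.

End span.

Lemma measurable_ztr t : measurable_fun setT (fun y => ztr (p := p) n y t 0).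
Proof.
have -> : (fun y => ztr n y t 0) = fun y => Z y (lshift (Tpr p) t) n.
  by apply/funext => y; rewrite !mxE.
exact: measurable_Z.
Qed.

Lemma measurable_Ztr t k : measurable_fun setT (fun y => Ztr (p := p) I y t k).
Proof.
have -> : (fun y => Ztr I y t k) = fun y => Z y (lshift (Tpr p) t) (enum_val k).
  by apply/funext => y; rewrite !mxE.
exact: measurable_Z.
Qed.

Lemma measurable_Zpr t k : measurable_fun setT (fun y => Zpr (p := p) I y t k).
Proof.
have -> : (fun y => Zpr I y t k) = fun y => Z y (rshift (Ttr p) t) (enum_val k).
  by apply/funext => y; rewrite !mxE.
exact: measurable_Z.
Qed.

Section estimator.
Variables (kappa : nat) (s : Om p -> seq R)
  (mu : Om p -> 'M[R]_(Ttr p, minn (Ttr p) #|I|))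
  (nu : Om p -> 'M[R]_(#|I|, minn (Ttr p) #|I|)).
Hypothesis svd : svd_of_Ztr s mu nu.
Let ah := alpha_hat kappa n s mu nu.

Let sub : sigma_mx (Ztr (p := p) I) `<=` measurable.
Proof. by apply: sigma_gen_measurable => _ [t [k ->]]; exact: measurable_Ztr. Qed.

Lemma measurable_alpha_hat k : measurable_fun setT (fun y => ah y k 0).
Proof.
have [svdX mmu mnu] := svd.
have ms l := measurable_for_fun sub (singular_value_measurable svdX mmu mnu l).
(* On nonnegative reals the power of exponent -1 is the inverse, at 0 included, and it is a
   measurable function. *)
have -> : (fun y => ah y k 0) = fun y => \sum_t
    (\sum_(l < minn (Ttr p) #|I|)
      (l < kappa)%N%:R * ((s y)`_l `^ (-1) * (nu y k l * mu y t l))) * ztr n y t 0.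
  apply/funext => y; rewrite /ah /alpha_hat mxE; apply: eq_bigr => t _; congr (_ * _).
  rewrite summxE big_mkcond; apply: eq_bigr => l _.
  case: ifP => _; last by rewrite mul0r.
  rewrite mul1r !mxE big_ord1 !mxE powR_inv1//.
  have [sz [_ /allP pos] _ _ _] := svdX y.
  by apply: pos; apply: mem_nth; rewrite sz.
apply: measurable_sum => t; apply: measurable_funM; last exact: measurable_ztr.
apply: measurable_sum => l; apply: measurable_funM => //; apply: measurable_funM.
  exact: (measurableT_comp (measurable_powR (-1)) (ms l)).
by apply: measurable_funM; apply: measurable_for_fun sub _; [exact: mnu|exact: mmu].
Qed.

Lemma measurable_IPO_hat : measurable_fun setT (IPO_hat ah).
Proof.
apply: measurable_funM => //; apply: measurable_sum => t.
under eq_fun do rewrite mxE.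
apply: measurable_sum => k; apply: measurable_funM; first exact: measurable_Zpr.
exact: measurable_alpha_hat.
Qed.

Lemma measurable_norm2_error (al : 'cV[R]_#|I|) : measurable_fun setT (fun y => norm2 (ah y - al)).
Proof.
have -> : (fun y => norm2 (ah y - al)) =
    fun y => (\sum_k (ah y k 0 - al k 0) ^+ 2) `^ (2^-1).
  apply/funext => y; rewrite -[LHS]ger0_norm ?norm2_ge0// -sqrtr_sqr norm2_sqr.
  rewrite powR12_sqrt; last by apply: sumr_ge0 => k _; exact: sqr_ge0.
  by congr Num.sqrt; apply: eq_bigr => k _; rewrite !mxE.
apply: (measurableT_comp (measurable_powR _)).
apply: measurable_sum => k; apply: measurable_funX.
by apply: measurable_funB => //; exact: measurable_alpha_hat.
Qed.

Lemma sigma2_hatE y : sigma2_hat n ah y = (Ttr p)%:R^-1 *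
  sqn (ztr n y - lproj (s y) (mu y) kappa *m ztr n y).
Proof.
have [svdX _ _] := svd.
by rewrite /sigma2_hat norm2_sqr /ah /alpha_hat (trunc_svd_fit (svdX y)).
Qed.

End estimator.

End Instance.

Lemma noise_array_reindex (R : realType) d (Om : measurableType d)
    (Q : probability Om R) (I J : finType) (e : I -> Om -> R) (v C4 : R) (h : J -> I) :
  injective h -> noise_array Q e v C4 -> noise_array Q (fun j => e (h j)) v C4.
Proof.
move=> hi [me ind i4 mom]; split => // J' B _ mB.
(* Events on the subfamily become events on the full family, with no constraint outside the image of
   [h]. *)
pose B' i := if [pick j | h j == i] is Some j then B j else setT.
have B'h j : B' (h j) = B j.
  by rewrite /B'; case: pickP => [k /eqP/hi -> //|/(_ j)]; rewrite eqxx.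
have mB' i : measurable (B' i).
  by rewrite /B'; case: pickP => // _; exact: measurableT.
have := ind [set h j | j in J']%SET B' (finset.subsetT _) mB'.
rewrite big_imset/=; last by move=> ? ? _ _; exact: hi.
under [X in _ = X -> _]eq_bigr do rewrite B'h.
move=> <-; congr (fine (Q _)); apply/seteqP; split => y hy i /= iJ.
  by case/imsetP : iJ => j jJ ->; rewrite B'h; exact: hy.
by have := hy (h i); rewrite /= B'h; apply; exact: imset_f.
Qed.

(** * Prediction error and variance estimate at one instance *)

Section Claims.
Context {R : realType} (p : panel R) (K Q : probability (Om p) R) (x : Om p).
Variables sigma xi : R.
Hypotheses (sigma_gt0 : 0 < sigma) (xi_gt0 : 0 < xi).
Hypothesis model : conditional_model K Q x.
Hypothesis H2 : forall t i (a : assignment p), ('E_K[noise t i a] = 0)%E.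
Hypothesis H6 : independent_noise (p := p) K.
Hypothesis H6' : forall t i (a : assignment p),
  ('V_K[noise t i a] = (sigma ^+ 2)%:E)%E /\
  (psi2_norm K (noise t i a) <= (xi * sigma)%:E)%E.
Hypothesis H7 : forall t i (a : assignment p),
  ((-1)%:E <= 'E_K[Y t i a] <= 1%:E)%E.
Variables (n : 'I_(nunit p)) (ta : assignment p).
Let I := donors (A x) n ta.
Hypotheses (Ttr_gt0 : (0 < Ttr p)%N) (card_gt0 : (0 < #|I|)%N).
Variable pi : 'I_(nunit p) -> seq 'I_(nunit p).
Hypothesis pi_ok : donor_orderings (A x) n ta pi.
Hypothesis H4 : in_donor_span n I pi x.
Hypothesis H5 : (EZpr Q I <= EZtr Q I)%MS.
Variables x1 x2 : R.
Hypotheses (x1_gt0 : 0 < x1) (x2_gt0 : 0 < x2).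
Hypothesis H8 : x1 <= (singular_values (EZtr Q I))`_(rtr Q I).-1 / (singular_values (EZtr Q I))`_0.
Hypothesis H8' : x2 * ((Ttr p)%:R * #|I|%:R) <= frob (EZtr Q I) ^+ 2.
Variables (s : Om p -> seq R)
  (mu : Om p -> 'M[R]_(Ttr p, minn (Ttr p) #|I|))
  (nu : Om p -> 'M[R]_(#|I|, minn (Ttr p) #|I|)).
Hypothesis svd : svd_of_Ztr s mu nu.

Let C4 : R := 4 * (2 * (xi * sigma)) ^+ 4.
Let ah := alpha_hat (rtr Q I) n s mu nu.
Let al := alpha Q I n.
Let r := rtr Q I.
Let N : R := #|I|%:R.
Let T1 : R := (Ttr p)%:R.
Let T2 : R := (Tpr p)%:R.
Let N_gt0 : 0 < N. Proof. by rewrite ltr0n. Qed.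
Let T2_gt0 : 0 < T2. Proof. by rewrite ltr0n Tpr_gt0. Qed.

Let shocks : noise_array Q (shock x) (sigma ^+ 2) C4.
Proof. exact: shock_noise_array model H2 H6 H6'. Qed.

Let Atr := signal_tr x I.
Let Apr := signal_pr x I.
Let EtrE : EZtr Q I = Atr := EZtrE sigma_gt0 xi_gt0 model H2 H6 H6' I.
Let EprE : EZpr Q I = Apr := EZprE sigma_gt0 xi_gt0 model H2 H6 H6' I.
Let EnE : mean_mx Q (ztr n) = signal_n x n := mean_ztrE sigma_gt0 xi_gt0 model H2 H6 H6' n.

Let F_le t i : `|signal x t i| <= 1.
Proof. exact: signal_bound model H2 H6' H7 t i. Qed.

Let Atr_le i j : `|EZtr Q I i j| <= 1. Proof. by rewrite EtrE mxE F_le. Qed.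


Let svdA : exists U V, is_svd (EZtr Q I) (singular_values (EZtr Q I)) U V.
Proof. exact: signal_svd x1_gt0 H8. Qed.

Let alE : exists beta, [/\ signal_n x n = EZtr Q I *m beta,
  al = mpinv (EZtr Q I) *m (EZtr Q I *m beta) &
  forall t, factor_mean (rshift (Ttr p) t) n ta x = (EZpr Q I *m al) t 0].
Proof.
have [beta [e1 e2]] := donor_combination pi_ok H4.
have ea : al = mpinv (EZtr Q I) *m (EZtr Q I *m beta).
  by rewrite /al /alpha EnE e1 EtrE.
exists beta; split => //; first by rewrite e1 EtrE.
have [U [V svd0]] := svdA.
by move=> t; rewrite e2 ea (rowspace_mpinv svd0 _ H5) EprE.
Qed.

Lemma IPOE : IPO K n ta = T2^-1 * \sum_t (Apr *m al) t 0.
Proof.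
have [_ [_ _ e]] := alE; rewrite /IPO; congr (_ * _); apply: eq_bigr => t _.
by rewrite (expectation_Y sigma_gt0 xi_gt0 model H2 H6') e EprE.
Qed.

Let sh (tk : 'I_(Tpr p) * 'I_#|I|) : Om p -> R := shock x (rshift (Ttr p) tk.1, enum_val tk.2).

Let sh_noise : noise_array Q sh (sigma ^+ 2) C4.
Proof.
apply: (noise_array_reindex (h := fun tk => (rshift (Ttr p) tk.1, enum_val tk.2))) shocks.
move=> [t k] [t' k'] h; have := congr1 fst h; have := congr1 snd h => /=.
by move=> /enum_val_inj -> /rshift_inj ->.
Qed.

Definition clt_weight (tk : 'I_(Tpr p) * 'I_#|I|) : R :=
  - al tk.2 0 / (Num.sqrt T2 * sigma * norm2 al).

Hypothesis al_gt0 : 0 < norm2 al.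

Let scale := (Num.sqrt T2 * sigma * norm2 al)^-1.
Let scale_gt0 : 0 < scale.
Proof. by rewrite invr_gt0 !mulr_gt0// sqrtr_gt0. Qed.

(** A coordinate of [al] is at most its norm, so the bound on the weights holds even if [al] charges
    a single donor: smallness comes from the number of prediction measurements. *)
Lemma prediction_weighted_array :
  weighted_array Q sh clt_weight (sigma ^+ 2) C4 (sigma * Num.sqrt T2)^-1.
Proof.
have [msh ind i4 mom] := sh_noise.
have alk k : `|al k 0| <= norm2 al.
  rewrite -(ler_pXn2r (n := 2)) ?nnegrE ?norm2_ge0// real_normK ?num_real// norm2_sqr.
  by rewrite /sqn (bigD1 k)//= lerDl sumr_ge0// => ? _; exact: sqr_ge0.
split => //.
- move=> [t k]; rewrite /clt_weight /= normrM normrN -/scale (gtr0_norm scale_gt0).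
  rewrite -ler_pdivlMr// (_ : _ / scale = norm2 al) ?alk// /scale invrK; field.
  by rewrite !gt_eqF// sqrtr_gt0.
- rewrite (eq_bigr (fun tk => scale ^+ 2 * al tk.2 0 ^+ 2)); last first.
    by move=> tk _; rewrite /clt_weight -/scale exprMn sqrrN mulrC.
  rewrite -mulr_sumr -(pair_bigA _ (fun (t : 'I_(Tpr p)) k => al k 0 ^+ 2))/=.
  rewrite sumr_const card_ord -[\sum_k _]/(sqn al) -norm2_sqr -mulr_natl -/T2.
  rewrite /scale exprVn !exprMn sqr_sqrtr ?(ltW T2_gt0)//; field.
  by rewrite !gt_eqF.
Qed.

Let S (y : Om p) : 'cV[R]_#|I| := \col_k \sum_t sh (t, k) y.

Let S_moment : rintegrable Q (fun y => sqn (S y)) /\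
  \int[Q]_y sqn (S y) = N * T2 * sigma ^+ 2.
Proof.
have -> : (fun y => sqn (S y)) = fun y => \sum_k \sum_t \sum_t' sh (t, k) y * sh (t', k) y.
  apply/funext => y; apply: eq_bigr => k _; rewrite mxE expr2 mulr_suml.
  by apply: eq_bigr => t _; rewrite mulr_sumr.
have i3 k t t' : rintegrable Q (fun y => sh (t, k) y * sh (t', k) y).
  exact: (noise_rintegrable2 sh_noise).
have i2 k t : rintegrable Q (fun y => \sum_t' sh (t, k) y * sh (t', k) y).
  exact: rintegrable_sum.
have i1 k : rintegrable Q (fun y => \sum_t \sum_t' sh (t, k) y * sh (t', k) y).
  exact: rintegrable_sum.
split; first exact: rintegrable_sum.
rewrite Rintegral_sum// (eq_bigr (fun=> T2 * sigma ^+ 2)) => [|k _].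
  by rewrite sumr_const card_ord -mulrA -[_ *+ _]mulr_natl.
rewrite Rintegral_sum// (eq_bigr (fun=> sigma ^+ 2)) => [|t _].
  by rewrite sumr_const card_ord -[_ *+ _]mulr_natl.
rewrite Rintegral_sum// (bigD1 t)//= big1 ?addr0 => [|t' tt'].
  by rewrite (noise_orth sh_noise) eqxx mul1r.
by rewrite (noise_orth sh_noise) xpair_eqE eqxx andbT eq_sym (negbTE tt') mul0r.
Qed.

Let V (y : Om p) := Num.sqrt T2 / (sigma * norm2 al) * (IPO K n ta - IPO_hat ah y).

Lemma measurable_statistic : measurable_fun setT V.
Proof.
apply: measurable_funM => //; apply: measurable_funB => //.
exact: measurable_IPO_hat.
Qed.

Let remainderE y : V y - \sum_tk clt_weight tk * sh tk y =
  - scale * \sum_t (Zpr I y *m (ah y - al)) t 0.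
Proof.
have -> : \sum_tk clt_weight tk * sh tk y =
    - scale * \sum_t ((Zpr I y - Apr) *m al) t 0.
  rewrite (ZprE x I y) addrAC subrr add0r mulr_sumr.
  rewrite (eq_bigr (fun tk => clt_weight (tk.1, tk.2) * sh (tk.1, tk.2) y)); last by case.
  rewrite -(pair_bigA _ (fun t k => clt_weight (t, k) * sh (t, k) y))/=.
  apply: eq_bigr => t _; rewrite mxE mulr_sumr; apply: eq_bigr => k _.
  by rewrite [in RHS]mxE /clt_weight -/scale/= /sh/=; ring.
rewrite /V IPOE /IPO_hat -/T2 -mulrBr mulrA -sumrB.
have -> : Num.sqrt T2 / (sigma * norm2 al) * T2^-1 = scale.
  rewrite /scale -{2}(sqr_sqrtr (ltW T2_gt0)); field.
  by rewrite !gt_eqF// sqrtr_gt0.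
rewrite !mulNr opprK -mulrDr -big_split/= -mulrN -sumrN; congr (_ * _).
apply: eq_bigr => t _; rewrite mulmxBl mulmxBr; move: (Apr *m al) (Zpr I y *m al) => a b.
by rewrite !mxE; ring.
Qed.

(** Cauchy-Schwarz between [Delta] and the column sums of [Zpr]. The signals contribute at most [T2]
    per donor; the threshold on [S] is set to the same size, whence the factor 2. *)
Let remainder_le y : sqn (S y) <= N * T2 ^+ 2 ->
  `|V y - \sum_tk clt_weight tk * sh tk y| <=
    2 * (norm2 (ah y - al) / (sigma * norm2 al / Num.sqrt (T2 * N))).
Proof.
move=> hS; set D := ah y - al.
pose a : 'cV[R]_#|I| := \col_k \sum_t Apr t k.
have e : \sum_t (Zpr I y *m D) t 0 = ((a + S y)^T *m D) 0 0.
  rewrite (ZprE x I y) mxE; under eq_bigr do rewrite mxE.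
  rewrite exchange_big/=; apply: eq_bigr => k _; rewrite -mulr_suml; congr (_ * _).
  by rewrite !mxE -big_split/=; apply: eq_bigr => t _; rewrite !mxE.
have a_le : sqn a <= N * T2 ^+ 2.
  apply: (@le_trans _ _ (\sum_(k < #|I|) T2 ^+ 2)); last first.
    by rewrite sumr_const card_ord -[_ *+ _]mulr_natl.
  have T20 := ltW T2_gt0.
  apply: ler_sum => k _; rewrite mxE -real_normK ?num_real// lerXn2r ?nnegrE//.
  apply: (le_trans (ler_norm_sum _ _ _)).
  apply: (@le_trans _ _ (\sum_(t < Tpr p) 1)).
    by apply: ler_sum => t _; rewrite mxE F_le.
  by rewrite sumr_const card_ord.
have q : (2 * (Num.sqrt N * T2)) ^+ 2 = 4 * (N * T2 ^+ 2).
  by rewrite !exprMn sqr_sqrtr ?ltW//; ring.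
have le1 : `|((a + S y)^T *m D) 0 0| <= 2 * (Num.sqrt N * T2) * norm2 D.
  rewrite -(ler_pXn2r (n := 2)) ?nnegrE ?mulr_ge0 ?sqrtr_ge0 ?norm2_ge0 ?(ltW T2_gt0)//.
  rewrite real_normK ?num_real// exprMn q norm2_sqr.
  apply: (le_trans (dot_le _ _)); rewrite ler_wpM2r ?sqn_ge0//.
  have := sqn_le_double a (- S y); rewrite opprK sqnN; lra.
rewrite remainderE e normrM normrN (gtr0_norm scale_gt0).
apply: (le_trans (ler_wpM2l (ltW scale_gt0) le1)).
rewrite le_eqVlt; apply/orP; left; apply/eqP.
rewrite /scale sqrtrM ?(ltW T2_gt0)// -{2}(sqr_sqrtr (ltW T2_gt0)); field.
rewrite (gt_eqF al_gt0) (gt_eqF sigma_gt0) !gt_eqF// sqrtr_gt0//.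
Qed.

(** The mean of [sqn (S y)] is [N T2 sigma^2], a fraction [sigma^2 / T2] of the threshold of
    [remainder_le]; Markov's inequality gives the second term. *)
Lemma remainder_prob (chi eps : R) : 0 < eps -> 0 < chi ->
  chi <= sigma * norm2 al / Num.sqrt (T2 * N) ->
  (Q [set y | (eps < `|V y - \sum_tk clt_weight tk * sh tk y|)%R] <=
   Q [set y | (eps / 2 < `|norm2 (ah y - al) / chi|)%R] + (sigma ^+ 2 / T2)%:E)%E.
Proof.
move=> eps0 chi0 chi_le.
have [iS eS] := S_moment.
have k0 : 0 < N * T2 ^+ 2 by rewrite mulr_gt0// exprn_gt0.
have msh tk : measurable_fun setT (sh tk) by exact: measurable_shock.
have m1 : measurable [set y | eps / 2 < `|norm2 (ah y - al) / chi|].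
  apply: measurable_gt; apply: measurableT_comp => //; apply: measurable_funM => //.
  exact: measurable_norm2_error.
have m2 : measurable [set y | N * T2 ^+ 2 < sqn (S y)].
  by apply: measurable_gt; exact: rintegrable_measurable iS.
have mrem : measurable [set y | eps < `|V y - \sum_tk clt_weight tk * sh tk y|].
  apply: measurable_gt; apply: measurableT_comp => //; apply: measurable_funB.
    exact: measurable_statistic.
  by apply: measurable_sum => tk; exact: measurable_funM.
apply: (@le_trans _ _ (Q ([set y | eps / 2 < `|norm2 (ah y - al) / chi|] `|`
    [set y | N * T2 ^+ 2 < sqn (S y)]))).
  apply: le_measure; rewrite ?inE//; first exact: measurableU.
  move=> y /= he; have [hS|hS] := ltP (N * T2 ^+ 2) (sqn (S y)); [by right|left].
  have := lt_le_trans he (remainder_le hS).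
  rewrite ger0_norm; last by rewrite divr_ge0 ?norm2_ge0// ltW.
  move=> h; rewrite ltr_pdivrMr// mulrC; apply: (lt_le_trans h).
  rewrite ler_pM2l// ler_wpM2l ?norm2_ge0// lef_pV2 ?posrE//.
  exact: lt_le_trans chi0 chi_le.
apply: (le_trans (measureU2 _ m1 m2)); rewrite leeD2l//.
apply: (le_trans (markov_ineq k0 iS (fun y => sqn_ge0 (S y)))).
rewrite eS lee_fin le_eqVlt; apply/orP; left; apply/eqP; field.
by rewrite !gt_eqF.
Qed.

Definition sigma2_const : R := 17 * C4 + 4 * sigma ^+ 2 + 2 + 16 * (sigma ^+ 2) ^+ 2.

Lemma sigma2_prob (k : R) : 0 < k ->
  (Q [set y | (k < `|(`|sigma2_hat n ah y - sigma ^+ 2|)%R|)%R] <=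
   (sigma2_const * (r%:R / Num.sqrt T1 +
      r%:R ^+ 2 / ((x1 * Num.sqrt x2) ^+ 4 * Num.min T1 N)) / k)%:E)%E.
Proof.
move=> k0; have [U [W svd0]] := svdA.
have [beta [e1 e2 _]] := alE.
have [svdX mmu mnu] := svd.
have alfit : EZtr Q I *m al = signal_n x n by rewrite e2 e1 (mpinv_fit svd0).
have albE : al = (EZtr Q I)^T *m ((mpinv (EZtr Q I))^T *m al).
  by rewrite e2; exact: mpinv_rowspace svd0 beta.
pose f (t : 'I_(Ttr p)) (j : 'I_#|I|) := (lshift (Tpr p) t, enum_val j).
pose g (t : 'I_(Ttr p)) := (lshift (Tpr p) t, n).
have finj t i t' i' : f t i = f t' i' -> t = t' /\ i = i'.
  move=> h; have := congr1 fst h; have := congr1 snd h => /=.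
  by move=> /enum_val_inj -> /lshift_inj ->.
have ginj : injective g by move=> t t' h; exact: lshift_inj (congr1 fst h).
(* Donors differ from [n] by definition, so the target's shocks lie outside the donors' family. *)
have fg t i t' : f t i != g t'.
  apply/eqP => h; have := congr1 snd h => /= eqn.
  by have := enum_valP i; rewrite eqn /I /donors finset.inE eqxx.
have XE : Ztr (p := p) I = fun y => EZtr Q I + \matrix_(t, i) shock x (f t i) y.
  by apply/funext => y; rewrite (ZtrE x I y) EtrE.
have zE y : ztr n y = EZtr Q I *m al + \col_t shock x (g t) y.
  by rewrite (ztrE x n y) alfit.
have zeta_le : sqn (EZtr Q I *m al) <= T1.
  rewrite alfit; apply: (@le_trans _ _ (\sum_(t < Ttr p) 1)).
    by apply: ler_sum => t _; rewrite mxE -real_normK ?num_real// expr_le1.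
  by rewrite sumr_const card_ord.
rewrite XE in svdX mmu mnu.
have [B [iB leB intB]] := residual_bound shocks finj ginj fg albE zeta_le svdX mmu mnu (leqnn (\rank (EZtr Q I))) Ttr_gt0.
have mres := residual_measurable shocks g al svdX mmu mnu (\rank (EZtr Q I)).
have sE y : sigma2_hat n ah y = T1^-1 *
    sqn ((EZtr Q I *m al + \col_t shock x (g t) y) - lproj (s y) (mu y) (\rank (EZtr Q I)) *m
      (EZtr Q I *m al + \col_t shock x (g t) y)).
  by rewrite (sigma2_hatE _ _ svd) -zE.
have B0 y : 0 <= B y by exact: le_trans (leB y).
have rate : \int[Q]_y B y <= sigma2_const * (r%:R / Num.sqrt T1 +
      r%:R ^+ 2 / ((x1 * Num.sqrt x2) ^+ 4 * Num.min T1 N)).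
  apply: (le_trans intB); rewrite e2.
  apply: (residual_rate Ttr_gt0 card_gt0 x1_gt0 x2_gt0 H8 H8' Atr_le) => //.
  - by rewrite -(mpinv_fit svd0 beta) -e2.
  - exact: sqr_ge0.
  - by rewrite /C4 mulr_ge0// exprn_even_ge0.
apply: (@le_trans _ _ (Q [set y | (k < B y)%R])); last first.
  apply: (le_trans (markov_ineq k0 iB B0)); rewrite lee_fin.
  by rewrite ler_wpM2r// invr_ge0 ltW.
apply: le_measure; rewrite ?inE//.
- apply: measurable_gt; do 2 (apply: measurableT_comp => //); apply: measurable_funB => //.
  by rewrite (funext sE); exact: measurable_funM.
- by apply: measurable_gt; exact: rintegrable_measurable iB.
- by move=> y /=; rewrite normr_id sE => h; exact: lt_le_trans h (leB y).
Qed.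

End Claims.

(** * Passage to the limit along the instances *)

Lemma near_natr_ge (R : realType) (f : nat -> nat) (k : R) :
  f m @[m --> \oo] --> \oo -> \forall m \near \oo, k <= (f m)%:R.
Proof.
move=> /cvgnyPge /(_ (Num.bound `|k|)); apply: filterS => m.
rewrite -(ler_nat R); apply: le_trans; apply: le_trans (ler_norm k) _.
exact: ltW (archi_boundP (normr_ge0 k)).
Qed.

Lemma cvg_invr_natr (R : realType) (f : nat -> nat) (k : R) :
  f m @[m --> \oo] --> \oo -> k / (f m)%:R @[m --> \oo] --> 0.
Proof.
move=> fy; apply/cvgrPdist_le => e e0.
apply: filterS2 (near_natr_ge (`|k| / e) fy) (near_natr_ge (1 : R) fy) => m h1 h2.
have p := lt_le_trans ltr01 h2.
rewrite sub0r normrN normrM normfV normr_nat ler_pdivrMr//.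
by rewrite mulrC -ler_pdivrMr.
Qed.

Theorem theorem3 (R : realType) (sigma xi : R)
  (sigma_gt0 : 0 < sigma) (xi_gt0 : 0 < xi)
  (* a sequence of problem instances, each with its conditional laws given LF
     and given LF and A, its target unit and its counterfactual assignment *)
  (M : nat -> panel R)
  (KLF KLFA : forall m, Om (M m) -> probability (Om (M m)) R)
  (rcp_LF : forall m, is_rcp (P (M m)) (sigma_LF (p := M m)) (KLF m))
  (rcp_LFA : forall m, is_rcp (P (M m)) (sigma_LFA (p := M m)) (KLFA m))
  (n : forall m, 'I_(nunit (M m)))
  (ta : forall m, assignment (M m))
  (* (1) *)
  (H1 : forall m, local_interference (M m))
  (* (2) *)
  (H2 : forall m, {ae P (M m), forall x, forall t i a,
     ('E_(KLF m x)[noise t i a] = 0)%E})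
  (* (3) *)
  (H3 : forall m, {ae P (M m), forall x,
     independent_sigma (KLF m x) (sigma_Y (p := M m)) (sigma_A (p := M m))})
  (* (6) *)
  (H6 : forall m, {ae P (M m), forall x,
     independent_noise (p := M m) (KLF m x) /\
     forall t i (a : assignment (M m)),
       ('V_(KLF m x)[noise t i a] = (sigma ^+ 2)%:E)%E /\
       (psi2_norm (KLF m x) (noise t i a) <= (xi * sigma)%:E)%E})
  (* (7) *)
  (H7 : forall m, {ae P (M m), forall x, forall t i a,
     ((-1)%:E <= 'E_(KLF m x)[Y t i a] <= 1%:E)%E}) :
  (* the conclusions hold conditionally on almost every value of (LF, A) *)
  exists2 Nul : forall m, set (Om (M m)),
    forall m, (P (M m)).-negligible (Nul m) &
  forall (x : forall m, Om (M m)) (x_good : forall m, ~ Nul m (x m)),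
  let I m := donors (A (x m)) (n m) (ta m) in
  let Q m := KLFA m (x m) in
  let T1 m : R := (Ttr (M m))%:R in
  let T2 m : R := (Tpr (M m))%:R in
  let cI m : R := #|I m|%:R in
  let r1 m := rtr (Q m) (I m) in
  let al m := alpha (Q m) (I m) (n m) in
  forall (Ttr_oo : Ttr (M m) @[m --> \oo] --> \oo)
    (Tpr_oo : Tpr (M m) @[m --> \oo] --> \oo)
    (card_oo : #|I m| @[m --> \oo] --> \oo)
    (* (4) *)
    (pi : forall m, 'I_(nunit (M m)) -> seq 'I_(nunit (M m)))
    (pi_ok : forall m, donor_orderings (A (x m)) (n m) (ta m) (pi m))
    (H4 : forall m,
       I m != finset.set0 /\ in_donor_span (n m) (I m) (pi m) (x m))
    (* (5) *)
    (H5 : forall m, (EZpr (Q m) (I m) <= EZtr (Q m) (I m))%MS)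
    (* (8) *)
    (xi1 xi2 : nat -> R)
    (xi_pos : forall m, 0 < xi1 m /\ 0 < xi2 m)
    (H8 : forall m,
       let s := singular_values (EZtr (Q m) (I m)) in
       xi1 m <= s`_(r1 m).-1 / s`_0 /\
       xi2 m * (T1 m * cI m) <= frob (EZtr (Q m) (I m)) ^+ 2)
    (* (9) *)
    (kappa : nat -> nat)
    (H9 : forall m, kappa m = r1 m /\
       (r1 m <= rk (M m) * size (nbr (n m)))%N)
    (* the estimator *)
    (shat : forall m, Om (M m) -> seq R)
    (muhat : forall m, Om (M m) ->
       'M[R]_(Ttr (M m), minn (Ttr (M m)) #|I m|))
    (nuhat : forall m, Om (M m) -> 'M[R]_(#|I m|, minn (Ttr (M m)) #|I m|))
    (svd_ok : forall m, svd_of_Ztr (shat m) (muhat m) (nuhat m)),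
  let ah m := alpha_hat (kappa m) (n m) (shat m) (muhat m) (nuhat m) in
  forall (HDelta : oP Q (fun m y => norm2 (ah m y - al m))
       (fun m => Num.min
          (sigma * norm2 (al m) / Num.sqrt (T2 m * cI m))
          (Num.sqrt (norm2 (al m) / sigma)))),
  cvg_in_distribution Q
    (fun m y => Num.sqrt (T2 m) / (sigma * norm2 (al m)) *
       (IPO (KLF m (x m)) (n m) (ta m) - IPO_hat (ah m) y))
    (normal_prob 0 1) /\
  OP Q (fun m y => `|sigma2_hat (n m) (ah m) y - sigma ^+ 2|)
    (fun m => (r1 m)%:R / Num.sqrt (T1 m) +
       (r1 m)%:R ^+ 2 * ln (T1 m * cI m) /
       ((xi1 m * Num.sqrt (xi2 m)) ^+ 4 * Num.min (T1 m) (cI m))).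
Proof.
pose good m (x : Om (M m)) := [/\ conditional_model (KLF m x) (KLFA m x) x,
  forall t i a, ('E_(KLF m x)[noise t i a] = 0)%E,
  independent_noise (p := M m) (KLF m x),
  forall t i (a : assignment (M m)),
     ('V_(KLF m x)[noise t i a] = (sigma ^+ 2)%:E)%E /\
     (psi2_norm (KLF m x) (noise t i a) <= (xi * sigma)%:E)%E &
  forall t i (a : assignment (M m)), ((-1)%:E <= 'E_(KLF m x)[Y t i a] <= 1%:E)%E].
(* The exceptional set is fixed for each instance before the outcomes, the orderings and the
   singular vectors are chosen. *)
exists (fun m => ~` [set x | good m x]).
  move=> m; have h1 := ae_conditional_model (rcp_LF m) (rcp_LFA m) (H3 m).
  have h2 : {ae P (M m), forall x, good m x}.
    apply: filterS2 h1 (filterI (H2 m) (filterI (H6 m) (H7 m))) => x ? [? [[? ?] ?]].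
    by split.
  exact: h2.
move=> x x_good I Q T1 T2 cI r1 al Ttr_oo Tpr_oo card_oo pi pi_ok H4 H5 xi1 xi2 xi_pos
  H8 kappa H9 shat muhat nuhat svd_ok ah HDelta.
have ek : kappa = r1 by apply/funext => m; case: (H9 m).
have {}x_good m : good m (x m) by apply: contrapT; exact: x_good.
have I0 m : (0 < #|I m|)%N by rewrite finset.card_gt0; case: (H4 m).
have T10 : \forall m \near \oo, (0 < Ttr (M m))%N.
  by apply: filterS (near_natr_ge (1 : R) Ttr_oo) => m; rewrite ler1n.
subst kappa.
pose C4 : R := 4 * (2 * (xi * sigma)) ^+ 4.
(* The rate assumed on [Delta] is eventually positive, which excludes [alpha = 0], where its first
   term is 0. *)
have al0 : \forall m \near \oo, 0 < norm2 (al m).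
  case: HDelta => + _; apply: filterS => m; rewrite lt_min => /andP[h _].
  rewrite lt_def norm2_ge0 andbT; apply/negP => /eqP e.
  by move: h; rewrite e mulr0 mul0r ltxx.
split.
  refine (@clt_slutsky R _ _ Q (fun m => ('I_(Tpr (M m)) * 'I_#|I m|)%type : finType)
    (fun m tk => shock (x m) (rshift (Ttr (M m)) tk.1, enum_val tk.2))
    (fun m => @clt_weight R (M m) (KLFA m (x m)) (x m) sigma (n m) (ta m)) (sigma ^+ 2) C4
    (fun m => (sigma * Num.sqrt (T2 m))^-1) _ _ _ _ _).
  - apply: filterS2 T10 al0 => m T1m alm; have [g1 g2 g3 g4 g5] := x_good m.
    apply: (prediction_weighted_array sigma_gt0 xi_gt0 g1 g2 g3 g4); exact: alm.
  - apply/cvgrPdist_le => e e0.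
    apply: filterS (near_natr_ge ((sigma * e) ^- 2) Tpr_oo) => m h.
    rewrite sub0r normrN normfV normrM (gtr0_norm sigma_gt0) ger0_norm ?sqrtr_ge0//.
    have se : 0 < sigma * e by rewrite mulr_gt0.
    have h' : (sigma * e)^-1 <= Num.sqrt (T2 m).
      rewrite -[leLHS]ger0_norm ?invr_ge0 ?(ltW se)// -sqrtr_sqr ler_sqrt ?exprVn//.
    have i0 : 0 < (sigma * e)^-1 by rewrite invr_gt0.
    have q0 := lt_le_trans i0 h'.
    rewrite invfM -ler_pdivlMl ?invr_gt0// invrK mulrC.
    by rewrite -[leRHS]invrK lef_pV2 ?posrE// [e * sigma]mulrC.
  - by move=> m; apply: measurable_statistic.
  - move=> e e0; have [chi0 hD] := HDelta.
    apply: (@squeeze_cvge _ _ _ _ (fun=> 0%E) _ (fun m =>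
      (Q m [set y | (e / 2 < `|norm2 (ah m y - al m) / Num.min
          (sigma * norm2 (al m) / Num.sqrt (T2 m * cI m))
          (Num.sqrt (norm2 (al m) / sigma))|)%R] + (sigma ^+ 2 / T2 m)%:E)%E)).
    + apply: filterS3 T10 al0 chi0 => m T1m alm chim; rewrite measure_ge0/=.
      have [g1 g2 g3 g4 g5] := x_good m; have [x1m x2m] := xi_pos m.
      have [h8 h8'] := H8 m; have [_ h4] := H4 m.
      apply: (remainder_prob sigma_gt0 xi_gt0 g1 g2 g3 g4 g5 (I0 m) (pi_ok m) h4 (H5 m)
        x1m h8 (svd_ok m) alm e0 chim).
      by rewrite ge_min lexx.
    + exact: cvg_cst.
    + rewrite -[X in _ --> X]adde0; apply: cvgeD => //.
        by apply: hD; rewrite divr_gt0.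
      apply: cvg_EFin; first exact: nearW.
      exact: cvg_invr_natr.
move=> eps eps0.
pose C := sigma2_const sigma xi.
have C0 : 0 <= C.
  have := ltW sigma_gt0; have := ltW xi_gt0 => xi0 s0.
  by rewrite /C /sigma2_const !addr_ge0// ?mulr_ge0// ?sqr_ge0.
(* Markov's inequality leaves at most [C / (C + 1) * eps]; adding 1 makes it strictly less than
   [eps]. *)
exists ((C + 1) / eps).
(* Once [T1] is at least the base of the logarithm, [ln (T1 * cI)] is at least 1, so the rate
   obtained without it is below the stated one. *)
have near_e : \forall m \near \oo, expR 1 <= T1 m by exact: near_natr_ge.
have [m0 _ hm0] := filterI T10 near_e.
exists m0 => m /hm0[T1m em].
have [g1 g2 g3 g4 g5] := x_good m; have [x1m x2m] := xi_pos m.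
have [h8 h8'] := H8 m; have [_ h4] := H4 m.
set A1 := (r1 m)%:R / Num.sqrt (T1 m); set x4 := (xi1 m * Num.sqrt (xi2 m)) ^+ 4.
have T1p : 0 < T1 m by rewrite ltr0n.
have cIp : 0 < cI m by rewrite ltr0n.
have M0 : 0 < Num.min (T1 m) (cI m) by rewrite lt_min T1p.
have x40 : 0 < x4 by rewrite exprn_gt0// mulr_gt0// sqrtr_gt0.
have ln1 : 1 <= ln (T1 m * cI m).
  rewrite -[leLHS](expRK 1) ler_ln ?posrE ?expR_gt0 ?mulr_gt0//.
  by apply: (le_trans em); rewrite ler_peMr ?(ltW T1p)// ler1n.
have rank0 : (0 < r1 m)%N.
  exact: (signal_rank_gt0 T1m (I0 m) x1m x2m h8 h8').
have A10 : 0 < A1 by rewrite divr_gt0 ?ltr0n// sqrtr_gt0.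
set rate := A1 + (r1 m)%:R ^+ 2 / (x4 * Num.min (T1 m) (cI m)).
set chi := A1 + _.
have d0 := mulr_gt0 x40 M0.
have rate_chi : rate <= chi.
  rewrite lerD2l ler_pM2r ?invr_gt0//.
  by rewrite ler_peMr// sqr_ge0.
have rate0 : 0 < rate by rewrite addr_gt0// divr_gt0// exprn_gt0// ltr0n.
have chi0 : 0 < chi by exact: lt_le_trans rate_chi.
have C1 : 0 < C + 1 by rewrite ltr_wpDl.
have k0 : 0 < (C + 1) / eps * chi by rewrite mulr_gt0// divr_gt0.
apply: (le_lt_trans (sigma2_prob (p := M m) (K := KLF m (x m)) (x := x m) sigma_gt0 xi_gt0
  g1 g2 g3 g4 g5 T1m (I0 m) (pi_ok m) h4 (H5 m) x1m x2m h8 h8' (svd_ok m) k0)).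
rewrite lte_fin ltr_pdivrMr//.
rewrite mulrA mulrCA mulfV ?gt_eqF// mulr1.
apply: (@le_lt_trans _ _ (C * chi)); first by rewrite ler_wpM2l.
by rewrite ltr_pM2r// ltrDl.
Qed.
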